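(* For any integers $j>3$ and $k>5$, there is a $k$-MSP graph that contains an induced $j$-cycle (i.e. an induced subgraph isomorphic to the cycle $C_j$).
   Context: All graphs are finite and simple. Polygons are simple polygons (closed planar regions without holes); angles equal to $\pi$ are not considered vertices. The direction of a line segment in the plane is the angle it makes with the $x$-axis. For an integer $k>1$, an allowed direction (with respect to $k$) is one in $\{ i\pi/k : 0\le i<k\}$. A $k$-lizard is a polygon all of whose sides have allowed directions with respect to $k$ (side lengths are arbitrary). A scale of a $k$-lizard $L$ is a maximal convex $k$-lizard contained in $L$: a convex $k$-lizard $S\subseteq L$ such that whenever $T$ is a convex $k$-lizard with $S\subseteq T\subseteq L$, $T=S$. A graph $G$ is a $k$-MSP graph if there exist a $k$-lizard $L$ and a bijection between the vertices of $G$ and the scales of $L$ such that two vertices of $G$ are adjacent if and only if the interiors of the corresponding scales intersect. *)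

(* Defs.v *)
From HB Require Import structures.
From mathcomp Require Import all_boot all_order all_algebra.
From mathcomp Require Import all_classical all_reals all_analysis.

Set Implicit Arguments.
Unset Strict Implicit.
Unset Printing Implicit Defensive.

Import Order.TTheory GRing.Theory Num.Theory.
Import numFieldNormedType.Exports.

Local Open Scope classical_set_scope.
Local Open Scope ring_scope.

Record sgraph := SGraph {
  vertex :> finType;
  adj : rel vertex;
  adj_sym : symmetric adj;
  adj_irrefl : irreflexive adj }.

Definition sgraph_iso (G H : sgraph) : Prop :=
  exists f : G -> H, bijective f /\ forall x y, adj (f x) (f y) = adj x y.

Section InducedSubgraph.
Variables (G : sgraph) (A : {set G}).

Definition induced_adj : rel {x : G | x \in A} :=
  fun x y => adj (val x) (val y).

Lemma induced_adj_sym : symmetric induced_adj.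
Proof. by move=> x y; rewrite /induced_adj adj_sym. Qed.

Lemma induced_adj_irrefl : irreflexive induced_adj.
Proof. by move=> x; rewrite /induced_adj adj_irrefl. Qed.

Definition induced_subgraph : sgraph := SGraph induced_adj_sym induced_adj_irrefl.

End InducedSubgraph.

Section CycleGraph.
Variable j : nat.

(* [ordS] is the cyclic successor on ['I_j].  The conjunct [x != y] only
   matters for [j = 1], where [ordS] has a fixed point. *)
Definition cycle_adj : rel 'I_j :=
  fun x y => (x != y) && ((y == ordS x) || (x == ordS y)).

Lemma cycle_adj_sym : symmetric cycle_adj.
Proof. by move=> x y; rewrite /cycle_adj eq_sym orbC. Qed.

Lemma cycle_adj_irrefl : irreflexive cycle_adj.
Proof. by move=> x; rewrite /cycle_adj eqxx. Qed.

Definition cycle_graph : sgraph := SGraph cycle_adj_sym cycle_adj_irrefl.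

End CycleGraph.

Section Lizards.
Variable R : realType.

Local Notation point := (R * R)%type.

Definition line_segment (a b : point) : set point :=
  [set (1 - t) *: a + t *: b | t in `[0, 1]].

Section Polygon.
Variables (n : nat) (p : 'I_n -> point).

Definition polygon_side (i : 'I_n) : set point := line_segment (p i) (p (ordS i)).

Definition polygon_boundary : set point := \bigcup_(i in [set: 'I_n]) polygon_side i.

(* The last clause says that no angle is equal to pi; angles equal to 0 are
   already excluded by the condition on consecutive sides. *)
Definition simple_closed_chain : Prop :=
  [/\ (2 < n)%N,
      injective p,
      forall i, polygon_side i `&` polygon_side (ordS i) = [set p (ordS i)],
      forall i i', i' != i -> i' != ordS i -> i != ordS i' ->
        polygon_side i `&` polygon_side i' = set0
    & forall i, ~ line_segment (p i) (p (ordS (ordS i))) (p (ordS i))].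

(* The boundary curve together with the bounded component of its complement. *)
Definition polygon_region : set point :=
  polygon_boundary `|`
  [set x | ~ polygon_boundary x /\ bounded_set (connected_component (~` polygon_boundary) x)].

End Polygon.

Definition has_direction (a b : point) (theta : R) : Prop :=
  exists s : R, s != 0 /\ b - a = s *: (cos theta, sin theta).

Definition allowed_direction (k : nat) (theta : R) : Prop :=
  exists i : nat, (i < k)%N /\ theta = i%:R * pi / k%:R.

Definition lizard (k : nat) (L : set point) : Prop :=
  exists (n : nat) (p : 'I_n -> point),
    [/\ simple_closed_chain p,
        L = polygon_region p
      & forall i, exists theta,
          allowed_direction k theta /\ has_direction (p i) (p (ordS i)) theta].

Definition convex_lizard (k : nat) (S : set point) : Prop :=
  lizard k S /\ convex_set (S : set (convex_lmodType point)).

Definition lizard_scale (k : nat) (L S : set point) : Prop :=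
  [/\ convex_lizard k S,
      S `<=` L
    & forall T, convex_lizard k T -> S `<=` T -> T `<=` L -> T = S].

Definition MSP_graph (k : nat) (G : sgraph) : Prop :=
  exists (L : set point) (f : G -> set point),
    [/\ lizard k L,
        set_bij [set: G] [set S | lizard_scale k L S] f
      & forall u v : G, u != v ->
          (adj u v <-> interior (f u) `&` interior (f v) !=set0)].

End Lizards.

(* Main.v *)
Require Import Defs.
From mathcomp Require Import all_boot all_order all_algebra.
From mathcomp Require Import all_classical all_reals all_analysis.
From mathcomp Require Import ring lra zify.

Set Implicit Arguments.
Unset Strict Implicit.
Unset Printing Implicit Defensive.

Import Order.TTheory GRing.Theory Num.Theory.
Import numFieldNormedType.Exports.

Local Open Scope classical_set_scope.
Local Open Scope ring_scope.

(* The lizard is a tower: the trapezoid -20 <= x + v, x - v <= x_R, v <= 1/8, in coordinates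
   (x, v) with v = cot (pi / k) y, minus finitely many open convex "notches" with allowed sides.
   They leave gates, at distance [spacing], along the line v = 0, and a wide part below v = -5.
   That bottom part is a scale, and so is every sufficiently thick "pin", a triangle with sides
   of allowed directions whose apex points downwards and whose two slanted sides pass through
   the feet of one gate: each side of such a triangle contains, in its relative interior, a
   boundary point of the tower past which it cannot be pushed outwards.  Each gate carries a pin
   descending to the left and one descending to the right.  The two overlap, and the latter
   overlaps the left-descending pin of the next gate; the first and the last pin of this zigzag
   are chosen steeper and reach the bottom scale.  No other two of these scales overlap, so they
   form an induced cycle.

   The tower has finitely many scales: a convex lizard is separated from each notch by a line
   of allowed direction, so a scale is cut out of the trapezoid by one half-plane per notch, with
   one of 2k normals and as large as the notch permits.  That such intersections of half-planes
   are lizards comes from a discrete Sturm comparison on the support function. *)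

(** An [MSP_graph] has every scale of its lizard as a vertex. So besides exhibiting [j] scales, one
    must bound the number of all the others, which are never identified. In the coordinate [v],
    sides at the angles [pi/k], [2 pi/k], [3 pi/k] have inverse slopes [1], [rho], [rho'], which
    depend only on [C = cos (2 pi/k)]. The hypothesis [k > 5] gives [cos (3 pi/k) >= 0], that is
    [1/2 <= C], and all the inequalities hold on the whole range [1/2 <= C < 1]. A pin is 2 wide at
    [v = 0], so with inverse slopes [l < r] its apex is at [v = -2/(r - l)]. The pairs [rho, 1] and
    [-1, -rho] put the apex above [-4]; the steeper pairs made of [rho'] and [rho] put it between
    [-12] and [-6]. This is why the bottom scale begins at [v = -5]. *)

(** * Planar topology: recognizing the region bounded by a curve *)

Section Plane.
Variable R : realType.
Local Notation point := (R * R)%type.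

Definition dot (a x : point) : R := a.1 * x.1 + a.2 * x.2.

Lemma dot_continuous (a : point) : continuous (dot a).
Proof.
move=> x; apply: cvgD; apply: cvgM; try exact: cvg_cst.
- exact: cvg_fst.
- exact: cvg_snd.
Qed.

Lemma closed_dot_le (a : point) c : closed [set x : point | dot a x <= c].
Proof.
have -> : [set x : point | dot a x <= c] = dot a @^-1` [set y | y <= c] by [].
by apply: closed_comp (@closed_le _ c) => x _; exact: dot_continuous.
Qed.

Lemma open_dot_gt (a : point) c : open [set x : point | c < dot a x].
Proof.
have -> : [set x : point | c < dot a x] = dot a @^-1` [set y | c < y] by [].
by apply: open_comp (@open_gt _ c) => x _; exact: dot_continuous.
Qed.

Lemma bounded_setP (A : set point) :
  bounded_set A <-> exists M, forall x, A x -> `|x.1| <= M /\ `|x.2| <= M.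
Proof.
split.
  move=> [M [_ AM]]; exists (M + 1) => x Ax.
  have := AM (M + 1); rewrite ltrDl ltr01 => /(_ isT x Ax) /=.
  by rewrite prod_normE ge_max => /andP.
move=> [M AM]; exists M; split; first exact: num_real.
move=> N MN x Ax /=; rewrite prod_normE ge_max; have [x1 x2] := AM x Ax.
by rewrite (le_trans x1 (ltW MN)) (le_trans x2 (ltW MN)).
Qed.

Lemma line_segmentP (a b x : point) :
  line_segment a b x <-> exists t, [/\ 0 <= t, t <= 1,
     x.1 = (1 - t) * a.1 + t * b.1 & x.2 = (1 - t) * a.2 + t * b.2].
Proof.
split.
  move=> [t]; rewrite /= in_itv /= => /andP[t0 t1] <-.
  by exists t.
move=> [t [t0 t1 e1 e2]]; exists t; first by rewrite /= in_itv /= t0 t1.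
by apply: injective_projections; rewrite /= ?e1 ?e2.
Qed.

Lemma convex_setP (S : set point) :
  convex_set (S : set (convex_lmodType point)) <->
  forall x y (t : R), 0 <= t -> t <= 1 -> S x -> S y ->
    S ((1 - t) *: x + t *: y).
Proof.
split => [cS x y t t0 t1 Sx Sy|cS x y t].
  have := cS y x (Itv01 t0 t1); rewrite !inE => /(_ Sy Sx).
  by rewrite addrC.
rewrite !inE => Sx Sy.
rewrite -[conv t x y]/(t%:num *: (x : point) + (1 - t%:num) *: (y : point)).
rewrite [X in S X]addrC.
by apply: cS.
Qed.

Lemma ray_connected (x d : point) : connected [set x + t *: d | t in `[0, +oo[].
Proof.
apply: connected_continuous_connected.
  exact/connected_intervalP/interval_is_interval.
apply: continuous_subspaceT => t; apply: cvgD; first exact: cvg_cst.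
apply: cvgZr_tmp; exact: cvg_id.
Qed.

Lemma ray_unbounded (x d : point) (A : set point) : d != 0 ->
  (forall t, 0 <= t -> A (x + t *: d)) -> ~ bounded_set A.
Proof.
move=> d0 Ad /bounded_setP [M AM].
have key (u v : R) : v != 0 -> (forall t, 0 <= t -> `|u + t * v| <= M) -> False.
  move=> v0 /(_ ((`|M| + `|u| + 1) / `|v|)).
  have vp : 0 < `|v| by rewrite normr_gt0.
  have h : 0 <= (`|M| + `|u| + 1) / `|v|.
    by rewrite divr_ge0 // addr_ge0 // addr_ge0.
  move=> /(_ h); set t := _ / _ => tM.
  have e : `|t * v| = `|M| + `|u| + 1.
    by rewrite normrM ger0_norm // /t divfK // gt_eqF.
  have := ler_normB (u + t * v) u; rewrite addrAC subrr add0r e => h2.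
  have := ler_norm M; lra.
have [d1|d1] := eqVneq d.1 0.
  have d2 : d.2 != 0.
    apply: contra_neq d0 => d2; exact: injective_projections.
  by apply: (key x.2 d.2 d2) => t t0; have [] := AM _ (Ad t t0).
by apply: (key x.1 d.1 d1) => t t0; have [] := AM _ (Ad t t0).
Qed.

(** Stands in for the Jordan curve theorem. Off [B] the set [L] is both closed and open, being the
    complement of [E] there, so the component of a point of [L] stays in the bounded set [L]. A
    point outside [L] sees a ray that avoids [B], so its component is unbounded. *)
Lemma region_of_separation (B L E : set point) :
  closed L -> closed E -> L `|` E = setT -> L `&` E = B -> bounded_set L ->
  (forall x, ~ L x ->
     exists2 d : point, d != 0 & forall t, 0 <= t -> ~ B (x + t *: d)) ->
  B `|` [set x | ~ B x /\ bounded_set (connected_component (~` B) x)] = L.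
Proof.
move=> cL cE LUE LIE bL esc; apply/seteqP; split => x.
  move=> [Bx|[nBx bx]]; first by move: Bx; rewrite -LIE => -[].
  apply: contrapT => nLx; have [d d0 dB] := esc x nLx.
  apply: (ray_unbounded (x := x) d0 _ bx) => t t0.
  exists [set x + t *: d | t in `[0, +oo[].
    split => //.
    - by exists 0; rewrite /= ?in_itv /= ?lexx // scale0r addr0.
    - by move=> y [s]; rewrite /= in_itv /= andbT => s0 <-; exact: dB.
    - exact: ray_connected.
  by exists t => //; rewrite /= in_itv /= t0.
move=> Lx; have [Bx|nBx] := pselect (B x); [by left|right; split => //].
set C := connected_component _ _.
have CB : C `<=` ~` B by exact: connected_component_sub.
have Cx : C x by exact: connected_component_refl.
suff CL : C `&` L = C.
  move/bounded_setP : bL => [M LM]; apply/bounded_setP; exists M => y.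
  by rewrite -CL => -[_ /LM].
apply: (@component_connected _ (~` B) x).
- by exists x.
- exists (~` E); first exact: closed_openC.
  apply/seteqP; split => y [Cy Ly]; split => //.
    by move=> Ey; apply: (CB _ Cy); rewrite -LIE.
  by have : (L `|` E) y by [rewrite LUE|]; case.
- by exists L.
Qed.

End Plane.

(** * Allowed directions and their normals *)

Section Directions.
Variables (R : realType) (k : nat).
Hypothesis k_gt0 : (0 < k)%N.
Local Notation point := (R * R)%type.

Definition angle (i : nat) : R := i%:R * pi / k%:R.
Definition dir (i : nat) : point := (cos (angle i), sin (angle i)).
(** Indexed by all of [nat], with period [2k]: since [normal (i + k) = - normal i], the indices
    below [2k] give every allowed line with both orientations. *)
Definition normal (i : nat) : point := (sin (angle i), - cos (angle i)).

Lemma angleD i j : angle (i + j) = angle i + angle j.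
Proof. by rewrite /angle natrD !mulrDl. Qed.

Lemma angle_k : angle k = pi.
Proof. by rewrite /angle mulrAC divff ?mul1r // pnatr_eq0 -lt0n. Qed.

Lemma dirDk i : dir (i + k) = - dir i.
Proof.
rewrite /dir angleD angle_k; apply: injective_projections => /=.
  exact: cosDpi.
exact: sinDpi.
Qed.

Lemma normalDk i : normal (i + k) = - normal i.
Proof.
rewrite /normal angleD angle_k; apply: injective_projections => /=.
  exact: sinDpi.
by rewrite cosDpi.
Qed.

Lemma periodic_modn (T : Type) (f : nat -> T) i :
  (forall i, f (i + k + k)%N = f i) -> f (i %% (k + k))%N = f i.
Proof.
move=> fper; have fq q r : f (q * (k + k) + r)%N = f r.
  elim: q => // q IH; rewrite mulSn -addnA addnC addnA fper //.
by rewrite [in RHS](divn_eq i (k + k)) fq.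
Qed.

Lemma dotN (a x : point) : dot (- a) x = - dot a x.
Proof. by rewrite /dot /=; ring. Qed.

Lemma dotDl (a b x : point) : dot (a + b) x = dot a x + dot b x.
Proof. by rewrite /dot /=; ring. Qed.

Lemma dotZl (s : R) (a x : point) : dot (s *: a) x = s * dot a x.
Proof. by rewrite /dot /= /GRing.scale /=; ring. Qed.

Lemma dotDr (a x y : point) : dot a (x + y) = dot a x + dot a y.
Proof. by rewrite /dot /=; ring. Qed.

Lemma dotBr (a x y : point) : dot a (x - y) = dot a x - dot a y.
Proof. by rewrite /dot /=; ring. Qed.

Lemma dotZr (s : R) (a x : point) : dot a (s *: x) = s * dot a x.
Proof. by rewrite /dot /= /GRing.scale /=; ring. Qed.

Lemma normalD2k i : normal (i + k + k) = normal i.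
Proof. by rewrite !normalDk opprK. Qed.

Lemma dirD2k i : dir (i + k + k) = dir i.
Proof. by rewrite !dirDk opprK. Qed.

Lemma sin_angle_ge0 i : (i <= k)%N -> 0 <= sin (angle i).
Proof.
move=> ik; apply: sin_ge0_pi; rewrite /angle; apply/andP; split.
  by rewrite divr_ge0 // mulr_ge0 // pi_ge0.
rewrite ler_pdivrMr ?ltr0n // mulrC ler_wpM2l ?pi_ge0 //.
by rewrite ler_nat.
Qed.

Lemma sin_angle_gt0 i : (0 < i < k)%N -> 0 < sin (angle i).
Proof.
move=> /andP[i0 ik]; apply: sin_gt0_pi; rewrite /angle; apply/andP; split.
  by rewrite divr_gt0 // ?ltr0n // mulr_gt0 ?ltr0n // pi_gt0.
rewrite ltr_pdivrMr ?ltr0n // mulrC ltr_pM2l ?pi_gt0 //.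
by rewrite ltr_nat.
Qed.

Lemma sin_angleDk i : sin (angle (i + k)) = - sin (angle i).
Proof. by rewrite angleD angle_k sinDpi. Qed.

(** The sine changes sign only at multiples of [pi], and these are themselves angles of the grid, so
    two neighbours never have opposite signs. *)
Lemma sin_angleM_ge0 n : 0 <= sin (angle n) * sin (angle n.+1).
Proof.
elim/ltn_ind: n => n IH; have [nk|kn] := ltnP n k.
  by rewrite mulr_ge0 ?sin_angle_ge0 // ltnW.
have -> : n = ((n - k) + k)%N by rewrite subnK.
by rewrite -addSn !sin_angleDk mulrNN; apply: IH; rewrite ltn_subrL k_gt0 (leq_trans k_gt0).
Qed.

Lemma dot_normal_dir i j : dot (normal (i + j)) (dir j) = sin (angle i).
Proof.
rewrite /dot /= -[angle i](addrK (angle j)) -angleD sinB; ring.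
Qed.

Lemma sin_angle_eq0 n : (1 < k)%N -> sin (angle n) = 0 -> sin (angle n.+1) = 0 ->
  False.
Proof.
move=> k1 sn; rewrite -addn1 angleD sinD sn mul0r add0r => /eqP.
rewrite mulf_eq0 => /orP[/eqP cn|/eqP s1].
  by have := cos2Dsin2 (angle n); rewrite sn cn expr0n /= addr0 => /esym/eqP; rewrite oner_eq0.
by have := @sin_angle_gt0 1; rewrite k1 s1 ltxx => /(_ isT).
Qed.

(* Allowed directions meet the open cone between two consecutive normals trivially, so a
   functional in that cone and the two normals have the same weak sign on each of them. *)
Lemma cone_dir (l m : R) i j : (1 < k)%N -> (j < k)%N -> 0 < l -> 0 < m ->
  let a := l *: normal i + m *: normal i.+1 in
  dot a (dir j) != 0 /\
  forall s, 0 <= s * dot a (dir j) ->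
    0 <= s * dot (normal i) (dir j) /\ 0 <= s * dot (normal i.+1) (dir j).
Proof.
(* The full turn [2k] keeps the natural subtraction exact. *)
move=> k1 jk l0 m0 a; pose n := (i + k + k - j)%N.
have jn : (j <= i + k + k)%N by rewrite (leq_trans (ltnW jk)) // leq_addl.
have e1 : dot (normal i) (dir j) = sin (angle n).
  by rewrite -(normalD2k i) -(subnK jn) dot_normal_dir.
have e2 : dot (normal i.+1) (dir j) = sin (angle n.+1).
  by rewrite -(normalD2k i.+1) !addSn -(subnK jn) -addSn dot_normal_dir.
have ea : dot a (dir j) = l * sin (angle n) + m * sin (angle n.+1).
  by rewrite /a dotDl !dotZl e1 e2.
have h := sin_angleM_ge0 n; have h0 := @sin_angle_eq0 n k1.
rewrite ea e1 e2; set u := sin _ in h h0 *; set v := sin _ in h h0 *.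
have key : (0 <= u /\ 0 <= v /\ 0 < l * u + m * v) \/ (u <= 0 /\ v <= 0 /\ l * u + m * v < 0).
  have [u0|u0|u0] := ltgtP u 0.
  - right; have v0 : v <= 0 by rewrite -(nmulr_lge0 _ u0) mulrC.
    by do 2![split => //]; rewrite addrC ltr_wnDl ?pmulr_rle0 // pmulr_rlt0.
  - left; have v0 : 0 <= v by rewrite -(pmulr_lge0 _ u0) mulrC.
    by do 2![split => //]; rewrite addrC ltr_wpDl ?pmulr_rge0 // pmulr_rgt0.
  - have [v0|v0|v0] := ltgtP v 0; last by case: (h0 u0 v0).
      by right; rewrite u0 mulr0 add0r pmulr_rlt0 // v0 lexx.
    by left; rewrite u0 mulr0 add0r pmulr_rgt0 // v0 lexx.
split.
  by case: key => [[_ [_ h1]]|[_ [_ h1]]]; [rewrite gt_eqF|rewrite lt_eqF].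
move=> s; case: key => [[u0 [v0 w0]]|[u0 [v0 w0]]].
  by rewrite pmulr_lge0 // => s0; rewrite !mulr_ge0.
by rewrite nmulr_lge0 // => s0; rewrite !mulr_le0.
Qed.

End Directions.

(** * Linear functionals on convex polygons with allowed sides *)

Section Support.
Variables (R : realType) (k : nat).
Hypothesis k_gt1 : (1 < k)%N.
Local Notation point := (R * R)%type.
Local Notation normal := (normal R k).
Local Notation dir := (dir R k).

Let k_gt0 : (0 < k)%N. Proof. exact: ltnW. Qed.

Lemma dot_self_gt0 (a : point) : a != 0 -> 0 < dot a a.
Proof.
move=> a0; rewrite /dot -!expr2 lt0r addr_ge0 ?sqr_ge0 // andbT.
apply: contra_neq a0 => /eqP; rewrite paddr_eq0 ?sqr_ge0 // !sqrf_eq0.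
by move=> /andP[/eqP h1 /eqP h2]; exact: injective_projections.
Qed.

Section Region.
Variables (n : nat) (p : 'I_n -> point).
Hypothesis n_gt0 : (0 < n)%N.

(** From a point off the boundary with value at least [M], the ray in direction [a] never meets the
    boundary, so the component of the point would be unbounded. *)
Lemma polygon_region_max (a : point) M x : a != 0 ->
  (forall y, polygon_boundary p y -> dot a y <= M) ->
  polygon_region p x -> M <= dot a x -> polygon_boundary p x.
Proof.
move=> a0 aM [//|[nBx bx]] Mx; exfalso.
apply: (ray_unbounded (x := x) a0 _ bx) => t t0.
exists [set x + t *: a | t in `[0, +oo[].
  split.
  - by exists 0; rewrite /= ?in_itv /= ?lexx // scale0r addr0.
  - move=> y [s]; rewrite /= in_itv /= andbT => s0 <-.
    have [->|sN0] := eqVneq s 0; first by rewrite scale0r addr0.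
    move=> /aM; rewrite dotDr dotZr leNgt => /negP; apply.
    by rewrite (le_lt_trans Mx) // ltrDl mulr_gt0 ?dot_self_gt0 // lt0r sN0.
  - exact: ray_connected.
by exists t => //; rewrite /= in_itv /= t0.
Qed.

Lemma polygon_boundary_max (a : point) :
  exists i0, forall y, polygon_boundary p y -> dot a y <= dot a (p i0).
Proof.
case: n p n_gt0 => // n' q _.
pose i0 := [arg max_(i > ord0) dot a (q i)]%O.
have i0max i : dot a (q i) <= dot a (q i0).
  by rewrite /i0; case: arg_maxP => // j _ h; exact: h.
exists i0 => y [i _ [t]]; rewrite /= in_itv /= => /andP[t0 t1] <-.
rewrite dotDr !dotZr.
have -> : dot a (q i0) = (1 - t) * dot a (q i0) + t * dot a (q i0) by ring.
by rewrite lerD // ler_wpM2l // subr_ge0.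
Qed.

Lemma polygon_regionS_max (a : point) M x :
  (forall y, polygon_boundary p y -> dot a y <= M) ->
  polygon_region p x -> dot a x <= M.
Proof.
move=> aM Sx; have [a0|a0] := eqVneq a 0.
  have [i0 _] := polygon_boundary_max a.
  have := aM (p i0); rewrite a0 /dot /= !mul0r addr0; apply.
  exists i0 => //; exists 0; first by rewrite /= in_itv /= lexx ler01.
  by rewrite subr0 scale1r scale0r addr0.
rewrite leNgt; apply/negP => Mx.
have /aM := polygon_region_max a0 aM Sx (ltW Mx).
by rewrite leNgt Mx.
Qed.

Hypothesis p_dir : forall i, exists theta,
  allowed_direction k theta /\ has_direction (p i) (p (ordS i)) theta.

Lemma side_dir i : exists s j, [/\ s != 0, (j < k)%N & p (ordS i) - p i = s *: dir j].
Proof.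
have [th [[j [jk ->]] [s [s0 e]]]] := p_dir i.
by exists s, j.
Qed.

Hypothesis p_convex : convex_set (polygon_region p : set (convex_lmodType point)).

Lemma region_vertex i : polygon_region p (p i).
Proof.
left; exists i => //; exists 0; first by rewrite /= in_itv /= lexx ler01.
by rewrite subr0 scale1r scale0r addr0.
Qed.

(* A face of the region is covered by finitely many sides, so two of its points lie on a
   common side, which then has the direction of the face. *)
Lemma unique_maximizer (a : point) i j : a != 0 ->
  (forall r, (r < k)%N -> dot a (dir r) != 0) ->
  (forall y, polygon_boundary p y -> dot a y <= dot a (p i)) ->
  dot a (p j) = dot a (p i) -> p j = p i.
Proof.
move=> a0 a_dir amax eij; apply: contrapT => nij.
pose tau (m : nat) : R := m%:R / n.+1%:R.
have N0 : (n.+1%:R : R) != 0 by rewrite pnatr_eq0.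
pose z (m : 'I_n.+1) : point := (1 - tau m) *: p i + tau m *: p j.
have zB m : polygon_boundary p (z m).
  apply: (polygon_region_max a0 amax).
    apply: (convex_setP _).1 => //; try exact: region_vertex.
      by rewrite divr_ge0.
    by rewrite ler_pdivrMr ?ltr0n // mul1r ler_nat ltnW.
  by rewrite /z dotDr !dotZr eij -mulrDl subrK mul1r.
have /choice [f fz] : forall m, exists s, polygon_side p s (z m).
  by move=> m; have [s _ h] := zB m; exists s.
have : ~ injective f.
  by move=> /leq_card; rewrite !card_ord ltnn.
apply => m m' emm'.
have [t tI tz] := fz m; have [t' tI' tz'] := fz m'.
have [s [r [s0 rk e]]] := side_dir (f m).
have ez : z m - z m' = (t - t') *: (s *: dir r).
  by rewrite -e -tz -tz' emm'; apply: injective_projections; rewrite /= /GRing.scale /=; ring.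
have ez2 : z m - z m' = (tau m - tau m') *: (p j - p i).
  by apply: injective_projections; rewrite /= /GRing.scale /=; ring.
have : dot a (z m - z m') = 0.
  by rewrite ez2 dotZr dotBr eij subrr mulr0.
rewrite ez !dotZr => /eqP; rewrite !mulf_eq0 (negbTE s0) (negbTE (a_dir r rk)) !orbF.
move=> /eqP tt; move: ez; rewrite ez2 tt scale0r => /eqP.
rewrite scaler_eq0 => /orP[/eqP h|/eqP /subr0_eq //].
have : tau m = tau m' by exact: subr0_eq.
rewrite /tau => /(mulIf (invr_neq0 N0)) /eqP; rewrite eqr_nat => /eqP.
exact: val_inj.
Qed.

Lemma open_cone_neq0 (l m : R) i : 0 < l -> 0 < m ->
  l *: normal i + m *: normal i.+1 != 0.
Proof.
move=> l0 m0; apply/eqP => e.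
have [/eqP + _] := @cone_dir R k k_gt0 l m i 0 k_gt1 k_gt0 l0 m0.
by rewrite e /dot /= !mul0r addr0.
Qed.

(** The vertex that maximizes a functional of the open cone remains maximal when the functional is
    tilted to either generating normal: at the first tie with another vertex the functional would
    still be in the open cone, where [unique_maximizer] forbids ties. *)
Lemma common_maximizer (l m : R) i : 0 < l -> 0 < m ->
  exists i0, forall x, polygon_region p x ->
    [/\ dot (l *: normal i + m *: normal i.+1) x <=
        dot (l *: normal i + m *: normal i.+1) (p i0),
      dot (normal i) x <= dot (normal i) (p i0) &
      dot (normal i.+1) x <= dot (normal i.+1) (p i0)].
Proof.
move=> l0 m0; set a := l *: _ + _.
have [i0 i0max] := polygon_boundary_max a; exists i0.
have a0 : a != 0 by exact: open_cone_neq0.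
have bd j : polygon_boundary p (p j).
  exists j => //; exists 0; first by rewrite /= in_itv /= lexx ler01.
  by rewrite subr0 scale1r scale0r addr0.
have key g : (forall r : R, 0 < r -> exists l' m', [/\ 0 < l', 0 < m' &
      g + r *: a = l' *: normal i + m' *: normal i.+1]) ->
    forall j, dot g (p j) <= dot g (p i0).
  move=> hg j0; rewrite leNgt; apply/negP => hj0.
  have lt_a j : dot g (p i0) < dot g (p j) -> 0 < dot a (p i0) - dot a (p j).
    move=> hj; rewrite subr_gt0 lt_neqAle i0max // andbT; apply/eqP => e.
    have e2 : p j = p i0.
      apply: (unique_maximizer a0) => // r rk.
      by have [] := @cone_dir R k k_gt0 l m i r k_gt1 rk l0 m0.
    by rewrite e2 ltxx in hj.
  (* [F j] is the weight [r] at which [p j] and [p i0] tie for [g + r *: a]. With the largest of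
     these weights, [p i0] is still a maximizer. *)
  pose F j := (dot g (p j) - dot g (p i0)) / (dot a (p i0) - dot a (p j)).
  pose P := [pred j | dot g (p i0) < dot g (p j)].
  have Pj0 : P j0 by [].
  pose j1 := [arg max_(j > j0 | P j) F j]%O.
  have [Pj1 Fmax] : P j1 /\ forall j, P j -> F j <= F j1.
    by rewrite /j1; case: (arg_maxP F Pj0) => j Pj h; split.
  have d1 := lt_a _ Pj1.
  have r0 : 0 < F j1 by rewrite divr_gt0 // subr_gt0.
  have [l' [m' [l'0 m'0 e]]] := hg _ r0.
  have a'0 : g + F j1 *: a != 0 by rewrite e open_cone_neq0.
  have vmax j : dot (g + F j1 *: a) (p j) <= dot (g + F j1 *: a) (p i0).
    rewrite !dotDl !dotZl; have [Pj|nPj] := boolP (P j).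
      have := Fmax j Pj; rewrite {1}/F ler_pdivrMr ?lt_a //; lra.
    by apply: lerD; [rewrite leNgt|rewrite ler_wpM2l ?(ltW r0) // i0max].
  have [i2 i2max] := polygon_boundary_max (g + F j1 *: a).
  have e1 : p j1 = p i0.
    apply: (unique_maximizer a'0) => [r rk|y /i2max h|].
    - rewrite e.
      by have [] := @cone_dir R k k_gt0 l' m' i r k_gt1 rk l'0 m'0.
    - exact: le_trans h (vmax _).
    - by rewrite !dotDl !dotZl /F; field; rewrite gt_eqF.
  by move: Pj1; rewrite /= e1 ltxx.
have gmax g : (forall r : R, 0 < r -> exists l' m', [/\ 0 < l', 0 < m' &
      g + r *: a = l' *: normal i + m' *: normal i.+1]) ->
    forall x, polygon_region p x -> dot g x <= dot g (p i0).
  move=> hg x; apply: polygon_regionS_max => y.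
  have [i2 i2max] := polygon_boundary_max g => /i2max h.
  exact: le_trans h (key _ hg _).
move=> x Sx; split.
- exact: polygon_regionS_max Sx.
- apply: gmax => // r r0; exists (1 + r * l), (r * m).
  by rewrite mulr_gt0 // addr_gt0 ?mulr_gt0 // scalerDr scalerDl !scalerA scale1r addrA.
- apply: gmax => // r r0; exists (r * l), (1 + r * m).
  by rewrite mulr_gt0 // addr_gt0 ?mulr_gt0 // scalerDr scalerDl !scalerA scale1r addrCA.
Qed.

End Region.

End Support.

(** * Separation by lines of allowed direction *)

Section Separation.
Variables (R : realType).
Local Notation point := (R * R)%type.

Definition cross (u v : point) : R := u.1 * v.2 - u.2 * v.1.

(** Fix [x0] in [X] and let [w] be [x0] turned by a right angle. The functional [x0 - q *: w] is
    nonnegative at [x] when [q] is at most [dot x0 x / cross x0 x] where the cross product is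
    positive, and at least this ratio where it is negative. Convexity and [~ X 0] make the two
    families of bounds compatible, and [q] is taken to be the infimum of the upper ones. *)
Lemma plane_separation (X : set point) :
  (forall x y (t : R), 0 <= t -> t <= 1 -> X x -> X y ->
    X ((1 - t) *: x + t *: y)) ->
  ~ X 0 -> exists2 a : point, a != 0 & forall x, X x -> 0 <= dot a x.
Proof.
move=> cX X0; have [[x0 Xx0]|nX] := pselect (X !=set0); last first.
  exists (1, 0); first by apply/eqP => -[/eqP]; rewrite oner_eq0.
  by move=> x Xx; case: nX; exists x.
have x00 : x0 != 0 by apply: contra_notN X0 => /eqP <-.
have x0x0 := dot_self_gt0 x00.
have [[x1 [Xx1 x1p]]|np] := pselect (exists x, X x /\ 0 < cross x0 x); last first.
  exists (x0.2, - x0.1).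
    apply: contra_neq x00 => -[e1 e2]; apply: injective_projections => //=.
    by apply/eqP; rewrite -oppr_eq0 e2.
  move=> x Xx; rewrite leNgt; apply/negP => h; apply: np; exists x; split => //.
  move: h; rewrite /dot /cross /=; lra.
have [[y1 [Xy1 y1n]]|nn] := pselect (exists x, X x /\ cross x0 x < 0); last first.
  exists (- x0.2, x0.1).
    apply: contra_neq x00 => -[e1 e2]; apply: injective_projections => //=.
    by apply/eqP; rewrite -oppr_eq0 e1.
  move=> x Xx; rewrite leNgt; apply/negP => h; apply: nn; exists x; split => //.
  move: h; rewrite /dot /cross /=; lra.
have dec (w : point) : dot x0 x0 *: w = dot x0 w *: x0 + cross x0 w *: (- x0.2, x0.1).
  by apply: injective_projections; rewrite /dot /cross /= /GRing.scale /=; ring.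
have ray x : X x -> cross x0 x = 0 -> 0 < dot x0 x.
  move=> Xx cx; rewrite ltNge; apply/negP => dx; apply: X0.
  pose lam := dot x0 x / dot x0 x0.
  have xE : x = lam *: x0.
    apply: (scalerI (lt0r_neq0 x0x0)); rewrite dec cx scale0r addr0 scalerA /lam.
    by rewrite mulrC divfK // gt_eqF.
  have lam0 : lam <= 0 by rewrite /lam pmulr_lle0 // invr_gt0.
  have -> : (0 : point) = (1 - (- lam / (1 - lam))) *: x + (- lam / (1 - lam)) *: x0.
    rewrite {1}xE scalerA -scalerDl.
    have -> : (1 - - lam / (1 - lam)) * lam + - lam / (1 - lam) = 0.
      by field; rewrite gt_eqF //; lra.
    by rewrite scale0r.
  have l1 : 0 < 1 - lam by lra.
  apply: cX => //; first by apply: divr_ge0; lra.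
  by rewrite ler_pdivrMr //; lra.
have key x y : X x -> 0 < cross x0 x -> X y -> cross x0 y < 0 ->
    dot x0 y / cross x0 y <= dot x0 x / cross x0 x.
  (* The segment from [x] to [y] crosses the line through [0] and [x0] at parameter [t]; by [ray] it
     does so on the side of [x0]. *)
  move=> Xx cx Xy cy; pose t := cross x0 x / (cross x0 x - cross x0 y).
  have d0 : 0 < cross x0 x - cross x0 y by lra.
  have t0 : 0 <= t by rewrite divr_ge0 // ltW.
  have t1 : t <= 1 by rewrite ler_pdivrMr //; lra.
  have := ray _ (cX x y t t0 t1 Xx Xy).
  have -> : cross x0 ((1 - t) *: x + t *: y) = 0.
    have -> : cross x0 ((1 - t) *: x + t *: y) = (1 - t) * cross x0 x + t * cross x0 y.
      by rewrite /cross /= /GRing.scale /=; ring.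
    by rewrite /t; field; rewrite gt_eqF.
  move=> /(_ erefl); rewrite dotDr !dotZr.
  have -> : (1 - t) * dot x0 x + t * dot x0 y =
      (cross x0 x * dot x0 y - cross x0 y * dot x0 x) / (cross x0 x - cross x0 y).
    by rewrite /t; field; rewrite gt_eqF.
  rewrite pmulr_lgt0 ?invr_gt0 // => h.
  rewrite ler_pdivlMr // mulrAC ler_ndivrMr //; lra.
pose Q := [set r | exists x, [/\ X x, 0 < cross x0 x & r = dot x0 x / cross x0 x]].
have Qlb y : X y -> cross x0 y < 0 -> lbound Q (dot x0 y / cross x0 y).
  by move=> Xy cy r [x [Xx cx ->]]; exact: key.
have Qne : Q !=set0 by exists (dot x0 x1 / cross x0 x1), x1.
exists (x0 - inf Q *: (- x0.2, x0.1)).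
  apply/eqP => e; move: x0x0.
  have -> : dot x0 x0 = dot (x0 - inf Q *: (- x0.2, x0.1)) x0.
    by rewrite /dot /= /GRing.scale /=; ring.
  by rewrite e /dot /= !mul0r addr0 ltxx.
move=> x Xx.
have -> : dot (x0 - inf Q *: (- x0.2, x0.1)) x = dot x0 x - inf Q * cross x0 x.
  by rewrite /dot /cross /= /GRing.scale /=; ring.
rewrite subr_ge0; have [cx|cx|cx] := ltgtP (cross x0 x) 0.
- rewrite -ler_ndivrMr //; apply: lb_le_inf => //; exact: Qlb.
- rewrite -ler_pdivlMr //; apply: ge_inf; last by exists x.
  by exists (dot x0 y1 / cross x0 y1); exact: Qlb.
- by rewrite cx mulr0 ltW // ray.
Qed.

Variable k : nat.
Hypothesis k_gt1 : (1 < k)%N.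
Local Notation normal := (normal R k).
Local Notation dir := (dir R k).
Let k_gt0 : (0 < k)%N. Proof. exact: ltnW. Qed.

Lemma crossN (u v : point) : cross (- u) v = - cross u v.
Proof. by rewrite /cross /=; ring. Qed.

(** The cross product of [normal i] with [a] changes sign under [i -> i + k], so at some step it
    passes from nonnegative to negative. Cramer's rule at that step gives the coefficients. *)
Lemma cone_decomposition (a : point) : a != 0 ->
  exists i l m, [/\ 0 < l, 0 <= m & a = l *: normal i + m *: normal i.+1].
Proof.
move=> a0; pose f i := cross (normal i) a.
have fk i : f (i + k)%N = - f i by rewrite /f normalDk // crossN.
have s1 : 0 < sin (angle R k 1) by exact: sin_angle_gt0.
have cn i : cross (normal i) (normal i.+1) = sin (angle R k 1).
  rewrite -addn1 /cross /normal /= angleD sinD cosD -[RHS]mulr1.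
  by rewrite -(cos2Dsin2 (angle R k i)); ring.
have dec i : a = (- f i.+1 / sin (angle R k 1)) *: normal i +
                 (f i / sin (angle R k 1)) *: normal i.+1.
  rewrite /f -(cn i); have := gt_eqF s1; rewrite -(cn i) => c0.
  move: c0; move: (normal i) (normal i.+1) => u v; rewrite /cross => c0.
  by apply: injective_projections; rewrite /= /GRing.scale /=; field; rewrite c0.
suff [i [fi fi1]] : exists i, 0 <= f i /\ f i.+1 < 0.
  exists i, (- f i.+1 / sin (angle R k 1)), (f i / sin (angle R k 1)); split.
  - by rewrite divr_gt0 // oppr_gt0.
  - by rewrite divr_ge0 // ltW.
  - exact: dec.
have descend n : forall i, 0 <= f i -> f (i + n)%N < 0 -> exists i, 0 <= f i /\ f i.+1 < 0.
  elim: n => [i|n IH i fi]; first by rewrite addn0 leNgt => /negP.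
  rewrite addnS -addSn => h; have [fi1|fi1] := ltP (f i.+1) 0; first by exists i.
  exact: IH h.
have [f0|f0|f0] := ltgtP (f 0%N) 0.
- by apply: (descend k (0 + k)%N); rewrite !fk; lra.
- by apply: (descend k 0%N); rewrite ?fk; lra.
- have [f1|f1|f1] := ltgtP (f 1%N) 0.
  + by exists 0%N; rewrite f0.
  + by apply: (descend k 1%N); rewrite ?fk; lra.
  + by move: a0; rewrite (dec 0%N) f0 f1 oppr0 !mul0r !scale0r addr0 eqxx.
Qed.

(* Holds when [W] is a convex set whose sides have allowed directions; [w] is then a vertex. *)
Definition has_corners (W : set point) : Prop :=
  forall i l m c, 0 < l -> 0 < m ->
    (forall y, W y -> c <= dot (l *: normal i + m *: normal i.+1) y) ->
    exists2 w, c <= dot (l *: normal i + m *: normal i.+1) w &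
      forall y, W y -> dot (normal i) w <= dot (normal i) y /\
                       dot (normal i.+1) w <= dot (normal i.+1) y.

(** Any separating functional lies in a cone between two consecutive normals. One vertex of [S]
    maximizes both normals and one corner of [W] minimizes both, so the separating inequality is a
    positive combination of the two inequalities between these points, and at least one of the two
    must hold. *)
Lemma allowed_separation (S W : set point) :
  convex_lizard k S -> convex_set (W : set (convex_lmodType point)) ->
  has_corners W -> S `&` W = set0 ->
  exists2 i, (i < k + k)%N &
    forall x y, S x -> W y -> dot (normal i) x <= dot (normal i) y.
Proof.
move=> [[n [p [[n_gt2 _ _ _ _] SE p_dir]]] cS] /convex_setP cW Wc SW0.
have n_gt0 : (0 < n)%N by exact: leq_trans n_gt2.
move: cS SW0; rewrite {}SE => cS SW0.
pose X : set point := [set z | exists x y, [/\ polygon_region p x, W y & z = y - x]].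
have [||a a0 aX] := @plane_separation X.
- move=> _ _ t t0 t1 [x [y [Sx Wy ->]]] [x' [y' [Sx' Wy' ->]]].
  exists ((1 - t) *: x + t *: x'), ((1 - t) *: y + t *: y'); split.
  + exact: (convex_setP _).1.
  + exact: cW.
  + by apply: injective_projections; rewrite /= /GRing.scale /=; ring.
- move=> [x [y [Sx Wy /esym /subr0_eq xy]]].
  by have : (polygon_region p `&` W) x by [split => //; rewrite -xy]; rewrite SW0.
have {}aX x y : polygon_region p x -> W y -> dot a x <= dot a y.
  by move=> Sx Wy; rewrite -subr_ge0 -dotBr; apply: aX; exists x, y.
suff [i iP] : exists i, forall x y, polygon_region p x -> W y ->
    dot (normal i) x <= dot (normal i) y.
  by exists (i %% (k + k))%N; [rewrite ltn_mod addn_gt0 k_gt0|rewrite (@periodic_modn k _ normal) // => ?; exact: normalD2k].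
have [i [l [m [l0 m0 aE]]]] := cone_decomposition a0.
move: m0; rewrite le_eqVlt => /orP[/eqP m0|m0].
  exists i => x y Sx Wy; have := aX x y Sx Wy.
  by rewrite aE -m0 scale0r addr0 !dotZl ler_pM2l.
have [i0 i0max] := common_maximizer k_gt1 n_gt0 p_dir cS i l0 m0.
have [|w aw wW] := Wc i l m (dot a (p i0)) l0 m0.
  by move=> y Wy; rewrite -aE; apply: aX => //; exact: region_vertex.
move: aw; rewrite {1}aE !dotDl !dotZl => aw.
have [h|h] := leP (dot (normal i) (p i0)) (dot (normal i) w).
  exists i => x y Sx Wy; have [_ h1 _] := i0max x Sx; have [h2 _] := wW y Wy.
  exact: le_trans h1 (le_trans h h2).
exists i.+1 => x y Sx Wy; have [_ _ h1] := i0max x Sx; have [_ h2] := wW y Wy.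
apply: le_trans h1 (le_trans _ h2).
rewrite -(ler_pM2l m0) -(lerD2l (l * dot (normal i) (p i0))).
by rewrite (le_trans aw) // lerD2r ler_pM2l // ltW.
Qed.

End Separation.

(** * Simplicity of strictly convex closed chains *)

Section ConvexPolygon.
Variables (R : realType).
Local Notation point := (R * R)%type.

Lemma line_segment_dot (u a b x : point) H : line_segment a b x ->
  dot u a <= H -> dot u b <= H -> dot u x <= H.
Proof.
move=> [t]; rewrite /= in_itv /= => /andP[t0 t1] <- ua ub.
rewrite dotDr !dotZr.
have -> : H = (1 - t) * H + t * H by ring.
by rewrite lerD // ler_wpM2l // subr_ge0.
Qed.

Lemma line_segment_dot_eq (u a b x : point) H : line_segment a b x ->
  dot u a = H -> dot u b < H -> dot u x = H -> x = a.
Proof.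
move=> [t]; rewrite /= in_itv /= => /andP[t0 t1] <- ua ub.
rewrite dotDr !dotZr ua => h; have /eqP : t * (dot u b - H) = 0 by lra.
rewrite mulf_eq0 subr_eq0 (lt_eqF ub) orbF => /eqP ->.
by rewrite subr0 scale1r scale0r addr0.
Qed.

Lemma line_segment_sym (a b x : point) : line_segment a b x -> line_segment b a x.
Proof.
move=> [t]; rewrite /= in_itv /= => /andP[t0 t1] <-; exists (1 - t).
  by rewrite /= in_itv /=; lra.
by rewrite subKr addrC.
Qed.

Lemma line_segment_left (a b : point) : line_segment a b a.
Proof.
exists 0; first by rewrite /= in_itv /= lexx ler01.
by rewrite subr0 scale1r scale0r addr0.
Qed.

Lemma line_segment_right (a b : point) : line_segment a b b.
Proof. exact/line_segment_sym/line_segment_left. Qed.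

Section Chain.
Variables (n : nat) (p : 'I_n -> point) (u : 'I_n -> point) (H : 'I_n -> R).
Hypothesis n_gt2 : (2 < n)%N.
Hypothesis on1 : forall t, dot (u t) (p t) = H t.
Hypothesis on2 : forall t, dot (u t) (p (ordS t)) = H t.
Hypothesis off : forall s t, s != t -> s != ordS t -> dot (u t) (p s) < H t.

Lemma ordS_neq (t : 'I_n) : ordS t != t.
Proof.
apply/eqP => /(congr1 val) /=; have tn := ltn_ord t.
have [e|ne] := eqVneq t.+1 n; first by rewrite e modnn; lia.
by rewrite modn_small; lia.
Qed.

Lemma ordSS_neq (t : 'I_n) : ordS (ordS t) != t.
Proof.
apply/eqP => /(congr1 val) /=; have tn := ltn_ord t.
have [e|ne] := eqVneq t.+1 n; first by rewrite e modnn modn_small; lia.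
rewrite (modn_small (_ : t.+1 < n)%N); last by lia.
have [e2|ne2] := eqVneq t.+2 n; first by rewrite e2 modnn; lia.
by rewrite modn_small; lia.
Qed.

(** A point common to two sides lies on the supporting line of one of them, and the other side meets
    that line in at most an endpoint, because the remaining vertices are strictly below it. *)
Lemma strictly_convex_chain : simple_closed_chain p.
Proof.
have inj : injective p.
  move=> s t e; apply/eqP; apply: contraT => st.
  have [st2|st2] := eqVneq s (ordS t); last first.
    by have := off st st2; rewrite e on1 ltxx.
  subst s; have := @off t (ordS t).
  rewrite eq_sym st eq_sym ordSS_neq => /(_ isT isT).
  by rewrite -e on1 ltxx.
split => //.
- move=> t; apply/seteqP; split => x; last first.
    by move=> ->; split; [exact: line_segment_right|exact: line_segment_left].
  move=> [s1 s2]; apply: (line_segment_dot_eq s2 (on2 t)).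
    by apply: off; rewrite ?ordSS_neq ?ordS_neq.
  apply/eqP; rewrite eq_le (line_segment_dot s1) ?on1 ?on2 //=.
  have h : dot (- u t) x <= - H t by apply: (line_segment_dot s1); rewrite dotN ?on1 ?on2.
  by move: h; rewrite dotN lerN2.
- move=> t s st sSt tSs; apply/seteqP; split => x //= [s1 s2].
  have e1 : dot (u t) x = H t.
    apply/eqP; rewrite eq_le (line_segment_dot s1) ?on1 ?on2 //=.
    have h : dot (- u t) x <= - H t by apply: (line_segment_dot s1); rewrite dotN ?on1 ?on2.
    by move: h; rewrite dotN lerN2.
  have h1 : dot (u t) (p s) < H t by exact: off.
  have h2 : dot (u t) (p (ordS s)) < H t.
    apply: off; first by rewrite eq_sym.
    by apply: contra_neq st => /(bij_inj (@ordS_bij n)).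
  case: s2 e1 => r; rewrite /= in_itv /= => /andP[r0 r1] <-.
  rewrite dotDr !dotZr => e; move: h1 h2.
  set A := dot _ (p s) in e *; set B := dot _ (p (ordS s)) in e * => h1 h2.
  have : (1 - r) * (H t - A) + r * (H t - B) = 0 by lra.
  move/eqP; rewrite paddr_eq0 ?mulr_ge0 ?subr_ge0 ?(ltW h1) ?(ltW h2) // => /andP[].
  rewrite !mulf_eq0 !subr_eq0 (gt_eqF h1) (gt_eqF h2) !orbF => /eqP <-.
  by rewrite oner_eq0.
- move=> t st.
  have := line_segment_dot_eq st (on1 t) _ (on2 t).
  have h : dot (u t) (p (ordS (ordS t))) < H t.
    by apply: off; rewrite ?ordSS_neq ?ordS_neq.
  by move=> /(_ h) /inj /eqP; rewrite (negbTE (ordS_neq t)).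
Qed.

End Chain.

End ConvexPolygon.

(** * Intersections of allowed half-planes are lizards *)

Section HalfplaneIntersection.
Variables (R : realType) (k : nat).
Hypothesis k_gt1 : (1 < k)%N.
Local Notation point := (R * R)%type.
Local Notation normal := (normal R k).
Local Notation dir := (dir R k).
Local Notation angle := (angle R k).
Let k_gt0 : (0 < k)%N. Proof. exact: ltnW. Qed.
Local Notation c1 := (cos (angle 1)).
Local Notation s1 := (sin (angle 1)).

Let s1_gt0 : 0 < s1. Proof. exact: sin_angle_gt0. Qed.

(** Hence [j |-> dot (normal j) x] solves a linear recurrence for every [x], and a support function
    satisfies the corresponding inequality [h_conv]. *)
Lemma normal_rec j : normal j.+2 + normal j = (2 * c1) *: normal j.+1.
Proof.
have h := cos2Dsin2 (angle 1).
have -> : j.+2 = (j + (1 + 1))%N by rewrite addn2.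
rewrite -[j.+1]addn1.
rewrite /normal !angleD !(sinD, cosD).
move: h; move: (sin (angle j)) (cos (angle j)) c1 s1 => a b c s h.
have ea : a * (c ^+ 2 + s ^+ 2) = a by rewrite h mulr1.
have eb : b * (c ^+ 2 + s ^+ 2) = b by rewrite h mulr1.
by apply: injective_projections; rewrite /= /GRing.scale /=; lra.
Qed.

(* Discrete Sturm comparison with [j |-> sin (j pi / k)]: the Wronskian
   [f (j+1) sin_j - f j sin_(j+1)] is nondecreasing. *)
Lemma sturm (f : nat -> R) : f 0%N = 0 -> f 1%N = 0 ->
  (forall j, (j.+2 <= k)%N -> 2 * c1 * f j.+1 <= f j.+2 + f j) ->
  forall j, (j <= k)%N -> 0 <= f j /\
    ((exists m, (m.+2 <= j)%N /\ 2 * c1 * f m.+1 < f m.+2 + f m) -> 0 < f j).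
Proof.
move=> f0 f1 fk.
pose W j := f j.+1 * sin (angle j) - f j * sin (angle j.+1).
have W0 : W 0%N = 0 by rewrite /W f0 f1 !mul0r subrr.
have Wrec j : W j.+1 = W j + sin (angle j.+1) * (f j.+2 + f j - 2 * c1 * f j.+1).
  have : sin (angle j.+2) + sin (angle j) = 2 * c1 * sin (angle j.+1).
    by have := congr1 fst (normal_rec j).
  move=> h; have {}h : sin (angle j.+2) = 2 * c1 * sin (angle j.+1) - sin (angle j) by rewrite -h; ring.
  by rewrite /W h; ring.
have Wge j : (j < k)%N -> 0 <= W j /\
    ((exists m, (m.+1 <= j)%N /\ 2 * c1 * f m.+1 < f m.+2 + f m) -> 0 < W j).
  elim: j => [|j IH] jk.
    by rewrite W0; split => // -[m []].
  have [IH1 IH2] := IH (ltnW jk); rewrite Wrec.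
  have sj : 0 < sin (angle j.+1) by apply: sin_angle_gt0.
  have d : 0 <= sin (angle j.+1) * (f j.+2 + f j - 2 * c1 * f j.+1).
    by rewrite mulr_ge0 ?(ltW sj) // subr_ge0 fk.
  split; first by rewrite addr_ge0.
  move=> [m [mj hm]]; move: mj; rewrite ltnS leq_eqVlt => /orP[/eqP mj|mj].
    by rewrite ltr_wpDl // mulr_gt0 // subr_gt0 -mj.
  by rewrite ltr_pwDl // IH2 //; exists m.
elim=> [|j IH] jk.
  by rewrite f0; split => // -[m []].
have [->|j0] := posnP j.
  by rewrite f1; split => // -[m []].
have [IH1 _] := IH (ltnW jk); have [W1 W2] := Wge j jk.
have sj : 0 < sin (angle j) by apply: sin_angle_gt0 => //; apply/andP.
have sj1 : 0 <= sin (angle j.+1) by exact: sin_angle_ge0.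
have e : f j.+1 * sin (angle j) = W j + f j * sin (angle j.+1) by rewrite /W subrK.
split.
  by rewrite -(pmulr_lge0 _ sj) e addr_ge0 // mulr_ge0.
move=> [m [mj hm]]; rewrite -(pmulr_lgt0 _ sj) e ltr_pwDl ?mulr_ge0 //.
by apply: W2; exists m.
Qed.

Variable h : nat -> R.
Hypothesis h_per : forall i, h (i + k + k) = h i.
Hypothesis h_conv : forall i, 2 * c1 * h i.+1 <= h i.+2 + h i.
Variable o : point.
Hypothesis o_int : forall i, dot (normal i) o < h i.

Let T : set point := [set x | forall i, dot (normal i) x <= h i].

(** The point where the lines [dot (normal i) x = h i] and [dot (normal i.+1) x = h i.+1] meet. *)
Definition corner i : point := h i *: normal i + ((h i.+1 - c1 * h i) / s1) *: dir i.
(** Length of the side from [corner i] to [corner i.+1]. This side lies on the line of index [i.+1],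
    not [i]; it may be degenerate. *)
Definition len i : R := (h i.+2 + h i - 2 * c1 * h i.+1) / s1.

Lemma dot_normal_self i : dot (normal i) (normal i) = 1.
Proof. by rewrite -(cos2Dsin2 (angle i)) /dot /=; ring. Qed.

Lemma dot_normal_dir0 i : dot (normal i) (dir i) = 0.
Proof. by rewrite /dot /=; ring. Qed.

Lemma dot_normalS_dir i : dot (normal i.+1) (dir i) = s1.
Proof. by rewrite -add1n dot_normal_dir. Qed.

Lemma dot_normal_dirS i : dot (normal i) (dir i.+1) = - s1.
Proof.
by rewrite -[i.+1]addn1 /dot /= !angleD sinD cosD -[RHS]mulr1 -(cos2Dsin2 (angle i)); ring.
Qed.

Lemma dot_normalS_normal i : dot (normal i.+1) (normal i) = c1.
Proof.
by rewrite -[i.+1]addn1 /dot /= !angleD sinD cosD -[RHS]mulr1 -(cos2Dsin2 (angle i)); ring.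
Qed.

Lemma corner_line i : dot (normal i) (corner i) = h i.
Proof. by rewrite /corner dotDr !dotZr dot_normal_self dot_normal_dir0 mulr0 addr0 mulr1. Qed.

Lemma corner_lineS i : dot (normal i.+1) (corner i) = h i.+1.
Proof.
rewrite /corner dotDr !dotZr dot_normalS_normal dot_normalS_dir divfK ?gt_eqF //.
by ring.
Qed.

Lemma len_ge0 i : 0 <= len i.
Proof. by rewrite divr_ge0 ?(ltW s1_gt0) // subr_ge0. Qed.

Lemma line_param i (x : point) : dot (normal i) x = h i ->
  x = corner i + (dot (dir i) x - dot (dir i) (corner i)) *: dir i.
Proof.
move=> hx; have := corner_line i; move: (corner i) => q; rewrite -{}hx.
rewrite /dot /normal /dir /=; have := cos2Dsin2 (angle i).
move: (sin _) (cos _) => a b e hq.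
apply: injective_projections; rewrite /= /GRing.scale /=.
  have : x.1 * (b ^+ 2 + a ^+ 2) = x.1 by rewrite e mulr1.
  have : q.1 * (b ^+ 2 + a ^+ 2) = q.1 by rewrite e mulr1.
  by have /= := congr1 (fun z => a * z) hq; lra.
have : x.2 * (b ^+ 2 + a ^+ 2) = x.2 by rewrite e mulr1.
have : q.2 * (b ^+ 2 + a ^+ 2) = q.2 by rewrite e mulr1.
by have /= := congr1 (fun z => b * z) hq; lra.
Qed.

Lemma cornerS i : corner i.+1 = corner i + len i *: dir i.+1.
Proof.
have e : dot (normal i.+1) (corner i) = h i.+1 := corner_lineS i.
have := line_param e; set t := _ - _ => ht.
have t_len : t = - len i.
  have := congr1 (dot (normal i)) ht.
  rewrite corner_line dotDr dotZr dot_normal_dirS.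
  have -> : dot (normal i) (corner i.+1) = 2 * c1 * h i.+1 - h i.+2.
    have -> : normal i = (2 * c1) *: normal i.+1 - normal i.+2.
      by rewrite -normal_rec addrAC subrr add0r.
    by rewrite dotDl dotN dotZl corner_line corner_lineS.
  move=> h2; apply: (mulIf (lt0r_neq0 s1_gt0)); rewrite /len mulNr divfK ?gt_eqF //.
  lra.
by rewrite {1}ht t_len scaleNr subrK.
Qed.

Lemma corner_per i : corner (i + k + k) = corner i.
Proof. by rewrite /corner -!addSn !h_per normalD2k // dirD2k. Qed.

Lemma len_per i : len (i + k + k) = len i.
Proof. by rewrite /len -!addSn !h_per. Qed.

(** The slack of [corner i] in the half-plane [i + j]. It vanishes at [j = 0] and [j = 1] and
    exceeds the linear recurrence by multiples of [len], so [sturm] controls it over half a turn. *)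
Let g i j : R := h (i + j) - dot (normal (i + j)) (corner i).

Let g_rec i j : g i j.+2 + g i j - 2 * c1 * g i j.+1 = s1 * len (i + j).
Proof.
rewrite /g !addnS /len [s1 * _]mulrC divfK ?gt_eqF //.
have -> : normal (i + j).+2 = (2 * c1) *: normal (i + j).+1 - normal (i + j).
  by rewrite -normal_rec addrK.
by rewrite dotDl dotN dotZl; ring.
Qed.

Let g_ge i j : (j <= k)%N -> 0 <= g i j /\
  ((exists m, (m.+2 <= j)%N /\ 0 < len (i + m)) -> 0 < g i j).
Proof.
move=> jk; have [||j' _|g1 g2] := @sturm (g i) _ _ _ j jk.
- by rewrite /g addn0 corner_line subrr.
- by rewrite /g addn1 corner_lineS subrr.
- by rewrite -subr_ge0 g_rec mulr_ge0 ?len_ge0 // ltW.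
split => // -[m [mj lm]]; apply: g2; exists m; split => //.
by rewrite -subr_gt0 g_rec mulr_gt0.
Qed.

(** On the other half turn the recurrence is run backwards, from its zeros at [j = 2k + 1] and
    [j = 2k]. *)
Let g_ge' i j : (k < j <= k + k)%N -> 0 <= g i j /\
  ((exists m, (j <= m < k + k)%N /\ 0 < len (i + m)) -> 0 < g i j).
Proof.
move=> /andP[kj jk]; pose r j := g i ((k + k).+1 - j).
have er j' : (j'.+2 <= k)%N ->
    r j'.+2 + r j' - 2 * c1 * r j'.+1 = s1 * len (i + (k + k - j'.+1)).
  move=> j'k; rewrite -g_rec /r.
  have -> : ((k + k).+1 - j'.+2 = k + k - j'.+1)%N by lia.
  have -> : ((k + k).+1 - j'.+1 = (k + k - j'.+1).+1)%N by lia.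
  have -> : ((k + k).+1 - j' = (k + k - j'.+1).+2)%N by lia.
  by ring.
have jk' : ((k + k).+1 - j <= k)%N by lia.
have [||j' j'k|g1 g2] := @sturm r _ _ _ _ jk'.
- by rewrite /r /g subn0 addnS addnA -!addSn h_per normalD2k // corner_lineS subrr.
- by rewrite /r /g subn1 /= addnA h_per normalD2k // corner_line subrr.
- by rewrite -subr_ge0 er // mulr_ge0 ?len_ge0 // ltW.
have ej : ((k + k).+1 - ((k + k).+1 - j) = j)%N by lia.
move: g1 g2; rewrite /r ej => g1 g2; split => // -[m [mj lm]].
apply: g2; exists (k + k - m.+1)%N; split; first by lia.
rewrite -!/(r _) -subr_gt0 er; last by lia.
have -> : (k + k - (k + k - m.+1).+1 = m)%N by lia.
by rewrite mulr_gt0.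
Qed.

Lemma corner_in i : T (corner i).
Proof.
(* The natural number [i * (k + k) - i] represents [- i] modulo [2k]. *)
move=> a; pose j := ((a + (i * (k + k) - i)) %% (k + k))%N.
have jk : (j < k + k)%N by rewrite ltn_mod addn_gt0 k_gt0.
have e : (i + j = a %[mod k + k])%N.
  rewrite /j modnDmr addnCA subnKC; first by rewrite addnC modnMDl.
  by rewrite leq_pmulr // addn_gt0 k_gt0.
rewrite -(periodic_modn a h_per) -(@periodic_modn k _ normal a); last exact: normalD2k.
rewrite -e (periodic_modn _ h_per) (@periodic_modn k _ normal); last exact: normalD2k.
rewrite -subr_ge0; have [jk'|jk'] := leqP j k; first by case: (g_ge i jk').
by have [|+ _] := @g_ge' i j; first rewrite jk' ltnW.
Qed.

Lemma corner_const i m : (forall m', (m' < m)%N -> len (i + m') <= 0) ->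
  corner (i + m) = corner i.
Proof.
elim: m => [|m IH] hm; first by rewrite addn0.
rewrite addnS cornerS IH => [|m' m'm]; last by apply: hm; rewrite ltnW.
have -> : len (i + m) = 0 by apply/eqP; rewrite eq_le len_ge0 hm.
by rewrite scale0r addr0.
Qed.

(** If all these sides were degenerate, one point would lie on the opposite parallel lines [i] and
    [i + k], which leaves no room for the interior point [o]. *)
Lemma active_window i : exists m, (m.+1 < k)%N /\ 0 < len (i + m).
Proof.
apply: contrapT => hn.
have e : corner (i + k.-1) = corner i.
  apply: corner_const => m mk; rewrite leNgt; apply/negP => lm.
  by apply: hn; exists m; split => //; lia.
have := corner_lineS (i + k.-1); rewrite e -addnS prednK // normalDk // dotN corner_line.
have := o_int i; have := o_int (i + k); rewrite normalDk // dotN; lra.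
Qed.

Lemma next_active i : exists m, corner (i + m) = corner i /\ 0 < len (i + m).
Proof.
have [m0 [_ m0P]] := active_window i.
have ex : exists m, 0 < len (i + m) by exists m0.
exists (ex_minn ex); case: ex_minnP => m mP mmin; split => //.
apply: corner_const => m' m'm; rewrite leNgt; apply/negP => /mmin.
by rewrite leqNgt m'm.
Qed.

(** The nondegenerate sides in cyclic order. The polygon has the vertices [corner (a t)], and side
    [t] lies on the line [(a t).+1]. *)
Let act := [seq i <- iota 0 (k + k) | 0 < len i].
Let n := size act.
Let a t := nth 0%N act t.

Let mem_act i : (i \in act) = (i < k + k)%N && (0 < len i).
Proof. by rewrite mem_filter mem_iota add0n andbC. Qed.

Let act_nth t : (t < n)%N -> (a t < k + k)%N /\ 0 < len (a t).
Proof. by move=> tn; apply/andP; rewrite -mem_act mem_nth. Qed.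

Let a_mono s t : (s < t)%N -> (t < n)%N -> (a s < a t)%N.
Proof.
move=> st tn; have srt : sorted ltn act.
  by apply: sorted_filter (iota_ltn_sorted 0 _); exact: ltn_trans.
by apply: (sorted_ltn_nth ltn_trans 0%N srt) => //; rewrite inE // (ltn_trans st).
Qed.

Let a_index i : (i < k + k)%N -> 0 < len i -> exists2 t, (t < n)%N & a t = i.
Proof.
move=> ik li; have im : i \in act by rewrite mem_act ik.
by exists (index i act); [rewrite index_mem|rewrite /a nth_index].
Qed.

Let n_gt2 : (2 < n)%N.
Proof.
have [m1 [m1k l1]] := active_window 0.
have [m2 [m2k l2]] := active_window m1.+1.
have [m3 [m3k l3]] := active_window (m1.+1 + m2).+1.
(* Two windows of [k - 1] indices follow [b1], so the three indices lie within fewer than [2k]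
   consecutive ones and stay distinct modulo [2k]. *)
pose b1 := m1; pose b2 := (m1.+1 + m2)%N; pose b3 := ((m1.+1 + m2).+1 + m3)%N.
pose md b := (b %% (k + k))%N.
have kk : (0 < k + k)%N by rewrite addn_gt0 k_gt0.
have neq x y : (x < y)%N -> (y < x + (k + k))%N -> md x != md y.
  move=> xy yx; apply/eqP => /eqP; rewrite /md eq_sym eqn_mod_dvd ?(ltnW xy) //.
  by move=> /dvdn_leq; rewrite subn_gt0 xy => /(_ isT); lia.
have in_act b : 0 < len b -> md b \in act.
  by move=> lb; rewrite mem_act ltn_mod kk /md (periodic_modn _ len_per).
have sub : {subset [:: md b1; md b2; md b3] <= act}.
  by move=> x; rewrite !inE => /or3P[] /eqP ->; apply: in_act.
apply: (uniq_leq_size _ sub); rewrite /= !inE !negb_or /= andbT.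
rewrite !neq //; rewrite /b1 /b2 /b3; lia.
Qed.

Let a_next (t : 'I_n) : corner (a t).+1 = corner (a (ordS t)).
Proof.
have tn := ltn_ord t; rewrite /=; have [tn1|tn1] := ltnP t.+1 n.
  rewrite modn_small //; have lt := a_mono (ltnSn t) tn1.
  rewrite -(subnKC lt); apply/esym/corner_const => m hm.
  rewrite leNgt; apply/negP => lm.
  have [|s sn es] := a_index _ lm; first by have [] := act_nth tn1; lia.
  have [st|st|st] := ltngtP s t.
  - by have := a_mono st tn; rewrite es; lia.
  - move: st; rewrite leq_eqVlt => /orP[/eqP st|st]; first by move: hm; rewrite st es; lia.
    by have := a_mono st sn; rewrite es; lia.
  - by move: es; rewrite st; lia.
have -> : (t.+1 = n)%N by apply/eqP; rewrite eqn_leq tn1 ltn_ord.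
rewrite modnn -(corner_per (a 0)) -addnA.
have [a_t _] := act_nth tn.
have lt : (a t < a 0 + (k + k))%N by lia.
rewrite -(subnKC lt); apply/esym/corner_const => m hm.
rewrite leNgt; apply/negP => lm.
have [bk|bk] := ltnP ((a t).+1 + m) (k + k).
  have [s sn es] := a_index bk lm.
  have [st|st|st] := ltngtP s t.
  - by have := a_mono st tn; rewrite es; lia.
  - by lia.
  - by move: es; rewrite st; lia.
have lm' : 0 < len ((a t).+1 + m - (k + k)).
  by rewrite -len_per -addnA subnK.
have [a_0 _] : (a 0 < k + k)%N /\ 0 < len (a 0) by apply: act_nth; lia.
have [|s sn es] := a_index _ lm'; first by lia.
have [s0|s0] := posnP s; first by move: es; rewrite s0; lia.
by have := a_mono s0 sn; rewrite es; lia.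
Qed.

(** Strictness in [sturm] needs a nondegenerate side strictly between the corner and the line. Going
    forward at most half a turn, side [s] itself serves; otherwise, going backward, the side after
    [t] does. *)
Let off (s t : 'I_n) : s != t -> s != ordS t ->
  dot (normal (a t).+1) (corner (a s)) < h (a t).+1.
Proof.
move=> st sSt; have sn := ltn_ord s; have tn := ltn_ord t.
have [as_ ls] := act_nth sn; have [at_ lt] := act_nth tn.
have st' : (s != t :> nat)%N by [].
have sSt' : (s != t.+1 %% n :> nat)%N by [].
have [ts|ts|ts] := ltngtP s t; last by rewrite ts eqxx in st'.
  have ast := a_mono ts tn; pose j := ((a t).+1 - a s)%N.
  have ej : (a t).+1 = (a s + j)%N by rewrite subnKC // ltnW // ltnS ltnW.
  rewrite ej -subr_gt0; have [jk|jk] := leqP j k.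
    by case: (g_ge (a s) jk) => _; apply; exists 0%N; rewrite addn0; split => //; rewrite /j; lia.
  case: (@g_ge' (a s) j); first by rewrite jk /j; lia.
  move=> _; apply; have [tn1|tn1] := ltnP t.+1 n.
    have at1 := a_mono (ltnSn t) tn1; have [at2 lt2] := act_nth tn1.
    by exists (a t.+1 - a s)%N; rewrite subnKC; [split => //; rewrite /j; lia|lia].
  have tn' : (t.+1 = n)%N by apply/eqP; rewrite eqn_leq tn1 ltn_ord.
  move: sSt'; rewrite tn' modnn -lt0n => s0.
  have a0s := a_mono s0 sn.
  exists (a 0 + k + k - a s)%N; rewrite subnKC; last by lia.
  rewrite len_per; split; first by rewrite /j; lia.
  by have [] := @act_nth 0; first by lia.
have ats := a_mono ts sn; pose j := ((a t).+1 + (k + k) - a s)%N.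
have ej : ((a t).+1 + (k + k) = a s + j)%N by rewrite subnKC //; lia.
rewrite -(@normalD2k R k k_gt0 (a t).+1) -h_per -!addnA ej -subr_gt0.
have [jk|jk] := leqP j k.
  by case: (g_ge (a s) jk) => _; apply; exists 0%N; rewrite addn0; split => //; rewrite /j; lia.
case: (@g_ge' (a s) j); first by rewrite jk /j; lia.
move=> _; apply; have tn1 : (t.+1 < n)%N by lia.
rewrite modn_small // in sSt'; have ts1 : (t.+1 < s)%N by lia.
have at1 := a_mono ts1 sn; have at0 := a_mono (ltnSn t) tn1.
exists (a t.+1 + k + k - a s)%N; rewrite subnKC; last by lia.
rewrite len_per; split; first by rewrite /j; lia.
by have [] := act_nth tn1.
Qed.

Lemma dir_mod i : exists2 s : R, s != 0 & dir i = s *: dir (i %% k).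
Proof.
rewrite {1}(divn_eq i k); elim: (i %/ k)%N => [|q [s s0 IH]].
  by exists 1; rewrite ?oner_neq0 // mul0n add0n scale1r.
exists (- s); first by rewrite oppr_eq0.
by rewrite mulSn -addnA addnC dirDk // IH scaleNr.
Qed.

Lemma bounded_of_normals (A : set point) :
  (forall i, exists M, forall x, A x -> dot (normal i) x <= M) -> bounded_set A.
Proof.
move=> bA; have [M0 h0] := bA 0%N; have [M1 h1] := bA 1%N.
have [M2 h2] := bA (0 + k)%N; have [M3 h3] := bA (1 + k)%N.
have c01 : angle 0 = 0 by rewrite /angle !mul0r.
have n0 : normal 0 = (0, -1) by rewrite /normal c01 sin0 cos0.
pose M := `|M0| + `|M2|; pose N := (M + `|M1| + `|M3|) / s1.
apply/bounded_setP; exists (M + N) => x Ax.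
have := h0 x Ax; have := h1 x Ax; have := h2 x Ax; have := h3 x Ax.
rewrite !normalDk // !dotN n0 /dot /=.
move=> b3 b2 b1 b0.
have := ler_norm M0; have := ler_norm M1; have := ler_norm M2; have := ler_norm M3.
move=> m3 m2 m1 m0.
have M_ge0 : 0 <= M by rewrite addr_ge0.
have N_ge0 : 0 <= N by rewrite divr_ge0 ?(ltW s1_gt0) // !addr_ge0.
have x2M : `|x.2| <= M.
  by rewrite ler_norml; apply/andP; split; rewrite /M; have := normr_ge0 M0; have := normr_ge0 M2; lra.
have cM : `|c1 * x.2| <= M.
  rewrite normrM (le_trans _ x2M) // ler_piMl // cos_max //.
have x1N : `|x.1| <= N.
  rewrite /N ler_pdivlMr // -[X in _ * X](gtr0_norm s1_gt0) -normrM mulrC.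
  move: cM; rewrite !ler_norml => /andP[c2 c3].
  by apply/andP; split; have := normr_ge0 M1; have := normr_ge0 M3; lra.
by split; lra.
Qed.

Lemma closed_halfplanes : closed T.
Proof.
have -> : T = \bigcap_(i in [set: nat]) [set x | dot (normal i) x <= h i].
  by apply/seteqP; split => x; [move=> Tx i _|move=> Tx i]; exact: Tx.
by apply: closed_bigI => i _; exact: closed_dot_le.
Qed.

Lemma convex_halfplanes : convex_set (T : set (convex_lmodType point)).
Proof.
apply/convex_setP => x y t t0 t1 Tx Ty i.
apply: line_segment_dot (Tx i) (Ty i).
by exists t => //; rewrite /= in_itv /= t0.
Qed.

Lemma tight_lizard : convex_lizard k T.
Proof.
split; last exact: convex_halfplanes.
pose p (t : 'I_n) := corner (a t).
have sideP (t : 'I_n) : p (ordS t) = corner (a t).+1 by rewrite /p -a_next.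
have sub_side t : polygon_side p t `<=` T.
  move=> x xs i; apply: (line_segment_dot xs); exact: corner_in.
exists n, p; split.
- apply: (@strictly_convex_chain _ _ p (fun t => normal (a t).+1) (fun t => h (a t).+1)) => //.
  + by move=> t; rewrite /p corner_lineS.
  + by move=> t; rewrite sideP corner_line.
- apply/esym.
  (* On the line [b.+1] the neighbouring half-planes [b] and [b.+2] leave exactly the segment from
     [corner b] to [corner b.+1]. *)
  have face b x : T x -> dot (normal b.+1) x = h b.+1 -> polygon_boundary p x.
    move=> Tx hx; have := line_param hx; set t' := _ - _ => xE.
    have t'0 : t' <= 0.
      have := Tx b.+2; rewrite xE dotDr dotZr corner_lineS dot_normalS_dir gerDl.
      by rewrite pmulr_lle0.
    have tl : 0 <= len b + t'.
      have := Tx b; rewrite xE cornerS 2!dotDr 2!dotZr corner_line dot_normal_dirS.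
      by rewrite -addrA gerDl !mulrN -opprD oppr_le0 -mulrDl pmulr_lge0.
    have {}xE : x = corner b + (len b + t') *: dir b.+1.
      by rewrite scalerDl addrA -cornerS.
    (* A degenerate side is a single point, which is also the initial vertex of the next
       nondegenerate side. *)
    have [lb|lb] := ltP 0 (len b); last first.
      have {}xE : x = corner b.
        have z : len b + t' = 0 by lra.
        by rewrite xE z scale0r addr0.
      have [m [cm lm]] := next_active b.
      have [||r rn ar] := @a_index ((b + m) %% (k + k)).
      - by rewrite ltn_mod addn_gt0 k_gt0.
      - by rewrite (periodic_modn _ len_per).
      exists (Ordinal rn) => //; rewrite xE -cm -(periodic_modn _ corner_per) -ar.
      exact: line_segment_left.
    have [||r rn ar] := @a_index (b %% (k + k)).
    - by rewrite ltn_mod addn_gt0 k_gt0.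
    - by rewrite (periodic_modn _ len_per).
    exists (Ordinal rn) => //; rewrite /polygon_side sideP /p /= ar.
    rewrite (periodic_modn _ corner_per) (@periodic_modn k _ (fun i => corner i.+1)); last first.
      by move=> i; rewrite -!addSn corner_per.
    rewrite cornerS xE; exists ((len b + t') / len b).
      rewrite /= in_itv /= divr_ge0 ?(ltW lb) // ler_pdivrMr //; lra.
    move: (corner b) (dir b.+1) => q d.
    by rewrite scalerDr scalerA divfK ?gt_eqF // addrA -scalerDl subrK scale1r.
  apply: (@region_of_separation _ _ _ (\bigcup_(i in `I_(k + k)) [set x | h i <= dot (normal i) x])).
  + exact: closed_halfplanes.
  + apply: closed_bigcup; first exact: finite_II.
    move=> i _; have -> : [set x | h i <= dot (normal i) x] = [set x : point | dot (- normal i) x <= - h i].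
      by apply/seteqP; split => x /=; rewrite dotN lerN2.
    exact: closed_dot_le.
  + apply/seteqP; split => // x _; have [Tx|nTx] := pselect (T x); [by left|right].
    move/existsNP : nTx => [i /negP]; rewrite -ltNge => hi.
    exists (i %% (k + k))%N; first by rewrite /= ltn_mod addn_gt0 k_gt0.
    rewrite /= (periodic_modn _ h_per) (@periodic_modn k _ normal) ?ltW //; exact: normalD2k.
  + apply/seteqP; split => x.
      (* [face] speaks of a successor index, so [i], which may be [0], is replaced by [i + 2k]. *)
      move=> [Tx [i _ /= hi]]; apply: (face (i + k + k).-1) => //.
      have -> : (i + k + k).-1.+1 = (i + k + k)%N by rewrite prednK // addn_gt0 k_gt0 orbT.
      by rewrite h_per normalD2k //; apply/eqP; rewrite eq_le hi Tx.
    move=> [t _ xt]; split; first exact: (sub_side t).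
    exists ((a t).+1 %% (k + k))%N; first by rewrite /= ltn_mod addn_gt0 k_gt0.
    rewrite /= (periodic_modn _ h_per) (@periodic_modn k _ normal); last exact: normalD2k.
    rewrite -lerN2 -dotN; apply: (line_segment_dot xt); rewrite dotN ?sideP.
      by rewrite corner_lineS.
    by rewrite corner_line.
  + apply: bounded_of_normals => i; exists (h i) => x; exact.
  + move=> x /existsNP [i /negP]; rewrite -ltNge => hi; exists (normal i).
      apply/eqP => n0; have := dot_normal_self i; rewrite n0 /dot /= !mul0r addr0.
      by move=> /esym/eqP; rewrite oner_eq0.
    move=> r r0 [t _ /sub_side /(_ i)]; rewrite dotDr dotZr dot_normal_self mulr1.
    by rewrite leNgt ltr_wpDr.
- move=> t; have [s s0 e] := dir_mod (a t).+1; have [at_ lt] := act_nth (ltn_ord t).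
  exists (angle ((a t).+1 %% k)); split.
    by exists ((a t).+1 %% k)%N; split => //; rewrite ltn_mod.
  exists (len (a t) * s); split; first by rewrite mulf_neq0 // gt_eqF.
  by rewrite sideP /p cornerS addrAC subrr add0r e scalerA.
Qed.

End HalfplaneIntersection.

(** * Finiteness of the set of scales *)

Section FiniteScales.
Variables (R : realType) (k : nat).
Hypothesis k_gt1 : (1 < k)%N.
Local Notation point := (R * R)%type.
Local Notation normal := (normal R k).
Local Notation dir := (dir R k).
Local Notation angle := (angle R k).
Let k_gt0 : (0 < k)%N. Proof. exact: ltnW. Qed.

(** Expresses, by separating points, that [T] is an intersection of closed half-planes with allowed
    normals. *)
Definition halfplanes_closed (T : set point) : Prop := forall x, ~ T x ->
  exists i c, (forall y, T y -> dot (normal i) y <= c) /\ c < dot (normal i) x.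

Definition noncollinear (T : set point) : Prop :=
  exists a b c, [/\ T a, T b, T c & cross (b - a) (c - a) != 0].

(** The bounds [h] are the suprema over [T] rather than any given ones: this tightness yields
    [h_conv] through [normal_rec], and it lets redundant half-planes become degenerate sides. The
    centroid of three noncollinear points is strictly inside every half-plane. *)
Lemma convex_lizard_of_halfplanes (T : set point) :
  halfplanes_closed T -> bounded_set T -> noncollinear T -> convex_lizard k T.
Proof.
move=> cT /bounded_setP[M TM] [a [b [c [Ta Tb Tc abc]]]].
pose h i := sup (dot (normal i) @` T).
have T0 i : (dot (normal i) @` T) !=set0 by exists (dot (normal i) a), a.
have ub i : has_ubound (dot (normal i) @` T).
  exists (`|(normal i).1| * M + `|(normal i).2| * M) => _ [x Tx <-].
  have [x1 x2] := TM x Tx; rewrite /dot (le_trans (ler_norm _)) //.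
  by rewrite (le_trans (ler_normD _ _)) // !normrM lerD // ler_wpM2l.
have hle i x : T x -> dot (normal i) x <= h i.
  by move=> Tx; apply: ub_le_sup => //; exists x.
have c0 : 0 <= cos (angle 1).
  apply: cos_ge0_pihalf; rewrite /angle mul1r; apply/andP; split.
    by rewrite (@le_trans _ _ 0) ?oppr_le0 ?divr_ge0 ?pi_ge0.
  by rewrite ler_wpM2l ?pi_ge0 // lef_pV2 ?posrE ?ltr0n // ler_nat.
have TE : T = [set x | forall i, dot (normal i) x <= h i].
  apply/seteqP; split => x; first by move=> Tx i; exact: hle.
  move=> hx; apply: contrapT => /cT [i [e [Te ex]]].
  have : h i <= e by apply: ge_sup => // _ [y Ty <-]; exact: Te.
  by rewrite leNgt (lt_le_trans ex).
pose o : point := 3^-1 *: (a + b + c).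
rewrite TE; apply: (@tight_lizard _ _ k_gt1 h _ _ o).
- by move=> i; rewrite /h normalD2k.
- move=> i; have key x : T x -> 2 * cos (angle 1) * dot (normal i.+1) x <= h i.+2 + h i.
    by move=> Tx; rewrite -dotZl -normal_rec // dotDl lerD // hle.
  move: c0; rewrite le_eqVlt => /orP[/eqP c0|c0].
    by have := key a Ta; rewrite -c0 mulr0 !mul0r.
  rewrite mulrC -ler_pdivlMr ?mulr_gt0 //; apply: ge_sup => // _ [x Tx <-].
  by rewrite ler_pdivlMr ?mulr_gt0 // mulrC key.
- move=> i; rewrite /o dotZr !dotDr.
  have ha := hle i a Ta; have hb := hle i b Tb; have hc := hle i c Tc.
  suff : ~ [/\ dot (normal i) a = h i, dot (normal i) b = h i & dot (normal i) c = h i].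
    move=> H; rewrite ltNge; apply/negP => hn; apply: H; split; lra.
  move=> [ea eb ec]; move: abc => /eqP; apply.
  have eb' : dot (normal i) (b - a) = 0 by rewrite dotBr eb ea subrr.
  have ec' : dot (normal i) (c - a) = 0 by rewrite dotBr ec ea subrr.
  move: (b - a) (c - a) eb' ec' => u v; rewrite /dot /cross /=.
  have := cos2Dsin2 (angle i); move: (sin _) (cos _) => s t e eu ev.
  have su : s * u.1 = t * u.2 by lra.
  have sv : s * v.1 = t * v.2 by lra.
  rewrite -[LHS]mul1r -e.
  have -> : (t ^+ 2 + s ^+ 2) * (u.1 * v.2 - u.2 * v.1) =
    s * v.2 * (s * u.1 - t * u.2) - s * u.2 * (s * v.1 - t * v.2) -
    t * u.1 * (s * v.1 - t * v.2) + t * v.1 * (s * u.1 - t * u.2) by ring.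
  by rewrite su sv !subrr !mulr0 !subr0 addr0.
Qed.

(** Of three consecutive vertices on a line, one is between the others. If it is an outer one, the
    two sides share more than their common vertex; if it is the middle one, the angle is
    straight. *)
Lemma convex_lizard_noncollinear (S : set point) :
  lizard k S -> noncollinear S.
Proof.
move=> [n [p [[n_gt2 inj consec _ nostraight] -> _]]].
have n_gt0 : (0 < n)%N by exact: leq_trans n_gt2.
pose i0 := Ordinal n_gt0.
have nS (t : 'I_n) : ordS t != t by exact: ordS_neq.
pose a := p i0; pose b := p (ordS i0); pose c := p (ordS (ordS i0)).
exists a, b, c; split; try exact: region_vertex.
apply/negP => /eqP abc.
have ab : b - a != 0.
  by rewrite subr_eq0; apply: contra_neq (nS i0) => /inj.
have bc : c - b != 0.
  by rewrite subr_eq0; apply: contra_neq (nS (ordS i0)) => /inj.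
have /seteqP [cs _] := consec i0.
have side0 x : line_segment a b x -> polygon_side p i0 x by [].
have side1 x : line_segment b c x -> polygon_side p (ordS i0) x by [].
have nostr : ~ line_segment a c b := nostraight i0.
have uu := dot_self_gt0 ab.
pose l := dot (b - a) (c - a) / dot (b - a) (b - a).
have cE : c - a = l *: (b - a).
  apply: (scalerI (lt0r_neq0 uu)); rewrite scalerA mulrC divfK ?gt_eqF //.
  move: abc; move: (b - a) (c - a) => u v; rewrite /cross /dot => uv.
  have uv2 : u.1 * v.2 = u.2 * v.1 by lra.
  apply: injective_projections; rewrite /= /GRing.scale /=.
    have := congr1 (fun z => u.2 * z) uv2; rewrite /=; lra.
  have := congr1 (fun z => u.1 * z) uv2; rewrite /=; lra.
have {}cE : c = a + l *: (b - a) by rewrite -cE addrC subrK.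
have [l0|l0] := ltP l 0.
  have : line_segment b c a.
    exists (1 / (1 - l)).
      by rewrite /= in_itv /= divr_ge0 ?ler_pdivrMr //; lra.
    rewrite cE; apply: injective_projections; rewrite /= /GRing.scale /=; field; rewrite gt_eqF //; lra.
  move=> /side1 h; have /cs /= e : (polygon_side p i0 `&` polygon_side p (ordS i0)) a.
    by split => //; apply: side0; exact: line_segment_left.
  by move: ab; rewrite /b -e subrr eqxx.
have [l1|l1] := leP l 1.
  have : line_segment a b c.
    exists l; first by rewrite /= in_itv /= l0 l1.
    by rewrite cE; apply: injective_projections; rewrite /= /GRing.scale /=; ring.
  move=> /side0 h; have /cs /= e : (polygon_side p i0 `&` polygon_side p (ordS i0)) c.
    by split => //; apply: side1; exact: line_segment_right.
  by move: bc; rewrite /b -e subrr eqxx.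
apply: nostr; exists l^-1.
  by rewrite /= in_itv /= invr_ge0 l0 invf_le1 ?ltW //; lra.
rewrite cE; apply: injective_projections; rewrite /= /GRing.scale /=; field; rewrite gt_eqF //; lra.
Qed.

Lemma open_decrease (W : set point) i x : open W -> W x ->
  exists2 y, W y & dot (normal i) y < dot (normal i) x.
Proof.
move=> oW Wx; have /nbhs_ballP [e /= e0 eW] : nbhs x W by exact: open_nbhs_nbhs.
have [r [r0 re]] : exists r, 0 < r /\ r < e by exists (e / 2); split; lra.
exists (x - r *: normal i).
  apply: eW; rewrite -ball_normE /ball_ /= subKr prod_normE gt_max /= /GRing.scale /=.
  rewrite !normrM normrN (gtr0_norm r0).
  have h1 := sin_max (angle i); have h2 := cos_max (angle i).
  by apply/andP; split; (apply: le_lt_trans re; rewrite ler_piMr // ltW).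
by rewrite dotBr dotZr dot_normal_self mulr1 ltrBlDr ltrDl.
Qed.

Lemma finite_scales (L C : set point) (I : finType) (W : I -> set point) :
  L = [set x | C x /\ forall m, ~ W m x] ->
  bounded_set L -> halfplanes_closed C ->
  (forall m, open (W m)) ->
  (forall m, convex_set (W m : set (convex_lmodType point))) ->
  (forall m, has_corners k (W m)) ->
  finite_set [set S | lizard_scale k L S].
Proof.
move=> LE bL cC oW cW Wc.
pose F (iota : {ffun I -> 'I_(k + k)}) : set point :=
  [set x | C x /\ forall m y, W m y -> dot (normal (iota m)) x <= dot (normal (iota m)) y].
apply: (@sub_finite_set _ _ (F @` setT)); last first.
  exact/finite_image/finite_finset.
move=> S [cS SL Smax].
have /choice [io ioP] : forall m, exists i : 'I_(k + k), forall x y, S x -> W m y ->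
    dot (normal i) x <= dot (normal i) y.
  move=> m; have [|i ik iP] := @allowed_separation _ _ k_gt1 S (W m) cS (cW m) (Wc m).
    apply/seteqP; split => x // [/SL]; rewrite LE => -[_ /(_ m)].
    by [].
  by exists (Ordinal ik).
(* A point of the open notch [W m] never minimizes the normal on [W m], so it violates the
   half-plane chosen for [m]. *)
have FL : F (finfun io) `<=` L.
  move=> x [Cx Fx]; rewrite LE; split => // m Wx.
  have [y Wy] := @open_decrease (W m) (io m) x (oW m) Wx.
  by rewrite ltNge => /negP; apply; move: (Fx m y Wy); rewrite ffunE.
have SF : S `<=` F (finfun io).
  move=> x Sx; split; first by move: (SL _ Sx); rewrite LE => -[].
  by move=> m y Wy; rewrite ffunE; exact: ioP.
exists (finfun io) => //; apply: Smax => //.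
apply: convex_lizard_of_halfplanes.
- move=> x /= /not_andP[/cC [i [c [h1 h2]]]|].
    by exists i, c; split => // y [Cy _]; exact: h1.
  move=> /existsNP [m /existsNP [y /not_implyP [Wy /negP]]]; rewrite -ltNge => h.
  exists (finfun io m), (dot (normal (finfun io m)) y); split => // z [_]; exact.
- move/bounded_setP : bL => [M LM]; apply/bounded_setP; exists M => x /FL; exact: LM.
- have [a [b [c [Sa Sb Sc abc]]]] := convex_lizard_noncollinear cS.1.
  by exists a, b, c; split => //; exact: SF.
Qed.

End FiniteScales.

(** * Simple chains given as lists of vertices, and their closing *)

Section Arcs.
Variable R : realType.
Local Notation point := (R * R)%type.

Fixpoint arc (l : seq point) : set point :=
  if l is x :: l' then
    if l' is y :: _ then line_segment x y `|` arc l' else [set x]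
  else set0.

(** Each side is compared with the whole remaining arc, so that simplicity of the outline can be
    proved by induction on the gates. The closing side is added in [simple_closed_arc]. *)
Fixpoint simple_arc (l : seq point) : Prop :=
  if l is x :: l' then
    if l' is y :: l'' then
      [/\ x <> y,
          (forall z, line_segment x y z -> arc l' z -> z = y),
          (if l'' is w :: _ then ~ line_segment x w y else True)
        & simple_arc l']
    else True
  else True.

Lemma arc_nth l z : (1 < size l)%N -> arc l z <->
  exists i, (i.+1 < size l)%N /\ line_segment (nth 0 l i) (nth 0 l i.+1) z.
Proof.
elim: l => // x [//|y l] IH _; case: l IH => [_|w l IH].
  split=> [[h|->]|[[|i] [il h]]].
  - by exists 0%N.
  - by exists 0%N; split => //; exact: line_segment_right.
  - by left.
  - by [].
split=> [[h|/(IH isT) [i [il h]]]|[[|i] [il h]]].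
- by exists 0%N.
- by exists i.+1.
- by left.
- by right; apply/(IH isT); exists i.
Qed.

Lemma simple_arc_neq l i : simple_arc l -> (i.+1 < size l)%N ->
  nth 0 l i <> nth 0 l i.+1.
Proof.
elim: l i => // x [|y l] IH [|i] //.
  by move=> [].
by move=> [_ _ _ sl] il; exact: IH.
Qed.

Lemma simple_arc_straight l i : simple_arc l -> (i.+2 < size l)%N ->
  ~ line_segment (nth 0 l i) (nth 0 l i.+2) (nth 0 l i.+1).
Proof.
elim: l i => // x [|y l] IH [|i] //.
  by case: l IH => // w l _ [].
by move=> [_ _ _ sl] il; exact: IH.
Qed.

Lemma simple_arc_meet l i j z : simple_arc l -> (i < j)%N -> (j.+1 < size l)%N ->
  line_segment (nth 0 l i) (nth 0 l i.+1) z ->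
  line_segment (nth 0 l j) (nth 0 l j.+1) z -> j = i.+1 /\ z = nth 0 l i.+1.
Proof.
have meet l' i' j' : simple_arc l' -> (i' < j')%N -> (j'.+1 < size l')%N ->
    line_segment (nth 0 l' i') (nth 0 l' i'.+1) z ->
    line_segment (nth 0 l' j') (nth 0 l' j'.+1) z -> z = nth 0 l' i'.+1.
  elim: l' i' j' => // x [|y l'] IH [|i'] [|j'] //; last first.
    by move=> [_ _ _ sl] ij jl; exact: IH.
  move=> [_ h _ _] _ jl s1 s2; apply: h => //.
  by apply/arc_nth; [move: jl => /=; lia|exists j'].
move=> sl ij jl si sj; have zE := meet _ _ _ sl ij jl si sj; split => //.
(* If [j] exceeded [i.+1], then [z] would also be the far end of side [i.+1], whereas consecutive
   vertices differ. *)
apply/eqP; rewrite eqn_leq ij andbT leqNgt; apply/negP => ij1.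
have := meet l i.+1 j sl ij1 jl; rewrite zE => /(_ (line_segment_left _ _)).
rewrite -zE => /(_ sj); rewrite zE => /simple_arc_neq.
by apply => //; lia.
Qed.

Lemma simple_arc_inj l i j : simple_arc l -> (i < j)%N -> (j < size l)%N ->
  nth 0 l i <> nth 0 l j.
Proof.
move=> sl ij jl e; case: j ij jl e => // j; rewrite ltnS leq_eqVlt => /orP[/eqP <-|ij] jl e.
  exact: simple_arc_neq sl jl e.
have [ji] : j = i.+1 /\ nth 0 l i = nth 0 l i.+1.
  apply: (simple_arc_meet sl ij jl); first exact: line_segment_left.
  rewrite e; exact: line_segment_right.
by move=> e2; apply: (simple_arc_neq sl _ e2); lia.
Qed.

Variable l : seq point.
Let n := size l.
Let q i := nth 0 l i.
Let p (i : 'I_n) : point := nth 0 l i.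
Hypothesis n_gt2 : (2 < n)%N.
Hypothesis sl : simple_arc l.
Hypothesis closing : forall z, line_segment (q n.-1) (q 0) z -> arc l z ->
  z = q n.-1 \/ z = q 0.
Hypothesis straight1 : ~ line_segment (q n.-2) (q 0) (q n.-1).
Hypothesis straight2 : ~ line_segment (q n.-1) (q 1) (q 0).

Let n1 : n.-1.+1 = n. Proof. by rewrite prednK //; lia. Qed.

Let ordS_val (i : 'I_n) : (ordS i : nat) = if i.+1 == n then 0%N else i.+1.
Proof.
rewrite /=; have [->|ne] := eqVneq i.+1 n; first by rewrite modnn.
by rewrite modn_small //; have := ltn_ord i; lia.
Qed.

Let sideE (i : 'I_n) : polygon_side p i =
  line_segment (q i) (if i.+1 == n then q 0 else q i.+1).
Proof. by rewrite /polygon_side /p -/(q i) -/(q (ordS i)) ordS_val; case: ifP. Qed.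

Let closing_side i z : (i.+1 < n)%N -> line_segment (q n.-1) (q 0) z ->
  line_segment (q i) (q i.+1) z ->
  (i = 0%N /\ z = q 0) \/ (i = n.-2 /\ z = q n.-1).
Proof.
move=> il zc zi; have [|zE|zE] := closing zc.
- by apply/arc_nth; [rewrite -/n; lia|exists i].
- have [->|ine] := eqVneq i n.-2; [by right|exfalso].
  have [||||_ e] := @simple_arc_meet l i n.-2 z sl.
  + by lia.
  + by rewrite -/n; lia.
  + exact: zi.
  + rewrite zE; have -> : n.-1 = n.-2.+1 by lia.
    exact: line_segment_right.
  apply: (@simple_arc_inj l i.+1 n.-1 sl); rewrite -/n; [by lia|by lia|].
  by rewrite -/(q n.-1) -zE e.
- have [->|ine] := posnP i; [by left|exfalso].
  have [||_ e] := @simple_arc_meet l 0 i z sl ine il.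
  + rewrite zE; exact: line_segment_left.
  + exact: zi.
  apply: (@simple_arc_neq l 0 sl); rewrite -/n; first by lia.
  by rewrite -/(q 0) -zE e.
Qed.

Lemma simple_closed_arc : simple_closed_chain p.
Proof.
have inj : injective p.
  move=> i j e; apply: val_inj => /=; have [ij|ij|//] := ltngtP i j.
    by case: (simple_arc_inj sl ij (ltn_ord j)).
  by case: (simple_arc_inj sl ij (ltn_ord i)).
split => //.
- move=> i; apply/seteqP; split => z; last first.
    by move=> ->; split; [exact: line_segment_right|exact: line_segment_left].
  rewrite !sideE ordS_val => -[]; have [i1|i1] := eqVneq i.+1 n.
    have in1 : (i = n.-1 :> nat)%N by lia.
    have -> : (1%N == n) = false by lia.
    rewrite in1 => z1 z2; have [|[_ ->]|[]] := @closing_side 0 z _ z1 z2; [lia| |lia].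
    by rewrite /= /p ordS_val i1 eqxx.
  have [i2|i2] := eqVneq i.+2 n.
    have in1 : (i.+1 = n.-1 :> nat)%N by lia.
    move=> z1; rewrite in1 => z2; have [|[]|[_ ->]] := @closing_side i z _ z2 z1.
    + by lia.
    + by lia.
    + by rewrite /= /p ordS_val (negbTE i1) in1.
  move=> z1 z2; have il := ltn_ord i.
  have il2 : (i.+2 < size l)%N by rewrite -/n; lia.
  have [_ ->] := simple_arc_meet sl (ltnSn i) il2 z1 z2.
  by rewrite /= /p ordS_val (negbTE i1).
- have wlog_ (i j : 'I_n) z : (i < j)%N -> j != ordS i -> i != ordS j ->
      polygon_side p i z -> polygon_side p j z -> False.
    move=> ij ji1 ij1; rewrite !sideE.
    have jn := ltn_ord j.
    have -> : (i.+1 == n) = false by lia.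
    have ji : (j != i.+1 :> nat)%N.
      apply: contra_neq ji1 => e; apply: ord_inj; rewrite ordS_val -e.
      by rewrite (ltn_eqF jn).
    have [j1|j1] := eqVneq j.+1 n => z1 z2.
      have jn1 : (j = n.-1 :> nat)%N by lia.
      have i0 : (i != 0 :> nat)%N.
        by apply: contra_neq ij1 => e; apply: ord_inj; rewrite ordS_val j1 eqxx.
      have il : (i.+1 < n)%N by lia.
      by rewrite jn1 in z2; have [[]|[]] := closing_side il z2 z1; lia.
    have jl : (j.+1 < size l)%N by rewrite -/n; lia.
    by have [] := simple_arc_meet sl ij jl z1 z2; lia.
  move=> i j ji jSi iSj; apply/seteqP; split => z // [zi zj].
  have [ij|ij|/val_inj ij] := ltngtP i j.
  + exact: wlog_ ij jSi iSj zi zj.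
  + exact: wlog_ ij iSj jSi zj zi.
  + by rewrite ij eqxx in ji.
- move=> i; rewrite /p (ordS_val (ordS i)) !ordS_val.
  have il := ltn_ord i.
  have [i1|i1] := eqVneq i.+1 n.
    have -> : (1%N == n) = false by lia.
    by have -> : (i = n.-1 :> nat)%N by lia.
  have [i2|i2] := eqVneq i.+2 n.
    have -> : (i.+1 = n.-1 :> nat)%N by lia.
    by have -> : (i = n.-2 :> nat)%N by lia.
  by apply: simple_arc_straight => //; rewrite -/n; lia.
Qed.

Lemma boundary_closed_arc : polygon_boundary p = arc l `|` line_segment (q n.-1) (q 0).
Proof.
apply/seteqP; split => z.
  move=> [i _]; rewrite sideE; have il := ltn_ord i; case: eqVneq => i1.
    by (have -> : (i = n.-1 :> nat)%N by lia); right.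
  by move=> zi; left; apply/arc_nth; [exact: ltnW|exists i; split => //; rewrite -/n; lia].
move=> [/arc_nth|zc].
  move=> /(_ (ltnW n_gt2)) [i [il zi]].
  exists (Ordinal (ltnW il)) => //; rewrite sideE /=.
  by have -> : (i.+1 == n) = false by rewrite /n; lia.
have nn : (n.-1 < n)%N by lia.
by exists (Ordinal nn) => //; rewrite sideE /= n1 eqxx.
Qed.

End Arcs.

(** * The tower *)

Section Outline.
Variables (R : realType) (kap s : R) (m : nat).
Hypothesis kap_gt0 : 0 < kap.
Hypothesis s_ge : 5 / 2 <= s.
Hypothesis s_le : s <= 4.
Local Notation point := (R * R)%type.

(* For [kap = cot (pi / k)] the lines [x - v = c] and [x + v = c] have allowed directions. *)
Definition pt (x v : R) : point := (x, v / kap).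
Definition ht (z : point) : R := kap * z.2.

Lemma ht_pt x v : ht (pt x v) = v.
Proof. by rewrite /ht /pt /= mulrC divfK // gt_eqF. Qed.

Lemma pt_inj z x v : z.1 = x -> ht z = v -> z = pt x v.
Proof.
move=> <- <-; rewrite /pt /ht; apply: injective_projections => //=.
by rewrite mulrC mulKf // gt_eqF.
Qed.

Ltac seglra := lazymatch goal with
  | |- _ = _ :> (_ * _)%type => apply: pt_inj; lra
  | |- _ => lra
  end.

Lemma segH x x' v z : x < x' ->
  line_segment (pt x v) (pt x' v) z <-> ht z = v /\ x <= z.1 <= x'.
Proof.
move=> xx'; split.
  move=> /line_segmentP [t [t0 t1 e1 e2]]; rewrite /ht e1 e2 /=.
  split; last by nra.
  by field; rewrite gt_eqF.
move=> [hz /andP[x1 x2]]; rewrite [z](pt_inj erefl hz).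
exists ((z.1 - x) / (x' - x)).
  rewrite /= in_itv /= divr_ge0 ?ler_pdivrMr; lra.
by apply: injective_projections; rewrite /= /GRing.scale /=; field; rewrite ?gt_eqF //; lra.
Qed.

Lemma segS sg x v x' v' z : v < v' -> x' = x + sg * (v' - v) ->
  line_segment (pt x v) (pt x' v') z <-> v <= ht z <= v' /\ z.1 = x + sg * (ht z - v).
Proof.
move=> vv' ->; split.
  move=> /line_segmentP [t [t0 t1 e1 e2]].
  have hz : ht z = (1 - t) * v + t * v'.
    by rewrite /ht e2 /=; field; rewrite gt_eqF.
  by rewrite hz e1 /=; split; [nra|ring].
move=> [/andP[h1 h2] e]; rewrite [z](pt_inj e erefl).
exists ((ht z - v) / (v' - v)).
  rewrite /= in_itv /= divr_ge0 ?ler_pdivrMr; lra.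
by apply: injective_projections; rewrite /= /GRing.scale /=; field; rewrite ?gt_eqF //; lra.
Qed.

Lemma segC (a b z : point) : line_segment a b z <-> line_segment b a z.
Proof. by split; exact: line_segment_sym. Qed.

Lemma not_straight (x y w : point) :
  ht y = ht x -> ht w <> ht x -> y.1 <> x.1 -> ~ line_segment x w y.
Proof.
rewrite /ht => /(mulfI (lt0r_neq0 kap_gt0)) yx wx yx1 /line_segmentP [t [t0 t1 e1 e2]].
have /eqP : t * (w.2 - x.2) = 0 by move: e2; rewrite yx; lra.
rewrite mulf_eq0 => /orP[/eqP t00|/eqP /subr0_eq h].
  by apply: yx1; rewrite e1 t00; ring.
by apply: wx; rewrite h.
Qed.

Definition gate_x i : R := i%:R * s.
Local Notation X := gate_x.
Definition right_x : R := X m + 20.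
Local Notation XR := right_x.

Let s_ge0 : 0 <= s. Proof. by have := s_ge; lra. Qed.

Lemma gate_x_ge0 i : 0 <= X i. Proof. by apply: mulr_ge0 s_ge0; exact: ler0n. Qed.
Lemma gate_xS i : X i.+1 = X i + s. Proof. by rewrite /X -natr1 mulrDl mul1r. Qed.
Lemma gate_x0 : X 0 = 0. Proof. by rewrite /X mul0r. Qed.
Lemma gate_x_le i j : (i <= j)%N -> X i <= X j.
Proof. by move=> ij; rewrite ler_wpM2r ?ler_nat. Qed.
Lemma gate_x_lt i j : (i < j)%N -> X i + s <= X j.
Proof. by move=> /gate_x_le; rewrite gate_xS. Qed.

Definition gate_foot_l i := pt (X i - 1) 0.
Definition gate_top_l i := pt (X i - 9 / 8) (1 / 8).
Definition gate_top_r i := pt (X i + 9 / 8) (1 / 8).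
Definition gate_foot_r i := pt (X i + 1) 0.

(** [r] counts the gates still to come and [i] numbers the first of them; the lemmas keep
    [i + r = m.+1]. *)
Fixpoint gates (r i : nat) : seq point :=
  if r is r'.+1 then
    [:: gate_foot_l i, gate_top_l i, gate_top_r i, gate_foot_r i & gates r' i.+1]
  else [:: pt XR 0].

(** Starts at the lowest vertex, where [x + v = -20] meets [x - v = XR], goes up the left side,
    around the ledge at [v = -5], and along [v = 0] through the gates. The side from [pt XR 0] back
    to the lowest vertex is the closing one. *)
Definition outline : seq point :=
  [:: pt (X m / 2) (- (XR + 20) / 2), pt (- 15) (- 5), pt (- 5) (- 5), pt (- 10) 0
    & gates m.+1 0].

Lemma gatesS r i : gates r.+1 i =
  [:: gate_foot_l i, gate_top_l i, gate_top_r i, gate_foot_r i & gates r i.+1].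
Proof. by []. Qed.

Lemma arc_cons (x y : point) l : arc [:: x, y & l] = line_segment x y `|` arc (y :: l).
Proof. by []. Qed.

Lemma simple_arc_cons (x y : point) l : x <> y ->
  (forall z, line_segment x y z -> arc (y :: l) z -> z = y) ->
  (if l is w :: _ then ~ line_segment x w y else True) ->
  simple_arc (y :: l) -> simple_arc [:: x, y & l].
Proof. by []. Qed.

(** The invariant that keeps the remaining gates away from the sides already drawn. It bounds
    [x + v] rather than [x], because the left wall of a gate leans to the left and [x + v] is
    constant on it. *)
Lemma gates_head r i : (i + r)%N = m.+1 -> exists xN rest,
  [/\ gates r i = pt xN 0 :: rest, X i - 1 <= xN,
      (if rest is w :: _ then 0 < ht w else True)
    & forall z, arc (gates r i) z -> 0 <= ht z /\ xN <= z.1 + ht z].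
Proof.
elim: r i => [|r IH] i ir.
  exists XR, [::]; split => // [|z ->].
      have -> : i = m.+1 by rewrite -ir addn0.
    by rewrite gate_xS /XR; have := s_le; lra.
  by rewrite ht_pt /=; lra.
have ir' : (i.+1 + r)%N = m.+1 by rewrite addSnnS.
have [xN [rest [e xNi _ arcN]]] := IH i.+1 ir'.
exists (X i - 1), [:: gate_top_l i, gate_top_r i, gate_foot_r i & gates r i.+1].
have XSi := gate_xS i; have s1 := s_ge; split => // [|z].
  by rewrite ht_pt; lra.
rewrite gatesS e !arc_cons -e => -[|[|[|[|/arcN]]]].
- by move=> /(@segS (-1)) [||]; lra.
- by move=> /segH [|]; lra.
- by move=> /segC /(@segS 1) [||]; lra.
- by move=> /segH [|]; lra.
- by lra.
Qed.

Lemma gates_simple r i : (i + r)%N = m.+1 -> simple_arc (gates r i).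
Proof.
elim: r i => [//|r IH] i ir.
have ir' : (i.+1 + r)%N = m.+1 by rewrite addSnnS.
have [xN [rest [e xNi restw arcN]]] := gates_head ir'.
have {}IH := IH _ ir'; have XSi := gate_xS i; have s1 := s_ge.
rewrite gatesS e; apply: simple_arc_cons; last apply: simple_arc_cons;
  last apply: simple_arc_cons; last apply: simple_arc_cons; rewrite ?arc_cons -?e //.
- by move=> /(congr1 ht); rewrite !ht_pt; lra.
- move=> z /(@segS (-1)) [||h1 h2]; [lra|lra|].
  case=> [/segH [|]|[/segC /(@segS 1) [||]|[/segH [|]|/arcN]]] *; seglra.
- by move=> /segC; apply: not_straight; rewrite /= ?ht_pt; lra.
- by move=> /(congr1 fst) /=; lra.
- move=> z /segH [|h1 h2]; first lra.
  case=> [/segC /(@segS 1) [||]|[/segH [|]|/arcN]] *; seglra.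
- by apply: not_straight; rewrite /= ?ht_pt; lra.
- by move=> /(congr1 ht); rewrite !ht_pt; lra.
- move=> z /segC /(@segS 1) [||h1 h2]; [lra|lra|].
  case=> [/segH [|]|/arcN] *; seglra.
- by move=> /segC; apply: not_straight; rewrite /= ?ht_pt; lra.
- by move=> /(congr1 fst) /=; lra.
- move=> z /segH [|h1 h2]; first lra.
  move=> /arcN *; seglra.
- case: rest restw {e} => // w _ hw.
  by apply: not_straight; rewrite /= ?ht_pt; lra.
Qed.

Lemma size_gates r i : size (gates r i) = (4 * r).+1.
Proof. by elim: r i => // r IH i; rewrite gatesS /= IH; lia. Qed.

Lemma gates_last r i : nth 0 (gates r i) (4 * r) = pt XR 0.
Proof.
elim: r i => // r IH i; have -> : (4 * r.+1 = (4 * r).+4)%N by lia.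
by rewrite gatesS /= IH.
Qed.

Lemma gates_last2 r i : nth 0 (gates r.+1 i) (4 * r + 3) = gate_foot_r (i + r).
Proof.
elim: r i => [|r IH] i; first by rewrite addn0.
have -> : (4 * r.+1 + 3 = (4 * r + 3).+4)%N by lia.
by rewrite gatesS [LHS]/= IH addSnnS.
Qed.

Definition depth := (XR + 20) / 2.

Lemma size_outline : size outline = (4 * m + 9)%N.
Proof. by rewrite /= size_gates; lia. Qed.

Lemma right_x_ge20 : 20 <= XR.
Proof. by have := gate_x_ge0 m; rewrite /XR; lra. Qed.

Definition outline_vertex (i : 'I_(size outline)) : point := nth 0 outline i.

Lemma outlineE : outline =
  [:: pt (X m / 2) (- depth), pt (- 15) (- 5), pt (- 5) (- 5), pt (- 10) 0
    & gates m.+1 0].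
Proof. by rewrite /outline /depth mulNr. Qed.

Lemma outline_last : nth 0 outline (size outline).-1 = pt XR 0.
Proof.
rewrite size_outline; have -> : (4 * m + 9).-1 = (4 * m.+1).+4 by lia.
by rewrite outlineE -[LHS]/(nth 0 (gates m.+1 0) (4 * m.+1)) gates_last.
Qed.

Lemma outline_last2 : nth 0 outline (size outline).-2 = gate_foot_r m.
Proof.
rewrite size_outline; have -> : (4 * m + 9).-2 = (4 * m + 3).+4 by lia.
by rewrite outlineE -[LHS]/(nth 0 (gates m.+1 0) (4 * m + 3)) gates_last2.
Qed.

Lemma outline_arcE : arc outline =
  line_segment (pt (X m / 2) (- depth)) (pt (- 15) (- 5)) `|`
  (line_segment (pt (- 15) (- 5)) (pt (- 5) (- 5)) `|`
  (line_segment (pt (- 5) (- 5)) (pt (- 10) 0) `|`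
  (line_segment (pt (- 10) 0) (pt (- 1) 0) `|` arc (gates m.+1 0)))).
Proof.
by rewrite outlineE gatesS !arc_cons /gate_foot_l gate_x0 add0r.
Qed.

Lemma gates_arc_ge z : arc (gates m.+1 0) z -> 0 <= ht z /\ -1 <= z.1 + ht z.
Proof.
have [xN [rest [e x0 _ h]]] := @gates_head m.+1 0 (add0n _).
by move=> /h; rewrite gate_x0 in x0; lra.
Qed.

Lemma outline_simple : simple_arc outline.
Proof.
have s1 := s_ge; have x0 := right_x_ge20; have xE : XR = X m + 20 by [].
have sg := @gates_simple m.+1 0 (add0n _).
have ga := gates_arc_ge.
have e1 : gate_foot_l 0 = pt (-1) 0 by rewrite /gate_foot_l gate_x0 add0r.
have e2 : gates m.+1 0 = [:: pt (-1) 0, gate_top_l 0, gate_top_r 0, gate_foot_r 0 & gates m 1].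
  by rewrite gatesS e1.
rewrite outlineE /depth; move: sg ga; rewrite e2 => sg ga.
apply: simple_arc_cons; last apply: simple_arc_cons;
  last apply: simple_arc_cons; last apply: simple_arc_cons => //;
  rewrite ?(arc_cons (pt (- 15) _)) ?(arc_cons (pt (-5) _)) ?(arc_cons (pt (-10) _)).
- by move=> /(congr1 ht); rewrite !ht_pt; lra.
- move=> z /(@segS (-1)) [||h1 h2]; [lra|lra|].
  case=> [/segH [|]|[/(@segS (-1)) [||]|[/segH [|]|/ga]]] *; seglra.
- by move=> /segC; apply: not_straight; rewrite /= ?ht_pt; lra.
- by move=> /(congr1 fst) /=; lra.
- move=> z /segH [|h1 h2]; first lra.
  case=> [/(@segS (-1)) [||]|[/segH [|]|/ga]] *; seglra.
- by apply: not_straight; rewrite /= ?ht_pt; lra.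
- by move=> /(congr1 ht); rewrite !ht_pt; lra.
- move=> z /(@segS (-1)) [||h1 h2]; [lra|lra|].
  case=> [/segH [|]|/ga] *; seglra.
- by move=> /segC; apply: not_straight; rewrite /= ?ht_pt; lra.
- by move=> /(congr1 fst) /=; lra.
- move=> z /segH [|h1 h2]; first lra.
  move=> /ga *; seglra.
- by apply: not_straight; rewrite /= ?ht_pt ?gate_x0; lra.
Qed.

End Outline.

(** * The outline as a closed chain, and its sides as inequalities *)

Section Gates.
Variables (R : realType) (kap s : R) (m : nat).
Hypothesis kap_gt0 : 0 < kap.
Hypothesis s_ge : 5 / 2 <= s.
Hypothesis s_le : s <= 4.
Local Notation point := (R * R)%type.
Local Notation pt := (pt kap).
Local Notation ht := (ht kap).
Local Notation X := (gate_x s).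
Local Notation XR := (right_x s m).
Local Notation depth := (depth s m).
Local Notation outline := (outline kap s m).
Local Notation gates := (gates kap s m).
Let htpt x v : ht (pt x v) = v. Proof. exact: ht_pt. Qed.
Let XR_ge : 20 <= XR. Proof. exact: right_x_ge20. Qed.
Let XRE : XR = X m + 20. Proof. by []. Qed.
Let depthE : depth = (XR + 20) / 2. Proof. by []. Qed.

Ltac seglra := lazymatch goal with
  | |- _ = _ :> (_ * _)%type => apply: (pt_inj kap_gt0); lra
  | |- _ \/ _ => first [left; apply: (pt_inj kap_gt0); lra | right; apply: (pt_inj kap_gt0); lra]
  | |- _ => lra
  end.

Lemma outline0 : nth 0 outline 0 = pt (X m / 2) (- depth).
Proof. by rewrite outlineE. Qed.

Lemma outline_closed : simple_closed_chain (@outline_vertex R kap s m).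
Proof.
have s1 := s_ge; have x0 := XR_ge; have xE := XRE; have dE := depthE.
have ga z := @gates_arc_ge R kap s m kap_gt0 s_ge s_le z.
apply: simple_closed_arc.
- by rewrite size_outline; lia.
- exact: outline_simple.
- move=> z; rewrite outline_last // outline0 outline_arcE.
  move=> /segC /(@segS _ _ kap_gt0 1) [||h1 h2]; [lra|lra|].
  case=> [/(@segS _ _ kap_gt0 (-1)) [||]|[/(segH kap_gt0) [|]|[/(@segS _ _ kap_gt0 (-1)) [||]|[/(segH kap_gt0) [|]|/ga]]]] *; seglra.
- rewrite outline_last // outline_last2 // outline0.
  by apply: (not_straight kap_gt0); rewrite /= ?htpt; lra.
(* No two of these three vertices have equal height, so [not_straight] does not apply; instead the
   middle one is lower than both neighbours. *)
- rewrite outline_last // outline0 outlineE /=.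
  move=> /line_segmentP [t [t0 t1 _]].
  move=> /(congr1 (fun y => kap * y)) /=.
  have -> : kap * ((1 - t) * (0 / kap) + t * (-5 / kap)) = (1 - t) * 0 + t * (-5).
    by field; rewrite gt_eqF.
  have -> : kap * (- depth / kap) = - depth by field; rewrite gt_eqF.
  lra.
Qed.

(** The left wall, the ceiling, the right wall, and the floor up to the next gate or, after the last
    gate, up to [pt XR 0]. *)
Definition gate_part i (z : point) : Prop :=
  [\/ 0 <= ht z <= 1 / 8 /\ z.1 + ht z = X i - 1,
      [/\ ht z = 1 / 8, X i - 1 <= z.1 + ht z & z.1 - ht z <= X i + 1],
      0 <= ht z <= 1 / 8 /\ z.1 - ht z = X i + 1
    | ht z = 0 /\ X i + 1 <= z.1 <= (if (i < m)%N then X i.+1 - 1 else XR)].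

Lemma gates_arcP r i z : (i + r)%N = m.+1 -> (0 < r)%N ->
  arc (gates r i) z <-> exists i', (i <= i' <= m)%N /\ gate_part i' z.
Proof.
have s1 := s_ge; have x0 := XR_ge; have xE := XRE.
have step N xN i0 l : N = pt xN 0 -> xN = (if (i0 < m)%N then X i0.+1 - 1 else XR) ->
    (i0 <= m)%N ->
    arc [:: gate_foot_l kap s i0, gate_top_l kap s i0, gate_top_r kap s i0, gate_foot_r kap s i0, N & l] z
    <-> gate_part i0 z \/ arc (N :: l) z.
  move=> -> -> im; rewrite !arc_cons; set A := arc _.
  have XSi : X i0.+1 = X i0 + s := gate_xS s i0.
  have XiR : X i0 + 20 <= XR by rewrite xE lerD2r gate_x_le.
  have iff1 : line_segment (gate_foot_l kap s i0) (gate_top_l kap s i0) z <->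
      0 <= ht z <= 1 / 8 /\ z.1 + ht z = X i0 - 1.
    split; first by move=> /(@segS _ _ kap_gt0 (-1)) [||]; lra.
    by move=> h; apply/(@segS _ _ kap_gt0 (-1)); lra.
  have iff2 : line_segment (gate_top_l kap s i0) (gate_top_r kap s i0) z <->
      [/\ ht z = 1 / 8, X i0 - 1 <= z.1 + ht z & z.1 - ht z <= X i0 + 1].
    split; first by move=> /(segH kap_gt0) [|h1 h2]; [lra|split; lra].
    by move=> [h1 h2 h3]; apply/(segH kap_gt0); lra.
  have iff3 : line_segment (gate_top_r kap s i0) (gate_foot_r kap s i0) z <->
      0 <= ht z <= 1 / 8 /\ z.1 - ht z = X i0 + 1.
    split; first by move=> /segC /(@segS _ _ kap_gt0 1) [||]; lra.
    by move=> h; apply/segC; apply/(@segS _ _ kap_gt0 1); lra.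
  have iff4 : line_segment (gate_foot_r kap s i0) (pt (if (i0 < m)%N then X i0.+1 - 1 else XR) 0) z <->
      ht z = 0 /\ X i0 + 1 <= z.1 <= (if (i0 < m)%N then X i0.+1 - 1 else XR).
    apply: segH => //; case: ifP; lra.
  rewrite /setU /= iff1 iff2 iff3 iff4 /gate_part; split.
    by case=> [|[|[|[|]]]] h; [left; constructor 1|left; constructor 2|left; constructor 3|left; constructor 4|right].
  by case=> [[]|] h; [left|right; left|right; right; left|right; right; right; left|do 4!right].
elim: r i => // r IH i ir _; have [r0|r0] := posnP r.
  have im : i = m by lia.
  have i1 : XR = (if (i < m)%N then X i.+1 - 1 else XR) by rewrite im ltnn.
  have i2 : (i <= m)%N by rewrite im.
  have XmR : X m + 20 = XR by [].
  rewrite r0 gatesS (step _ _ _ _ erefl i1 i2) im; split.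
    case=> [h|zR]; first by exists m; rewrite leqnn.
    exists m; rewrite leqnn; split => //; constructor 4.
    by rewrite zR htpt ltnn /=; lra.
  move=> [i' [i'm h]]; left.
  by have -> : m = i' by lia.
have ir' : (i.+1 + r)%N = m.+1 by rewrite addSnnS.
have [r' rE] : exists r', r = r'.+1 by exists r.-1; rewrite prednK.
have im : (i < m)%N by lia.
have i1 : X i.+1 - 1 = (if (i < m)%N then X i.+1 - 1 else XR) by rewrite im.
rewrite gatesS {1}rE (gatesS _ _ _ r') (step _ _ _ _ erefl i1 (ltnW im)).
rewrite -(gatesS _ _ _ r') -rE IH //; split.
  case=> [h|[i' [i'm h]]]; first by exists i; rewrite leqnn ltnW.
  by exists i'; split => //; lia.
move=> [i' [i'm h]]; have [e|ne] := eqVneq i' i; first by left; rewrite -e.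
by right; exists i'; split => //; lia.
Qed.

End Gates.

(** * The tower as the region of its outline *)

Section Tower.
Variables (R : realType) (kap s : R) (m : nat).
Hypothesis kap_gt0 : 0 < kap.
Hypothesis s_ge : 5 / 2 <= s.
Hypothesis s_le : s <= 4.
Local Notation point := (R * R)%type.
Local Notation pt := (pt kap).
Local Notation ht := (ht kap).
Local Notation X := (gate_x s).
Local Notation XR := (right_x s m).
Local Notation depth := (depth s m).
Local Notation outline := (outline kap s m).
Local Notation gates := (gates kap s m).
Let htpt x v : ht (pt x v) = v. Proof. exact: ht_pt. Qed.
Let XR_ge : 20 <= XR. Proof. exact: right_x_ge20. Qed.
Let XRE : XR = X m + 20. Proof. by []. Qed.
Let depthE : depth = (XR + 20) / 2. Proof. by []. Qed.
Let Xge0 i : 0 <= X i. Proof. exact: gate_x_ge0. Qed.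

Definition envelope : set point :=
  [set z | [/\ ht z <= 1 / 8, z.1 - ht z <= XR & -20 <= z.1 + ht z]].

(** [None] carves out the ledge above the bottom scale, the next two bound the first and the last
    gate from outside, and the others separate consecutive gates. All of them stick out of
    [envelope]. *)
Definition notch (w : option (option (option 'I_m))) : set point :=
  match w with
  | None => [set z | -5 < ht z /\ z.1 + ht z < -10]
  | Some None => [set z | 0 < ht z /\ z.1 + ht z < -1]
  | Some (Some None) => [set z | 0 < ht z /\ X m + 1 < z.1 - ht z]
  | Some (Some (Some i)) =>
      [set z | [/\ 0 < ht z, X i + 1 < z.1 - ht z & z.1 + ht z < X i.+1 - 1]]
  end.

Definition tower : set point := [set z | envelope z /\ forall w, ~ notch w z].

(** The complement of the tower with weak inequalities: a closed set that meets the tower exactly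
    along the outline, as [region_of_separation] requires. *)
Definition exterior : set point :=
  [set z | [\/ 1 / 8 <= ht z, XR <= z.1 - ht z, z.1 + ht z <= -20 |
    [\/ -5 <= ht z /\ z.1 + ht z <= -10, 0 <= ht z /\ z.1 + ht z <= -1,
        0 <= ht z /\ X m + 1 <= z.1 - ht z |
        exists i : 'I_m, [/\ 0 <= ht z, X i + 1 <= z.1 - ht z & z.1 + ht z <= X i.+1 - 1]]]].

Lemma towerP z : tower z <-> [/\ envelope z, ht z <= -5 \/ -10 <= z.1 + ht z,
   ht z <= 0 \/ -1 <= z.1 + ht z, ht z <= 0 \/ z.1 - ht z <= X m + 1 &
   forall i, (i < m)%N -> [\/ ht z <= 0, z.1 - ht z <= X i + 1 | X i.+1 - 1 <= z.1 + ht z]].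
Proof.
split.
  move=> [ez nz]; split => //.
  - have [h|h] := leP (ht z) (-5); [by left|right; rewrite leNgt; apply/negP => h2].
    by apply: (nz None).
  - have [h|h] := leP (ht z) 0; [by left|right; rewrite leNgt; apply/negP => h2].
    by apply: (nz (Some None)).
  - have [h|h] := leP (ht z) 0; [by left|right; rewrite leNgt; apply/negP => h2].
    by apply: (nz (Some (Some None))).
  - move=> i im; have [h|h] := leP (ht z) 0; first by constructor 1.
    have [h2|h2] := leP (z.1 - ht z) (X i + 1); first by constructor 2.
    constructor 3; rewrite leNgt; apply/negP => h3.
    by apply: (nz (Some (Some (Some (Ordinal im))))).
move=> [ez h1 h2 h3 h4]; split => // -[[[i|]|]|] /=.
- by have := h4 i (ltn_ord i) => -[] h [] /=; lra.
- by case: h3; lra.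
- by case: h2; lra.
- by case: h1; lra.
Qed.

(** Walking from gate 0 to the right, the first separating notch that has the point on its left
    identifies the gate. *)
Lemma gate_exists z : 0 < ht z -> -1 <= z.1 + ht z -> z.1 - ht z <= X m + 1 ->
  (forall i, (i < m)%N -> [\/ ht z <= 0, z.1 - ht z <= X i + 1 | X i.+1 - 1 <= z.1 + ht z]) ->
  exists i, [/\ (i <= m)%N, X i - 1 <= z.1 + ht z & z.1 - ht z <= X i + 1].
Proof.
move=> hz z0 zm zi.
have main n i : (i + n)%N = m -> X i - 1 <= z.1 + ht z ->
    exists i, [/\ (i <= m)%N, X i - 1 <= z.1 + ht z & z.1 - ht z <= X i + 1].
  elim: n i => [|n IH] i inm h.
    by exists i; rewrite -inm addn0 leqnn; split => //; rewrite -(addn0 i) inm.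
  have im : (i < m)%N by lia.
  case: (zi i im) => h2; first by exfalso; lra.
    by exists i; split => //; exact: ltnW.
  by apply: (IH i.+1) => //; rewrite addSnnS.
by apply: (main m 0%N); rewrite ?add0n ?gate_x0 //; lra.
Qed.

Lemma tower_boundary : tower `&` exterior = polygon_boundary (@outline_vertex R kap s m).
Proof.
have s1 := s_ge; have x0 := XR_ge; have xE := XRE; have dE := depthE; have s2 := s_le.
rewrite boundary_closed_arc; last by rewrite size_outline; lia.
rewrite outline_last // outline0 outline_arcE.
have XS' i : X i.+1 = X i + s := gate_xS s i.
have Xm0 := Xge0 m.
apply/seteqP; split => z.
  move=> [/towerP [[e1 e2 e3] l1 l2 l3 l4] ext].
  have [hz|hz|hz] := ltgtP (ht z) 0.
  - have [h|h] := ltP (z.1 - ht z) XR; last first.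
      right; apply/segC/(@segS _ _ kap_gt0 1); lra.
    left; have [h2|h2] := ltP (-20) (z.1 + ht z); last first.
      left; apply/(@segS _ _ kap_gt0 (-1)); lra.
    have [h3 h4] : -5 <= ht z /\ z.1 + ht z <= -10.
      by case: ext => [||| [||| [i []]]]; lra.
    right; case: l1 => l1.
      by left; apply/(segH kap_gt0); lra.
    by right; left; apply/(@segS _ _ kap_gt0 (-1)); lra.
  - left; do 4!right.
    have [|||i [im g1 g2]] := @gate_exists z hz.
    + by lra.
    + by lra.
    + by [].
    apply/gates_arcP => //; exists i; split => //.
    have Xi := gate_x_le s_ge im; have Xi0 := Xge0 i.
    case: ext => [h|h|h|].
    + by constructor 2; split; lra.
    + by exfalso; lra.
    + by exfalso; lra.
    case=> [h|h|h|[i' [h1 h2 h3]]].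
    + by exfalso; lra.
    + by constructor 1; lra.
    + by constructor 3; lra.
    + have [ii|ii|ii] := ltngtP i i'.
      * by have := gate_x_lt s_ge ii; have := XS' i'; constructor 3; lra.
      * have := gate_x_lt s_ge ii; have := XS' i'; constructor 1; lra.
      * by constructor 3; rewrite ii in g2 *; lra.
  - left; do 3!right.
    have m0 : (0 <= m <= m)%N by rewrite leqnn.
    have floor_m : X m + 1 <= z.1 -> arc (gates m.+1 0) z.
      move=> h; apply/gates_arcP => //; exists m; split => //.
      by constructor 4; rewrite ltnn; lra.
    have gap : z.1 <= -1 -> line_segment (pt (-10) 0) (pt (-1) 0) z.
      by move=> h; apply/(segH kap_gt0); lra.
    case: ext => [h|h|h|].
    + by exfalso; lra.
    + by right; apply: floor_m; lra.
    + by exfalso; lra.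
    case=> [h|h|h|[i' [h1 h2 h3]]].
    + by left; apply: gap => //; lra.
    + by left; apply: gap => //; lra.
    + by right; apply: floor_m; lra.
    + right; apply/gates_arcP => //; exists i'; split; first by rewrite leq0n ltnW.
      by constructor 4; rewrite ltn_ord; lra.
have low : ht z <= 0 -> z.1 - ht z <= XR -> -20 <= z.1 + ht z ->
    (ht z <= -5 \/ -10 <= z.1 + ht z) -> tower z.
  move=> h1 h2 h3 h4; apply/towerP; split => //; try by left.
    by split; lra.
  by move=> i _; constructor 1.
have high i : (i <= m)%N -> 0 <= ht z <= 1 / 8 -> X i - 1 <= z.1 + ht z ->
    z.1 - ht z <= X i + 1 -> tower z.
  move=> im h1 h2 h3; have Xi := gate_x_le s_ge im; have Xi0 := Xge0 i.
  apply/towerP; split.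
  - by split; lra.
  - by right; lra.
  - by right; lra.
  - by right; lra.
  - move=> i' im'; have [ii|ii] := ltnP i' i.
      by have := gate_x_lt s_ge ii; have := XS' i'; constructor 3; lra.
    by have := gate_x_le s_ge ii; constructor 2; lra.
move=> [|/segC /(@segS _ _ kap_gt0 1) [||h1 h2]]; last 3 first.
- by lra.
- by lra.
- split; last by constructor 2; lra.
  apply: low; [lra|lra|lra|].
  by have [h|h] := leP (ht z) (-5); [left|right; lra].
case=> [/(@segS _ _ kap_gt0 (-1)) [||h1 h2]|]; [lra|lra| |].
  by split; [apply: low; [lra|lra|lra|left; lra]|constructor 3; lra].
case=> [/(segH kap_gt0) [|h1 h2]|]; [lra| |].
  split; first by apply: low; [lra|lra|lra|left; lra].
  by constructor 4; constructor 1; lra.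
case=> [/(@segS _ _ kap_gt0 (-1)) [||h1 h2]|]; [lra|lra| |].
  split; first by apply: low; [lra|lra|lra|right; lra].
  by constructor 4; constructor 1; lra.
case=> [/(segH kap_gt0) [|h1 h2]|]; [lra| |].
  split; first by apply: low; [lra|lra|lra|right; lra].
  by constructor 4; constructor 2; lra.
move=> /gates_arcP [] // i [/= im gp].
have Xi := gate_x_le s_ge im; have Xi0 := Xge0 i.
have XiS : forall i', (i'.+1 = i)%N -> X i = X i' + s by move=> i' <-.
case: gp => [[h1 h2]|[h1 h2 h3]|[h1 h2]|[h1 h2]].
- split; first by apply: (high i im); lra.
  constructor 4; have [i0|i0] := posnP i.
    by move: h2; rewrite i0 gate_x0; constructor 2; lra.
  have im' : (i.-1 < m)%N by rewrite prednK.
  constructor 4; exists (Ordinal im') => /=; have := XiS i.-1; rewrite prednK // => /(_ erefl).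
  by split; lra.
- by split; [apply: (high i im); lra|constructor 1; lra].
- split; first by apply: (high i im); lra.
  constructor 4; have [im1|im1] := ltnP i m.
    by constructor 4; exists (Ordinal im1) => /=; have := XS' i; split; lra.
  have -> : m = i by apply/eqP; rewrite eqn_leq im im1.
  by constructor 3; lra.
- case: ifP h2 => im1 h2.
    have := gate_x_lt s_ge im1; have := XS' i.
    split; first by apply: low; [lra|lra|lra|right; lra].
    by constructor 4; constructor 4; exists (Ordinal im1) => /=; split; lra.
  have mi : m = i by apply/eqP; rewrite eqn_leq im leqNgt im1.
  split; first by apply: low; [lra|lra|lra|right; lra].
  by constructor 4; constructor 3; rewrite mi; lra.
Qed.

Lemma tower_exterior_cover : tower `|` exterior = setT.
Proof.
apply/seteqP; split => // z _.
have [ext|next] := pselect (exterior z); [by right|left].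
have [h1|h1] := leP (1 / 8) (ht z); first by case: next; constructor 1.
have [h2|h2] := leP XR (z.1 - ht z); first by case: next; constructor 2.
have [h3|h3] := leP (z.1 + ht z) (-20); first by case: next; constructor 3.
split; first by split; exact: ltW.
move=> [[[i|]|]|] /= h; apply: next; constructor 4.
- by case: h => h4 h5 h6; constructor 4; exists i; split; lra.
- by constructor 3; lra.
- by constructor 2; lra.
- by constructor 1; lra.
Qed.

Let htdot (z : point) : ht z = dot (0, kap) z.
Proof. by rewrite /dot /= mul0r add0r. Qed.
Let subdot (z : point) : z.1 - ht z = dot (1, - kap) z.
Proof. by rewrite /dot /= mul1r mulNr. Qed.
Let adddot (z : point) : z.1 + ht z = dot (1, kap) z.
Proof. by rewrite /dot /= mul1r. Qed.

Lemma closed_dot_ge (a : point) c : closed [set x : point | c <= dot a x].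
Proof.
have -> : [set x : point | c <= dot a x] = [set x | dot (- a) x <= - c].
  by apply/seteqP; split => x /=; rewrite dotN lerN2.
exact: closed_dot_le.
Qed.

Lemma open_dot_lt (a : point) c : open [set x : point | dot a x < c].
Proof.
have -> : [set x : point | dot a x < c] = [set x | - c < dot (- a) x].
  by apply/seteqP; split => x /=; rewrite dotN ltrN2.
exact: open_dot_gt.
Qed.

Lemma open_notch w : open (notch w).
Proof.
case: w => [[[i|]|]|] /=.
- rewrite [X in open X](_ : _ = [set z | 0 < dot (0, kap) z] `&`
    [set z | X i + 1 < dot (1, - kap) z] `&` [set z | dot (1, kap) z < X i.+1 - 1]).
    by do 2?apply: openI; [exact: open_dot_gt|exact: open_dot_gt|exact: open_dot_lt].
  by apply/seteqP; split => z /=; rewrite -htdot -subdot -adddot; [case=> h1 h2 h3|case=> [[h1 h2] h3]].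
- rewrite [X in open X](_ : _ = [set z | 0 < dot (0, kap) z] `&`
    [set z | X m + 1 < dot (1, - kap) z]).
    by apply: openI; exact: open_dot_gt.
  by apply/seteqP; split => z /=; rewrite -htdot -subdot.
- rewrite [X in open X](_ : _ = [set z | 0 < dot (0, kap) z] `&`
    [set z | dot (1, kap) z < -1]).
    by apply: openI; [exact: open_dot_gt|exact: open_dot_lt].
  by apply/seteqP; split => z /=; rewrite -htdot -adddot.
- rewrite [X in open X](_ : _ = [set z | -5 < dot (0, kap) z] `&`
    [set z | dot (1, kap) z < -10]).
    by apply: openI; [exact: open_dot_gt|exact: open_dot_lt].
  by apply/seteqP; split => z /=; rewrite -htdot -adddot.
Qed.

Lemma closed_tower : closed tower.
Proof.
have -> : tower = ([set z | dot (0, kap) z <= 1 / 8] `&` [set z | dot (1, - kap) z <= XR] `&`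
    [set z | -20 <= dot (1, kap) z]) `&` \bigcap_(w in setT) ~` notch w.
  apply/seteqP; split => z /=; rewrite -htdot -subdot -adddot.
    by move=> [[h1 h2 h3] h4]; split => // w _; exact: h4.
  by move=> [[[h1 h2] h3] h4]; split => // w; exact: h4 w I.
apply: closedI; last by apply: closed_bigI => w _; rewrite closedC; exact: open_notch.
by apply: closedI; [apply: closedI; exact: closed_dot_le|exact: closed_dot_ge].
Qed.

Lemma closed_exterior : closed exterior.
Proof.
have -> : exterior = ([set z | 1 / 8 <= dot (0, kap) z] `|` [set z | XR <= dot (1, - kap) z] `|`
    [set z | dot (1, kap) z <= -20]) `|`
   (([set z | -5 <= dot (0, kap) z] `&` [set z | dot (1, kap) z <= -10]) `|`
    ([set z | 0 <= dot (0, kap) z] `&` [set z | dot (1, kap) z <= -1]) `|`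
    ([set z | 0 <= dot (0, kap) z] `&` [set z | X m + 1 <= dot (1, - kap) z])) `|`
   \bigcup_(i in [set: 'I_m]) ([set z | 0 <= dot (0, kap) z] `&`
      [set z | X i + 1 <= dot (1, - kap) z] `&` [set z | dot (1, kap) z <= X i.+1 - 1]).
  apply/seteqP; split => z /=; rewrite -htdot -subdot -adddot.
    case=> [h|h|h|[h|h|h|[i [h1 h2 h3]]]].
    - by left; left; left; left.
    - by left; left; left; right.
    - by left; left; right.
    - by left; right; left; left.
    - by left; right; left; right.
    - by left; right; right.
    - by right; exists i => //; rewrite /= -htdot -subdot -adddot.
  case=> [[[[h|h]|h]|[[h|h]|h]]|[i _ /=]].
  - by constructor 1.
  - by constructor 2.
  - by constructor 3.
  - by constructor 4; constructor 1.
  - by constructor 4; constructor 2.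
  - by constructor 4; constructor 3.
  - rewrite -htdot -subdot -adddot => -[[h1 h2] h3].
    by constructor 4; constructor 4; exists i.
apply: closedU; last first.
  apply: closed_bigcup; first exact: finite_finset.
  move=> i _; apply: closedI; last exact: closed_dot_le.
  by apply: closedI; exact: closed_dot_ge.
apply: closedU.
  apply: closedU; last exact: closed_dot_le.
  by apply: closedU; exact: closed_dot_ge.
apply: closedU; last by apply: closedI; exact: closed_dot_ge.
by apply: closedU; apply: closedI; (exact: closed_dot_ge || exact: closed_dot_le).
Qed.

Lemma bounded_tower : bounded_set tower.
Proof.
have x0 := XR_ge; apply/bounded_setP; exists (XR + 21 + (XR + 21) / kap) => z [[h1 h2 h3] _].
have k0 : 0 <= (XR + 21) / kap by apply: divr_ge0; [lra|exact: ltW].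
have hb : `|ht z| <= XR + 21 by rewrite ler_norml; lra.
have z2 : `|z.2| <= (XR + 21) / kap.
  by rewrite ler_pdivlMr // mulrC -[X in X * _](gtr0_norm kap_gt0) -normrM.
split; last by lra.
by move: hb; rewrite !ler_norml; lra.
Qed.

Lemma tower_escape z : ~ tower z ->
  exists2 d : point, d != 0 & forall t, 0 <= t -> ~ tower (z + t *: d).
Proof.
have s1 := s_ge.
have htD (d : point) t : ht (z + t *: d) = ht z + t * ht d.
  by rewrite /ht /= /GRing.scale /=; ring.
have fstD (d : point) t : (z + t *: d).1 = z.1 + t * d.1 by [].
have ht0 (a : R) : ht (a, 0) = 0 by rewrite /ht mulr0.
have nz1 (a b : R) : a != 0 -> (a, b) != 0 :> point.
  by apply: contra_neq => -[].
have up : 1 / 8 < ht z ->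
    exists2 d : point, d != 0 & forall t, 0 <= t -> ~ tower (z + t *: d).
  move=> h; exists (0, 1).
    by apply/eqP => -[/eqP]; rewrite oner_eq0.
  move=> t t0 [[]]; rewrite htD leNgt => /negP; case.
  by apply: lt_le_trans h _; rewrite lerDl mulr_ge0 // /ht /= mulr1 ltW.
move=> nT; have [h1|h1] := ltP (1 / 8) (ht z); first exact: up.
have [h2|h2] := ltP XR (z.1 - ht z).
  exists (1, 0); first by rewrite nz1 ?oner_eq0.
  move=> t t0 [[_ + _] _]; rewrite htD fstD ht0 /=; lra.
have [h3|h3] := ltP (z.1 + ht z) (-20).
  exists (-1, 0); first by rewrite nz1 ?oppr_eq0 ?oner_eq0.
  move=> t t0 [[_ _ +] _]; rewrite htD fstD ht0 /=; lra.
have [w nw] : exists w, notch w z.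
  apply: contrapT => h; apply: nT; split; first by split.
  by move=> w nw; apply: h; exists w.
case: w nw => [[[i|]|]|] /=.
- move=> [g1 g2 g3]; have XSi : X i.+1 = X i + s := gate_xS s i.
  (* The ray aims at height [1/4] midway between the gates. This target is in the closed triangle
     because [s >= 5/2], and it is above the ceiling [1/8]: before it the ray stays in the notch,
     and from it on the ray is above the tower. *)
  pose d : point := (X i + s / 2 - z.1, (1 / 4 - ht z) / kap).
  have hd : ht d = 1 / 4 - ht z by rewrite /ht /= mulrC divfK ?gt_eqF.
  exists d.
    by apply/eqP => d0; move: hd; rewrite d0 (ht0 0); lra.
  move=> t t0 [[]]; rewrite htD hd => u1 _ _ /(_ (Some (Some (Some i)))) /=.
  have t1 : t < 1 by rewrite ltNge; apply/negP => t1; nra.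
  have e1 : 0 < (1 - t) * ht z by apply: mulr_gt0; lra.
  have e2 : 0 < (1 - t) * (z.1 - ht z - (X i + 1)) by apply: mulr_gt0; lra.
  have e3 : 0 < (1 - t) * ((X i + s - 1) - (z.1 + ht z)) by apply: mulr_gt0; lra.
  have e4 : 0 <= t * (s - 5 / 2) by apply: mulr_ge0; lra.
  have -> : z.1 + (t *: d).1 = z.1 + t * (X i + s / 2 - z.1) by [].
  by apply; rewrite htD hd XSi; split; lra.
- move=> [g1 g2]; exists (1, 0); first by rewrite nz1 ?oner_eq0.
  move=> t t0 [_ /(_ (Some (Some None)))] /=; apply.
  rewrite htD ht0 /GRing.scale /=; split; lra.
- move=> [g1 g2]; exists (-1, 0); first by rewrite nz1 ?oppr_eq0 ?oner_eq0.
  move=> t t0 [_ /(_ (Some None))] /=; apply.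
  rewrite htD ht0 /GRing.scale /=; split; lra.
- move=> [g1 g2]; exists (-1, 0); first by rewrite nz1 ?oppr_eq0 ?oner_eq0.
  move=> t t0 [_ /(_ None)] /=; apply.
  rewrite htD ht0 /GRing.scale /=; split; lra.
Qed.

Lemma tower_region : tower = polygon_region (@outline_vertex R kap s m).
Proof.
apply/esym/region_of_separation.
- exact: closed_tower.
- exact: closed_exterior.
- exact: tower_exterior_cover.
- exact: tower_boundary.
- exact: bounded_tower.
- move=> z /tower_escape [d d0 dT]; exists d => // t t0.
  by rewrite -tower_boundary => -[/(dT t t0)].
Qed.

End Tower.

(** * The sides of the tower have allowed directions *)

Section TowerDirections.
Variables (R : realType) (k : nat) (s : R) (m : nat).
Hypothesis k_gt2 : (2 < k)%N.
Hypothesis s_ge : 5 / 2 <= s.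
Hypothesis s_le : s <= 4.
Local Notation point := (R * R)%type.
Local Notation normal := (normal R k).
Local Notation dir := (dir R k).
Local Notation angle := (angle R k).

Definition kappa : R := cos (angle 1) / sin (angle 1).
Local Notation kap := kappa.
Local Notation pt := (pt kap).
Local Notation ht := (ht kap).
Local Notation X := (gate_x s).
Local Notation XR := (right_x s m).
Local Notation tower := (tower kap s m).
Local Notation notch := (@notch R kap s m).
Let k_gt1 : (1 < k)%N. Proof. exact: ltnW. Qed.
Let k_gt0 : (0 < k)%N. Proof. exact: ltnW. Qed.

Lemma sin1_gt0 : 0 < sin (angle 1).
Proof. exact: sin_angle_gt0. Qed.

Lemma angle_lt_pihalf i : (i.*2 < k)%N -> angle i < pi / 2.
Proof.
move=> ik; rewrite /angle ltr_pdivrMr ?ltr0n //.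
have ik2 : 0 < k%:R - 2 * i%:R :> R by rewrite subr_gt0 -natrM ltr_nat mul2n.
have := mulr_gt0 (pi_gt0 R) ik2; lra.
Qed.

Lemma cos1_gt0 : 0 < cos (angle 1).
Proof.
apply: cos_gt0_pihalf; rewrite angle_lt_pihalf // andbT.
rewrite (@lt_le_trans _ _ 0) ?oppr_lt0 ?divr_gt0 ?pi_gt0 //.
by rewrite divr_ge0 ?mulr_ge0 ?pi_ge0.
Qed.

Lemma kappa_gt0 : 0 < kap.
Proof. by rewrite divr_gt0 ?sin1_gt0 ?cos1_gt0. Qed.

Lemma angleB1 : angle k.-1 = pi - angle 1.
Proof. by apply/eqP; rewrite eq_sym subr_eq -angleD addn1 prednK // angle_k. Qed.

Lemma dir_last : dir k.-1 = (- cos (angle 1), sin (angle 1)).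
Proof.
rewrite /dir angleB1 cosB sinB cospi sinpi; apply: injective_projections => /=; ring.
Qed.

Lemma dir0 : dir 0 = (1, 0).
Proof. by rewrite /dir /angle !mul0r cos0 sin0. Qed.

Definition allowed_side (a b : point) : Prop :=
  exists theta, allowed_direction k theta /\ has_direction a b theta.

Lemma allowed_side_dir (a b : point) r i : (i < k)%N -> r != 0 ->
  b - a = r *: dir i -> allowed_side a b.
Proof.
by move=> ik r0 e; exists (angle i); split; [exists i|exists r].
Qed.

Lemma allowed_side_sym (a b : point) : allowed_side a b -> allowed_side b a.
Proof.
move=> [th [ha [r [r0 e]]]]; exists th; split => //; exists (- r).
by rewrite oppr_eq0 r0 scaleNr -e opprB.
Qed.

Lemma flat_side x x' v : x < x' -> allowed_side (pt x v) (pt x' v).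
Proof.
move=> xx'; apply: (@allowed_side_dir _ _ (x' - x) 0) => //; first by rewrite gt_eqF ?subr_gt0.
by rewrite dir0; apply: injective_projections; rewrite /= /GRing.scale /=; ring.
Qed.

Lemma slant_side x v x' v' : v < v' -> x' = x + (v' - v) -> allowed_side (pt x v) (pt x' v').
Proof.
move=> vv' ->; have c0 := cos1_gt0; have s0 := sin1_gt0.
apply: (@allowed_side_dir _ _ ((v' - v) / cos (angle 1)) 1) => //.
  by rewrite gt_eqF // divr_gt0 // subr_gt0.
apply: injective_projections; rewrite /= /GRing.scale /= /kappa; field; rewrite ?gt_eqF //.
Qed.

Lemma slant_sideN x v x' v' : v < v' -> x' = x - (v' - v) -> allowed_side (pt x v) (pt x' v').
Proof.
move=> vv' ->; have c0 := cos1_gt0; have s0 := sin1_gt0.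
apply: (@allowed_side_dir _ _ ((v' - v) / cos (angle 1)) k.-1).
- by rewrite prednK.
- by rewrite gt_eqF // divr_gt0 // subr_gt0.
- rewrite dir_last.
  apply: injective_projections; rewrite /= /GRing.scale /= /kappa; field; rewrite ?gt_eqF //.
Qed.

Fixpoint allowed_sides (l : seq point) : Prop :=
  if l is x :: l' then
    if l' is y :: _ then allowed_side x y /\ allowed_sides l' else True
  else True.

Lemma allowed_sides_nth l i : allowed_sides l -> (i.+1 < size l)%N ->
  allowed_side (nth 0 l i) (nth 0 l i.+1).
Proof.
by elim: l i => // x [|y l] IH [|i] // [h1 h2] il //; exact: IH.
Qed.

Lemma allowed_gates r i : (i + r)%N = m.+1 -> allowed_sides (gates kap s m r i).
Proof.
have s1 := s_ge; have k0 := kappa_gt0; have s2 := s_le.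
elim: r i => // r IH i ir.
have ir' : (i.+1 + r)%N = m.+1 by rewrite addSnnS.
have [xN [rest [e xNi _ _]]] := gates_head k0 s_ge s_le ir'.
have {}IH := IH _ ir'; have XSi := gate_xS s i; rewrite gatesS e; rewrite e in IH.
split; first by apply: slant_sideN; lra.
split; first by apply: flat_side; lra.
split; first by apply/allowed_side_sym/slant_side; lra.
split => //; apply: flat_side; lra.
Qed.

Lemma tower_lizard : lizard k tower.
Proof.
have s1 := s_ge; have k0 := kappa_gt0; have x0 := @right_x_ge20 R s m s_ge.
have sz := @size_outline R kap s m.
exists (size (outline kap s m)), (outline_vertex (kap := kap) (s := s) (m := m)); split.
- exact: outline_closed.
- exact: tower_region.
have dE : depth s m = (XR + 20) / 2 by [].
have xE : XR = X m + 20 by [].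
have ag : allowed_sides (outline kap s m).
  have := @allowed_gates m.+1 0 (add0n _); rewrite outlineE.
  have e1 : gates kap s m m.+1 0 = [:: pt (-1) 0, gate_top_l kap s 0, gate_top_r kap s 0, gate_foot_r kap s 0 & gates kap s m m 1].
    by rewrite gatesS /gate_foot_l gate_x0 add0r.
  rewrite e1 => ag.
  split; first by apply: slant_sideN; lra.
  split; first by apply: flat_side; lra.
  split; first by apply: slant_sideN; lra.
  by split; first by apply: flat_side; lra.
move=> i; have il := ltn_ord i; rewrite -/(allowed_side _ _).
have [i1|i1] := eqVneq i.+1 (size (outline kap s m)).
  have -> : ordS i = Ordinal (leq_ltn_trans (leq0n i) il).
    by apply: val_inj; rewrite /= -/(size _) i1 modnn.
  have e : outline_vertex i = pt XR 0.
    rewrite /outline_vertex -outline_last //; congr (nth 0 _ _).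
    by rewrite -[LHS]/(i.+1.-1) i1.
  rewrite e; apply: allowed_side_sym.
  rewrite -[outline_vertex _]/(nth 0 (outline kap s m) 0) outline0.
  by apply: slant_side; lra.
have il2 : (i.+1 < size (outline kap s m))%N by rewrite ltn_neqAle i1.
have := allowed_sides_nth ag il2.
have eS : nat_of_ord (ordS i) = i.+1.
  by rewrite -[LHS]/(i.+1 %% size (outline kap s m))%N modn_small.
by rewrite /outline_vertex eS.
Qed.

End TowerDirections.

(** * Corners of cones and triangles, and half-planes in cotangent form *)

Section Corners.
Variables (R : realType) (k : nat).
Hypothesis k_gt1 : (1 < k)%N.
Local Notation point := (R * R)%type.
Local Notation normal := (normal R k).
Local Notation dir := (dir R k).
Let k_gt0 : (0 < k)%N. Proof. exact: ltnW. Qed.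

Definition along_dir (e : point) : Prop := exists r j, (j < k)%N /\ e = r *: dir j.

Lemma along_dirZ r e : along_dir e -> along_dir (r *: e).
Proof. by move=> [r' [j [jk ->]]]; exists (r * r'), j; rewrite scalerA. Qed.

Lemma along_dirN e : along_dir e -> along_dir (- e).
Proof. by rewrite -scaleN1r; exact: along_dirZ. Qed.

Lemma ler_of_linear (c A B : R) : (forall t, 0 < t -> t <= 1 -> c <= A + t * B) -> c <= A.
Proof.
move=> h; rewrite leNgt; apply/negP => Ac.
have h1 := h 1 ltr01 (lexx _); have B0 : 0 < B by lra.
have := h ((c - A) / (2 * B)).
have -> : (c - A) / (2 * B) * B = (c - A) / 2 by field; rewrite gt_eqF.
have t0 : 0 < (c - A) / (2 * B) by apply: divr_gt0; lra.
have t1 : (c - A) / (2 * B) <= 1 by rewrite ler_pdivrMr; lra.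
by move=> /(_ t0 t1); lra.
Qed.

(** The bound reaches [w] by shrinking [W] towards it, since [w] need not belong to [W]. By
    [cone_dir] both normals are nonnegative on the sides of the cone, so [w] minimizes both. *)
Lemma corner_of_cone (W : set point) (w e1 e2 : point) i l m c :
  along_dir e1 -> along_dir e2 -> 0 < l -> 0 < m -> W !=set0 ->
  (forall y t, W y -> 0 < t -> t <= 1 -> W (w + t *: (y - w))) ->
  (forall y, W y -> exists a b, [/\ 0 <= a, 0 <= b & y = w + (a *: e1 + b *: e2)]) ->
  let u := l *: normal i + m *: normal i.+1 in
  (forall y, W y -> c <= dot u y) -> 0 <= dot u e1 -> 0 <= dot u e2 ->
  exists2 w, c <= dot u w &
      forall y, W y -> dot (normal i) w <= dot (normal i) y /\
                       dot (normal i.+1) w <= dot (normal i.+1) y.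
Proof.
move=> [r1 [j1 [j1k ->]]] [r2 [j2 [j2k ->]]] l0 m0 [y0 Wy0] Wshrink Wcone u uc.
have [_ c1] := @cone_dir R k k_gt0 l m i j1 k_gt1 j1k l0 m0.
have [_ c2] := @cone_dir R k k_gt0 l m i j2 k_gt1 j2k l0 m0.
rewrite !dotZr => /c1 [g1 g1'] /c2 [g2 g2']; exists w.
  apply: (@ler_of_linear _ _ (dot u (y0 - w))) => t t0 t1.
  by rewrite -dotZr -dotDr; apply/uc/Wshrink.
move=> y /Wcone [a [b [a0 b0 ->]]]; rewrite !dotDr !dotZr !lerDl.
by split; rewrite addr_ge0 // mulr_ge0.
Qed.

(** [W] recedes along both sides of the cone, so a functional bounded below on [W] is nonnegative on
    them. *)
Lemma has_corners_cone (W : set point) (w e1 e2 : point) :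
  along_dir e1 -> along_dir e2 -> W !=set0 ->
  (forall y t, W y -> 0 < t -> t <= 1 -> W (w + t *: (y - w))) ->
  (forall y t, W y -> 0 <= t -> W (y + t *: e1) /\ W (y + t *: e2)) ->
  (forall y, W y -> exists a b, [/\ 0 <= a, 0 <= b & y = w + (a *: e1 + b *: e2)]) ->
  has_corners k W.
Proof.
move=> d1 d2 W0 Wshrink Wrec Wcone i l m c l0 m0 uc; have [y0 Wy0] := W0.
have rec e : (forall t, 0 <= t -> W (y0 + t *: e)) ->
    0 <= dot (l *: normal i + m *: normal i.+1) e.
  move=> We; set u := _ + _; rewrite leNgt; apply/negP => ue.
  pose t := (dot u y0 - c + 1) / - dot u e.
  have t0 : 0 <= t by apply: divr_ge0; [have := uc _ Wy0; rewrite -/u; lra|lra].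
  have := uc _ (We t t0); rewrite -/u dotDr dotZr.
  have -> : t * dot u e = - (dot u y0 - c + 1) by rewrite /t; field; lra.
  lra.
apply: (@corner_of_cone W w e1 e2) => //; apply: rec => t t0; by have [] := Wrec y0 t Wy0 t0.
Qed.

(* Each vertex [w] of the triangle sees [W] inside the cone spanned by its two sides; a
   functional bounded below on [W] is minimal at one of the vertices. *)
Lemma has_corners_triangle (W : set point) (w0 e f : point) :
  along_dir e -> along_dir f -> along_dir (f - e) -> W !=set0 ->
  (forall w y t, (w = w0 \/ w = w0 + e \/ w = w0 + f) -> W y -> 0 < t -> t <= 1 ->
     W (w + t *: (y - w))) ->
  (forall y, W y -> exists a b, [/\ 0 <= a, 0 <= b, a + b <= 1 & y = w0 + (a *: e + b *: f)]) ->
  has_corners k W.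
Proof.
move=> de df dfe W0 Wshrink Wtri i l m c l0 m0 uc; set u := _ + _.
have [he|he] := leP 0 (dot u e); have [hf|hf] := leP 0 (dot u f).
- apply: (@corner_of_cone W w0 e f) => //.
    by move=> y t; apply: Wshrink; left.
  by move=> y /Wtri [a [b [a0 b0 _ ->]]]; exists a, b.
- apply: (@corner_of_cone W (w0 + f) (- f) (- (f - e))) => //.
  + exact: along_dirN. + exact: along_dirN.
  + by move=> y t; apply: Wshrink; right; right.
  + move=> y /Wtri [a [b [a0 b0 ab ->]]]; exists (1 - a - b), a; split; [lra|lra|].
    by apply: injective_projections; rewrite /= /GRing.scale /=; ring.
  + by rewrite -scaleN1r dotZr -/u; lra.
  + by rewrite -scaleN1r dotZr dotBr -/u; lra.
- apply: (@corner_of_cone W (w0 + e) (- e) (f - e)) => //.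
  + exact: along_dirN.
  + by move=> y t; apply: Wshrink; right; left.
  + move=> y /Wtri [a [b [a0 b0 ab ->]]]; exists (1 - a - b), b; split; [lra|lra|].
    by apply: injective_projections; rewrite /= /GRing.scale /=; ring.
  + by rewrite -scaleN1r dotZr -/u; lra.
  + by rewrite dotBr -/u; lra.
- have [h|h] := leP (dot u e) (dot u f).
    apply: (@corner_of_cone W (w0 + e) (- e) (f - e)) => //.
    + exact: along_dirN.
    + by move=> y t; apply: Wshrink; right; left.
    + move=> y /Wtri [a [b [a0 b0 ab ->]]]; exists (1 - a - b), b; split; [lra|lra|].
      by apply: injective_projections; rewrite /= /GRing.scale /=; ring.
    + by rewrite -scaleN1r dotZr -/u; lra.
    + by rewrite dotBr -/u; lra.
  apply: (@corner_of_cone W (w0 + f) (- f) (- (f - e))) => //.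
  + exact: along_dirN. + exact: along_dirN.
  + by move=> y t; apply: Wshrink; right; right.
  + move=> y /Wtri [a [b [a0 b0 ab ->]]]; exists (1 - a - b), a; split; [lra|lra|].
    by apply: injective_projections; rewrite /= /GRing.scale /=; ring.
  + by rewrite -scaleN1r dotZr -/u; lra.
  + by rewrite -scaleN1r dotZr dotBr -/u; lra.
Qed.

Lemma halfplanes_closedI (A B : set point) :
  halfplanes_closed k A -> halfplanes_closed k B -> halfplanes_closed k (A `&` B).
Proof.
move=> cA cB x /not_andP [/cA|/cB] [i [c [h1 h2]]].
  by exists i, c; split => // y [/h1].
by exists i, c; split => // y [_ /h1].
Qed.

Lemma halfplanes_closed_dot (u : point) c r i : 0 < r -> u = r *: normal i ->
  halfplanes_closed k [set x | dot u x <= c].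
Proof.
move=> r0 -> x /= /negP; rewrite -ltNge dotZl => h; exists i, (c / r); split.
  by move=> y /=; rewrite dotZl ler_pdivlMr // mulrC.
by rewrite ltr_pdivrMr // mulrC.
Qed.

Lemma halfplanes_closed_top (kap c : R) : 0 < kap ->
  halfplanes_closed k [set z | ht kap z <= c].
Proof.
move=> kap_gt0.
have -> : [set z | ht kap z <= c] = [set x | dot (0, kap) x <= c].
  by apply/seteqP; split => x /=; rewrite /dot /= mul0r add0r.
apply: (@halfplanes_closed_dot _ _ kap k) => //.
rewrite /normal angle_k // sinpi cospi opprK.
by apply: injective_projections; rewrite /= /GRing.scale /=; ring.
Qed.

Definition cot i : R := cos (angle R k i) / sin (angle R k i).

Lemma halfplanes_closed_right i c : (0 < i < k)%N ->
  halfplanes_closed k [set z | z.1 - cot i * z.2 <= c].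
Proof.
move=> ik; have si : 0 < sin (angle R k i) by exact: sin_angle_gt0.
have -> : [set z | z.1 - cot i * z.2 <= c] = [set x : point | dot (1, - cot i) x <= c].
  by apply/seteqP; split => x /=; rewrite /dot /= mul1r mulNr.
apply: (@halfplanes_closed_dot _ _ (sin (angle R k i))^-1 i); first by rewrite invr_gt0.
by apply: injective_projections; rewrite /cot /= /GRing.scale /=; field; rewrite gt_eqF.
Qed.

Lemma halfplanes_closed_left i c : (0 < i < k)%N ->
  halfplanes_closed k [set z | c <= z.1 - cot i * z.2].
Proof.
move=> ik; have si : 0 < sin (angle R k i) by exact: sin_angle_gt0.
have -> : [set z | c <= z.1 - cot i * z.2] = [set x : point | dot (-1, cot i) x <= - c].
  apply/seteqP; split => x /=; rewrite /dot /= mulN1r; lra.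
apply: (@halfplanes_closed_dot _ _ (sin (angle R k i))^-1 (i + k)); first by rewrite invr_gt0.
rewrite normalDk //.
by apply: injective_projections; rewrite /cot /= /GRing.scale /=; field; rewrite gt_eqF.
Qed.

Lemma cotN i : (0 < i < k)%N -> cot (k - i) = - cot i.
Proof.
move=> ik; have si : 0 < sin (angle R k i) by exact: sin_angle_gt0.
have e : angle R k (k - i) = pi - angle R k i.
  by apply/eqP; rewrite eq_sym subr_eq -angleD subnK ?angle_k //; lia.
by rewrite /cot e cosB sinB cospi sinpi; field; rewrite gt_eqF.
Qed.

End Corners.

(** * The notches are convex with allowed corners, so the tower has finitely many scales *)

Section TowerScalesFinite.
Variables (R : realType) (k : nat) (s : R) (m : nat).
Hypothesis k_gt2 : (2 < k)%N.
Hypothesis s_ge : 5 / 2 <= s.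
Hypothesis s_le : s <= 4.
Local Notation point := (R * R)%type.
Local Notation normal := (normal R k).
Local Notation kap := (kappa R k).
Local Notation pt := (pt kap).
Local Notation ht := (ht kap).
Local Notation X := (gate_x s).
Local Notation XR := (right_x s m).
Local Notation tower := (tower kap s m).
Local Notation notch := (@notch R kap s m).
Let k_gt1 : (1 < k)%N. Proof. exact: ltnW. Qed.
Let k_gt0 : (0 < k)%N. Proof. exact: ltnW. Qed.
Let kap_gt0 : 0 < kap. Proof. exact: kappa_gt0. Qed.

Lemma htD (x y : point) : ht (x + y) = ht x + ht y.
Proof. by rewrite /ht /= mulrDr. Qed.
Lemma htB (x y : point) : ht (x - y) = ht x - ht y.
Proof. by rewrite /ht /= mulrBr. Qed.
Lemma htZ t (x : point) : ht (t *: x) = t * ht x.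
Proof. by rewrite /ht /= /GRing.scale /=; ring. Qed.
Lemma fstZ t (x : point) : (t *: x).1 = t * x.1.
Proof. by []. Qed.
Lemma fstD (x y : point) : (x + y).1 = x.1 + y.1.
Proof. by []. Qed.
Let htpt x v : ht (pt x v) = v. Proof. exact: ht_pt. Qed.

Lemma pointE (x y : point) : x.1 = y.1 -> ht x = ht y -> x = y.
Proof.
move=> h1 /(mulfI (lt0r_neq0 kap_gt0)) h2; exact: injective_projections.
Qed.

Lemma along_flat : along_dir k (1, 0 : R).
Proof. by exists 1, 0%N; rewrite dir0 scale1r. Qed.

Lemma along_slant : along_dir k (pt 1 1).
Proof.
have c0 := @cos1_gt0 R k k_gt2; have s0 := @sin1_gt0 R k k_gt2.
exists (1 / cos (angle R k 1)), 1%N; split => //.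
by apply: injective_projections; rewrite /= /GRing.scale /= /kappa; field; rewrite ?gt_eqF.
Qed.

Lemma along_slantN : along_dir k (pt (-1) 1).
Proof.
have c0 := @cos1_gt0 R k k_gt2; have s0 := @sin1_gt0 R k k_gt2.
exists (1 / cos (angle R k 1)), k.-1; split; first by rewrite prednK.
rewrite dir_last //.
by apply: injective_projections; rewrite /= /GRing.scale /= /kappa; field; rewrite ?gt_eqF.
Qed.

Lemma conv_gt (a b c t : R) : 0 <= t -> t <= 1 -> c < a -> c < b -> c < (1 - t) * a + t * b.
Proof.
move=> t0 t1 ca cb; have [->|tN0] := eqVneq t 0; first by lra.
have t_gt0 : 0 < t by rewrite lt0r tN0.
have h1 : 0 <= (1 - t) * (a - c) by apply: mulr_ge0; lra.
have h2 : 0 < t * (b - c) by apply: mulr_gt0; lra.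
lra.
Qed.

Lemma convex_notch w : convex_set (notch w : set (convex_lmodType point)).
Proof.
apply/convex_setP => x y t t0 t1.
have hm : ht ((1 - t) *: x + t *: y) - ((1 - t) *: x + t *: y).1 =
  (1 - t) * (ht x - x.1) + t * (ht y - y.1) by rewrite htD !htZ fstD !fstZ; ring.
have hp : - (((1 - t) *: x + t *: y).1 + ht ((1 - t) *: x + t *: y)) =
  (1 - t) * - (x.1 + ht x) + t * - (y.1 + ht y) by rewrite htD !htZ fstD !fstZ; ring.
have h0 : ht ((1 - t) *: x + t *: y) = (1 - t) * ht x + t * ht y by rewrite htD !htZ.
move: hm hp h0; set z := (1 - t) *: x + t *: y => hm hp h0.
have gt c : c < ht x -> c < ht y -> c < ht z by rewrite h0; exact: conv_gt.
have gp c : x.1 + ht x < c -> y.1 + ht y < c -> z.1 + ht z < c.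
  by rewrite -![_ < c]ltrN2 hp; exact: conv_gt.
have gm c : c < x.1 - ht x -> c < y.1 - ht y -> c < z.1 - ht z.
  move=> h1 h2; have hm' : z.1 - ht z = (1 - t) * (x.1 - ht x) + t * (y.1 - ht y) by lra.
  by rewrite hm' conv_gt.
case: w => [[[i|]|]|] /=.
- by move=> [x1 x2 x3] [y1 y2 y3]; split; [exact: gt|exact: gm|exact: gp].
- by move=> [x1 x2] [y1 y2]; split; [exact: gt|exact: gm].
- by move=> [x1 x2] [y1 y2]; split; [exact: gt|exact: gp].
- by move=> [x1 x2] [y1 y2]; split; [exact: gt|exact: gp].
Qed.

Lemma corners_left a b : has_corners k [set z | a < ht z /\ z.1 + ht z < b].
Proof.
apply: (@has_corners_cone _ _ k_gt1 _ (pt (b - a) a) (- (1, 0)) (pt (-1) 1)).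
- exact/along_dirN/along_flat.
- exact: along_slantN.
- by exists (pt (b - a - 2) (a + 1)); rewrite /= htpt; lra.
- move=> y t [y1 y2] t0 t1; rewrite /= htD htZ htB htpt /= /GRing.scale /=.
  have h1 : 0 < t * (ht y - a) by apply: mulr_gt0; lra.
  have h2 : 0 < t * (b - (y.1 + ht y)) by apply: mulr_gt0; lra.
  by split; lra.
- move=> y t [y1 y2] t0; split; rewrite /= htD htZ ?htpt /= /GRing.scale /=.
    have -> : ht (- 1, - 0) = 0 by rewrite /ht /= oppr0 mulr0.
    by split; lra.
  by split; lra.
- move=> y [y1 y2]; exists (b - (y.1 + ht y)), (ht y - a); split; [lra|lra|].
  apply: pointE.
    by rewrite /= /GRing.scale /=; ring.
  rewrite !htD !htZ !htpt.
  have -> : ht (- (1, 0)) = 0 by rewrite /ht /= oppr0 mulr0.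
  by ring.
Qed.

Lemma corners_right a b : has_corners k [set z | a < ht z /\ b < z.1 - ht z].
Proof.
apply: (@has_corners_cone _ _ k_gt1 _ (pt (b + a) a) (1, 0) (pt 1 1)).
- exact: along_flat.
- exact: along_slant.
- by exists (pt (b + a + 2) (a + 1)); rewrite /= htpt; lra.
- move=> y t [y1 y2] t0 t1; rewrite /= htD htZ htB htpt /= /GRing.scale /=.
  have h1 : 0 < t * (ht y - a) by apply: mulr_gt0; lra.
  have h2 : 0 < t * ((y.1 - ht y) - b) by apply: mulr_gt0; lra.
  by split; lra.
- move=> y t [y1 y2] t0; split; rewrite /= htD htZ ?htpt /= /GRing.scale /=.
    have -> : ht (1, 0) = 0 by rewrite /ht /= mulr0.
    by split; lra.
  by split; lra.
- move=> y [y1 y2]; exists ((y.1 - ht y) - b), (ht y - a); split; [lra|lra|].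
  apply: pointE.
    by rewrite /= /GRing.scale /=; ring.
  rewrite !htD !htZ !htpt.
  have -> : ht (1, 0) = 0 by rewrite /ht /= mulr0.
  by ring.
Qed.

Lemma corners_triangle p q : p < q ->
  has_corners k [set z | [/\ 0 < ht z, p < z.1 - ht z & z.1 + ht z < q]].
Proof.
move=> pq; have [h [h0 hE]] : exists h, 0 < h /\ q = p + 2 * h.
  by exists ((q - p) / 2); split; lra.
subst q.
have ht10 : ht (1, 0) = 0 by rewrite /ht /= mulr0.
apply: (@has_corners_triangle _ _ k_gt1 _ (pt p 0) ((p + 2 * h - p) *: (1, 0)) (h *: pt 1 1)).
- exact/along_dirZ/along_flat.
- exact/along_dirZ/along_slant.
- have -> : h *: pt 1 1 - (p + 2 * h - p) *: (1, 0) = h *: pt (-1) 1.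
    by apply: injective_projections; rewrite /= /GRing.scale /=; ring.
  exact/along_dirZ/along_slantN.
- exists (pt (p + h) (h / 2)); rewrite /= htpt; split; lra.
- move=> w y t ww [y1 y2 y3] t0 t1.
  have h1 : 0 < t * ht y by apply: mulr_gt0; lra.
  have h2 : 0 < t * (y.1 - ht y - p) by apply: mulr_gt0; lra.
  have h3 : 0 < t * (p + 2 * h - (y.1 + ht y)) by apply: mulr_gt0; lra.
  have h4 : 0 <= (1 - t) * h by apply: mulr_ge0; lra.
  case: ww => [->|[->|->]]; rewrite /= !(htB, htD, htZ, htpt) ?ht10 /= /GRing.scale /=; split; lra.
- move=> y [y1 y2 y3]; exists ((y.1 - ht y - p) / (p + 2 * h - p)), (ht y / h); split.
  + by apply: divr_ge0; lra.
  + by apply: divr_ge0; lra.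
  + have -> : (y.1 - ht y - p) / (p + 2 * h - p) + ht y / h = (y.1 + ht y - p) / (p + 2 * h - p).
      by field; rewrite ?gt_eqF //; lra.
    by rewrite ler_pdivrMr; lra.
  + rewrite !scalerA !divfK ?gt_eqF ?subr_gt0 //; apply: pointE.
      by rewrite /= /GRing.scale /=; ring.
    by rewrite !htD !htZ !htpt ht10; ring.
Qed.

Lemma corners_notch w : has_corners k (notch w).
Proof.
case: w => [[[i|]|]|] /=.
- by apply: corners_triangle; have := gate_xS s i; have := s_ge; lra.
- exact: corners_right.
- exact: corners_left.
- exact: corners_left.
Qed.

Lemma halfplanes_closed_envelope : halfplanes_closed k (envelope kap s m).
Proof.
have -> : envelope kap s m = [set z | ht z <= 1 / 8] `&` [set z | z.1 - cot R k 1 * z.2 <= XR] `&`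
    [set z | - 20 <= z.1 - cot R k (k - 1) * z.2].
  apply/seteqP; split => z; rewrite /envelope /= cotN ?k_gt1 // mulNr opprK.
    by case.
  by move=> [[h1 h2] h3]; split.
apply: halfplanes_closedI; last by apply: (halfplanes_closed_left k_gt1); lia.
by apply: halfplanes_closedI; [exact: halfplanes_closed_top|apply: (halfplanes_closed_right k_gt1); lia].
Qed.

Lemma finite_tower_scales : finite_set [set S | lizard_scale k tower S].
Proof.
apply: (@finite_scales _ _ k_gt1 _ (envelope kap s m) _ notch) => //.
- exact: bounded_tower.
- exact: halfplanes_closed_envelope.
- exact: open_notch.
- exact: convex_notch.
- exact: corners_notch.
Qed.

End TowerScalesFinite.

(** * Scales of the tower *)

Section Blocking.
Variables (R : realType).
Local Notation point := (R * R)%type.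

Lemma convex_segment (T : set point) (b d : point) e r :
  convex_set (T : set (convex_lmodType point)) -> 0 < e ->
  T (b - e *: d) -> T (b + e *: d) -> `|r| <= e -> T (b + r *: d).
Proof.
move=> /convex_setP cT e0 T1 T2; rewrite ler_norml => /andP[r1 r2].
have -> : b + r *: d = (1 - (r + e) / (2 * e)) *: (b - e *: d) +
    ((r + e) / (2 * e)) *: (b + e *: d).
  by apply: injective_projections; rewrite /= /GRing.scale /=; field; rewrite gt_eqF.
apply: cT => //; first by apply: divr_ge0; lra.
by rewrite ler_pdivrMr; lra.
Qed.

(* The side [dot u x = c] of [S] contains [b] in its relative interior, and [b + t e] lies
   outside [L] for small [t > 0]: the side cannot be pushed outwards. *)
Definition blocked (L S : set point) (u : point) (c : R) : Prop :=
  exists b d e : point, exists r t0 : R,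
    [/\ 0 < r, 0 < t0, d != 0 /\ dot u d = 0, dot u b = c /\ 0 < dot u e &
        [/\ S (b - r *: d), S (b + r *: d) & forall t, 0 < t -> t < t0 -> ~ L (b + t *: e)]].

(** A point [z] of [T] beyond the side spans with the segment around [b] a triangle inside [T].
    Writing [e = q *: d + l *: (z - b)] with [l > 0] shows that this triangle contains [b + t *: e]
    for small [t > 0], which is outside [L]. *)
Lemma blocked_le (L S T : set point) u c :
  convex_set (T : set (convex_lmodType point)) -> S `<=` T -> T `<=` L ->
  blocked L S u c -> forall z, T z -> dot u z <= c.
Proof.
move=> cT ST TL [b [d [e [r [t0 [r0 t00 [d0 ud] [ub ue] [S1 S2 out]]]]]]] z Tz.
rewrite leNgt; apply/negP => cz.
have dd := dot_self_gt0 d0.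
have uz : 0 < dot u (z - b) by rewrite dotBr ub subr_gt0.
pose l := dot u e / dot u (z - b).
have l0 : 0 < l by apply: divr_gt0.
pose w := e - l *: (z - b).
have uw : dot u w = 0 by rewrite /w dotBr dotZr /l divfK ?subrr ?gt_eqF.
have u0 : u != 0 by apply/eqP => u0; move: ue; rewrite u0 /dot !mul0r addr0 ltxx.
have [q wE] : exists q, w = q *: d.
  exists (dot d w / dot d d); apply: (scalerI (lt0r_neq0 dd)).
  rewrite scalerA mulrC divfK ?gt_eqF //.
  have uu := dot_self_gt0 u0; apply: (scalerI (lt0r_neq0 uu)).
  have perp (v : point) : dot u v = 0 -> dot u u *: v = cross u v *: (- u.2, u.1).
    rewrite /dot /cross => h; apply: injective_projections; rewrite /= /GRing.scale /=.
      have := congr1 (fun x => u.1 * x) h; rewrite mulr0 /=; lra.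
    have := congr1 (fun x => u.2 * x) h; rewrite mulr0 /=; lra.
  have e1 : dot u u *: (dot d d *: w) = dot d d *: (cross u w *: (- u.2, u.1)).
    by rewrite -perp // !scalerA mulrC.
  have e2 : dot u u *: (dot d w *: d) = dot d w *: (cross u d *: (- u.2, u.1)).
    by rewrite -perp // !scalerA mulrC.
  rewrite e1 e2 !scalerA; congr (_ *: _).
  apply: (mulfI (lt0r_neq0 uu)).
  have e3 : dot u u * dot d w = cross u w * dot d (- u.2, u.1).
    by rewrite -dotZr perp // dotZr.
  have e4 : dot u u * dot d d = cross u d * dot d (- u.2, u.1).
    by rewrite -dotZr perp // dotZr.
  by rewrite mulrA e4 [RHS]mulrA e3; ring.
(* The three summands ensure, for [t = 1/N], that [t < t0], that the weight [t * l] of [z] is below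
   [1/2], and that the point left on the segment is within [r] of [b]. *)
pose N := 2 / t0 + 2 * l + 2 * (`|q| + 1) / r.
have n1 : 0 < 2 / t0 by apply: divr_gt0.
have n2 : 0 < 2 * (`|q| + 1) / r by apply: divr_gt0 => //; have := normr_ge0 q; lra.
have N0 : 0 < N by rewrite /N; lra.
pose t := N^-1; have t_gt0 : 0 < t by rewrite invr_gt0.
have tN : t * N = 1 by rewrite mulVf ?gt_eqF.
have tt0 : t < t0.
  have h : t * (2 / t0) < 1 by rewrite -[ltRHS]tN ltr_pM2l // /N; lra.
  have : t * (2 / t0) * t0 < t0 by rewrite gtr_pMl.
  by rewrite mulrA divfK ?gt_eqF //; lra.
have tl : t * l < 1 / 2.
  have : t * (2 * l) < 1 by rewrite -[ltRHS]tN ltr_pM2l // /N; lra.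
  lra.
have tq : 2 * (t * `|q|) <= r.
  have h : t * (2 * (`|q| + 1) / r) < 1 by rewrite -[ltRHS]tN ltr_pM2l // /N; lra.
  have : t * (2 * (`|q| + 1) / r) * r < r by rewrite gtr_pMl.
  have -> : t * (2 * (`|q| + 1) / r) * r = t * (2 * (`|q| + 1)) by field; rewrite gt_eqF.
  lra.
apply: (out t t_gt0 tt0); apply: TL.
pose a := t * l.
have a1 : 0 < 1 - a by rewrite /a; lra.
have -> : b + t *: e = (1 - a) *: (b + (t * q / (1 - a)) *: d) + a *: z.
  have eE : e = q *: d + l *: (z - b) by rewrite -wE /w subrK.
  rewrite eE /a in a1 *; apply: injective_projections; rewrite /= /GRing.scale /=;
  by field; rewrite gt_eqF.
apply: (convex_setP _).1 => //; [by rewrite /a mulr_ge0 // ltW|by lra|].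
apply: (@convex_segment _ _ _ r) => //; [exact: ST|exact: ST|].
rewrite normrM normrM (gtr0_norm t_gt0) normfV (gtr0_norm a1) ler_pdivrMr //.
have h : r * (1 / 2) <= r * (1 - a) by rewrite ler_pM2l // /a; lra.
lra.
Qed.

End Blocking.

(** * The bottom scale and the pins *)

Section TowerScales.
Variables (R : realType) (k : nat) (s : R) (m : nat).
Hypothesis k_gt2 : (2 < k)%N.
Hypothesis s_ge : 5 / 2 <= s.
Hypothesis s_le : s <= 4.
Local Notation point := (R * R)%type.
Local Notation normal := (normal R k).
Local Notation kap := (kappa R k).
Local Notation pt := (pt kap).
Local Notation ht := (ht kap).
Local Notation X := (gate_x s).
Local Notation XR := (right_x s m).
Local Notation tower := (tower kap s m).
Local Notation notch := (@notch R kap s m).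
Let k_gt1 : (1 < k)%N. Proof. exact: ltnW. Qed.
Let k_gt0 : (0 < k)%N. Proof. exact: ltnW. Qed.
Let kap_gt0 : 0 < kap. Proof. exact: kappa_gt0. Qed.
Let htpt x v : ht (pt x v) = v. Proof. exact: ht_pt. Qed.
Let XR_ge : 20 <= XR. Proof. exact: right_x_ge20. Qed.
Let XRE : XR = X m + 20. Proof. by []. Qed.
Let Xge0 i : 0 <= X i. Proof. exact: gate_x_ge0. Qed.

Definition bottom : set point :=
  [set z | [/\ ht z <= - 5, -20 <= z.1 + ht z & z.1 - ht z <= XR]].

(* [kap * l] and [kap * r] are the cotangents of the directions of the slanted sides. *)
Definition pin (i : nat) (l r : R) : set point :=
  [set z | [/\ ht z <= 1 / 8, X i - 1 <= z.1 - l * ht z & z.1 - r * ht z <= X i + 1]].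

(** With [r - l >= 1/6] the apex is not below [v = -12], and the pin drifts sideways by at most half
    its depth, so [x + v >= -19] and [x - v <= X m + 19]: this fixes the constant 20 of the
    envelope. While [v > -5] the same estimate keeps [x + v] above [-10], clear of the ledge. *)
Lemma pin_sub_tower i l r : (i <= m)%N -> -1 <= l -> l <= 1 / 2 -> - (1 / 2) <= r ->
  r <= 1 -> 1 <= 6 * (r - l) -> pin i l r `<=` tower.
Proof.
move=> im l1 l2 r1 r2 rl z [h1 h2 h3].
have Xi := gate_x_le s_ge im; have Xi0 := Xge0 i; have xr := XRE.
have [hz|hz] := leP (ht z) 0.
  have p1 : 0 <= (r + 1 / 2) * - ht z by apply: mulr_ge0; lra.
  have p2 : 0 <= (1 / 2 - l) * - ht z by apply: mulr_ge0; lra.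
  have p3 : 0 <= (6 * (r - l) - 1) * - ht z by apply: mulr_ge0; lra.
  apply/towerP; split.
  - by split; lra.
  - by have [h|h] := leP (ht z) (-5); [left|right; lra].
  - by left.
  - by left.
  - by move=> i' _; constructor 1.
have p1 : 0 <= (1 - r) * ht z by apply: mulr_ge0; lra.
have p2 : 0 <= (l + 1) * ht z by apply: mulr_ge0; lra.
apply/towerP; split.
- by split; lra.
- by right; lra.
- by right; lra.
- by right; lra.
- move=> i' im'; have [ii|ii] := ltnP i' i.
    by have := gate_x_lt s_ge ii; have := gate_xS s i'; constructor 3; lra.
  by have := gate_x_le s_ge ii; constructor 2; lra.
Qed.

Lemma bottom_sub_tower : bottom `<=` tower.
Proof.
move=> z [h1 h2 h3]; apply/towerP; split.
- by split; lra.
- by left.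
- by left; lra.
- by left; lra.
- by move=> i _; constructor 1; lra.
Qed.

Let dot_ht a b (z : point) : dot (a, kap * b) z = a * z.1 + b * ht z.
Proof. by rewrite /dot /ht /=; ring. Qed.

Let kapN0 : kap != 0. Proof. by rewrite gt_eqF. Qed.

Ltac coords := rewrite ?htB ?htD ?htZ ?htpt /= /GRing.scale /=.

Let pt_neq0 x v : v != 0 -> pt x v != 0.
Proof. by move=> v0; apply/eqP => /(congr1 ht); rewrite htpt /ht mulr0 => /eqP; exact/negP. Qed.

Let cross_pt a b c : cross (b - a) (c - a) =
  ((b.1 - a.1) * (ht c - ht a) - (ht b - ht a) * (c.1 - a.1)) / kap.
Proof. by rewrite /cross /ht /=; field. Qed.

Lemma bottom_scale : lizard_scale k tower bottom.
Proof.
have cB : halfplanes_closed k bottom.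
  have -> : bottom = [set z | ht z <= - 5] `&` [set z | z.1 - cot R k 1 * z.2 <= XR] `&`
      [set z | - 20 <= z.1 - cot R k (k - 1) * z.2].
    apply/seteqP; split => z; rewrite /bottom /= cotN ?k_gt1 // mulNr opprK.
      by case.
    by move=> [[h1 h2] h3]; split.
  apply: halfplanes_closedI; last by apply: halfplanes_closed_left; lia.
  by apply: halfplanes_closedI; [exact: halfplanes_closed_top|apply: halfplanes_closed_right; lia].
have x0 := XR_ge.
split; last 1 first.
- move=> T [_ cT] ST TL; apply/seteqP; split => // z Tz.
  (* The top side is blocked by the ledge, over [-15 <= x <= -5]; the two other sides lie on the
     envelope. *)
  have B1 : blocked tower bottom (0, kap * 1) (-5).
    exists (pt (-12) (-5)), (pt 1 0), (pt 0 1), 1, 1; rewrite !dot_ht !htpt /=.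
    split; [lra|lra| |lra|].
      by split; [apply/eqP => -[/eqP]; rewrite oner_eq0|lra].
    split; [split; coords; lra|split; coords; lra|].
    by move=> t t0 t1 /towerP [_ + _ _ _]; coords; lra.
  have B2 : blocked tower bottom (-1, kap * -1) 20.
    exists (pt (-14) (-6)), (pt (-1) 1), (pt (-1) 0), 1, 1; rewrite !dot_ht !htpt /=.
    split; [lra|lra| |lra|].
      by split; [apply: pt_neq0; rewrite oner_eq0|lra].
    split; [split; coords; lra|split; coords; lra|].
    by move=> t t0 t1 /towerP [[_ _ +] _ _ _ _]; coords; lra.
  have B3 : blocked tower bottom (1, kap * -1) XR.
    exists (pt (XR - 6) (-6)), (pt 1 1), (pt 1 0), 1, 1; rewrite !dot_ht !htpt /=.
    split; [lra|lra| |lra|].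
      by split; [apply: pt_neq0; rewrite oner_eq0|lra].
    split; [split; coords; lra|split; coords; lra|].
    by move=> t t0 t1 /towerP [[_ + _] _ _ _ _]; coords; lra.
  have := blocked_le cT ST TL B1 Tz; have := blocked_le cT ST TL B2 Tz.
  have := blocked_le cT ST TL B3 Tz; rewrite !dot_ht => h1 h2 h3.
  by split; lra.
- apply: convex_lizard_of_halfplanes => //.
    have /bounded_setP [M hM] := @bounded_tower R kap s m kap_gt0 s_ge.
    by apply/bounded_setP; exists M => z /bottom_sub_tower; exact: hM.
  exists (pt (-12) (-5)), (pt (-11) (-5)), (pt (-12) (-6)).
  split; try (split; coords; lra).
  by rewrite cross_pt; coords; apply: mulf_neq0; [lra|rewrite invr_eq0].
- exact: bottom_sub_tower.
Qed.

Lemma pin_scale i l r jl jr : (i <= m)%N -> (0 < jl < k)%N -> (0 < jr < k)%N ->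
  cot R k jl = kap * l -> cot R k jr = kap * r ->
  -1 <= l -> l <= 1 / 2 -> - (1 / 2) <= r -> r <= 1 -> 1 <= 6 * (r - l) ->
  lizard_scale k tower (pin i l r).
Proof.
move=> im jlk jrk el er l1 l2 r1 r2 rl.
have sub := pin_sub_tower im l1 l2 r1 r2 rl.
have cP : halfplanes_closed k (pin i l r).
  have -> : pin i l r = [set z | ht z <= 1 / 8] `&` [set z | X i - 1 <= z.1 - cot R k jl * z.2] `&`
      [set z | z.1 - cot R k jr * z.2 <= X i + 1].
    have E z c : kap * c * z.2 = c * ht z by rewrite /ht; ring.
    rewrite el er; apply/seteqP; split => z /=; rewrite !E; first by case.
    by move=> [[h1 h2] h3]; split.
  apply: halfplanes_closedI; last by apply: (halfplanes_closed_right k_gt1).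
  by apply: halfplanes_closedI; [exact: halfplanes_closed_top|apply: (halfplanes_closed_left k_gt1)].
have x0 := XR_ge; have Xi := gate_x_le s_ge im; have Xi0 := Xge0 i; have s1 := s_ge.
split => //.
- apply: convex_lizard_of_halfplanes => //.
    have /bounded_setP [M hM] := @bounded_tower R kap s m kap_gt0 s_ge.
    by apply/bounded_setP; exists M => z /sub; exact: hM.
  exists (pt (X i) 0), (pt (X i + 1 / 2) 0), (pt (X i) (1 / 8)).
  split; try (split; coords; lra).
  by rewrite cross_pt; coords; apply: mulf_neq0; [lra|rewrite invr_eq0].
- move=> T [_ cT] ST TL; apply/seteqP; split => // z Tz.
  have B1 : blocked tower (pin i l r) (0, kap * 1) (1 / 8).
    exists (pt (X i) (1 / 8)), (pt 1 0), (pt 0 1), (1 / 2), 1; rewrite !dot_ht !htpt /=.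
    split; [lra|lra| |lra|].
      by split; [apply/eqP => -[/eqP]; rewrite oner_eq0|lra].
    split; [split; coords; lra|split; coords; lra|].
    by move=> t t0 t1 /towerP [[+ _ _] _ _ _ _]; coords; lra.
  (* The right foot of the gate is inside this side, which continues up to [v = 1/8]. The vector
     [pt 2 1] increases both [v] and [x - v], hence enters the notch to the right of the gate;
     [t < 1/8] keeps it short of the next gate. *)
  have B2 : blocked tower (pin i l r) (1, kap * - r) (X i + 1).
    exists (pt (X i + 1) 0), (pt r 1), (pt 2 1), (1 / 8), (1 / 8); rewrite !dot_ht !htpt /=.
    split; [lra|lra| |lra|].
      by split; [apply: pt_neq0; rewrite oner_eq0|lra].
    split; [split; coords; lra|split; coords; lra|].
    move=> t t0 t1 /towerP [_ _ _ h3 h4]; have [im'|mi] := ltnP i m.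
      by have := h4 i im'; have := gate_xS s i; coords => XSi [] h; lra.
    have mE : m = i by apply/eqP; rewrite eqn_leq im mi.
    by move: h3; rewrite mE; coords => -[] h; lra.
  have B3 : blocked tower (pin i l r) (-1, kap * l) (1 - X i).
    exists (pt (X i - 1) 0), (pt l 1), (pt (-2) 1), (1 / 8), (1 / 8); rewrite !dot_ht !htpt /=.
    split; [lra|lra| |lra|].
      by split; [apply: pt_neq0; rewrite oner_eq0|lra].
    split; [split; coords; lra|split; coords; lra|].
    move=> t t0 t1 /towerP [_ _ h2 _ h4]; have [i0|i0] := posnP i.
      by move: h2; rewrite i0 gate_x0; coords => -[] h; lra.
    have im' : (i.-1 < m)%N by rewrite prednK.
    have := h4 _ im'; have := gate_xS s i.-1; rewrite prednK //; coords => XSi [] h; lra.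
  have := blocked_le cT ST TL B1 Tz; have := blocked_le cT ST TL B2 Tz.
  have := blocked_le cT ST TL B3 Tz; rewrite !dot_ht => h1 h2 h3.
  by split; lra.
Qed.

End TowerScales.

(** * Cycles of scales *)

Section CyclesOfScales.
Variables (R : realType) (k : nat).
Local Notation point := (R * R)%type.

Definition overlap (S T : set point) : Prop := interior S `&` interior T !=set0.

Lemma overlap_sym S T : overlap S T -> overlap T S.
Proof. by rewrite /overlap setIC. Qed.

Lemma not_overlap S T : S `&` T = set0 -> ~ overlap S T.
Proof.
move=> ST [z [/interior_subset Sz /interior_subset Tz]].
by have : (S `&` T) z by []; rewrite ST.
Qed.

Lemma cycle_adj_lt j (x y : 'I_j) : (2 < j)%N -> (x < y)%N ->
  cycle_adj x y = (y == x.+1 :> nat) || ((x == 0 :> nat) && (y == j.-1 :> nat)).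
Proof.
move=> j2 xy; have yj := ltn_ord y; rewrite /cycle_adj -!val_eqE /=.
have -> : (x.+1 %% j = x.+1)%N by rewrite modn_small //; lia.
have [e|ne] := eqVneq y.+1 j; first by rewrite e modnn; lia.
by rewrite modn_small; lia.
Qed.

Lemma cycle_adj_ordS j (x : 'I_j) : (1 < j)%N -> cycle_adj x (ordS x).
Proof.
move=> j1; rewrite /cycle_adj eqxx andbT -val_eqE /=; have xj := ltn_ord x.
have [e|ne] := eqVneq x.+1 j; first by rewrite e modnn; lia.
by rewrite modn_small; lia.
Qed.

Lemma cycle_adj_ordSS j (x : 'I_j) : (3 < j)%N ->
  ordS (ordS x) != x /\ ~~ cycle_adj (ordS (ordS x)) x.
Proof.
move=> j3; rewrite /cycle_adj -!val_eqE /=; have xj := ltn_ord x.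
have [e|ne] := eqVneq x.+1 j.
  rewrite e modnn !modn_small; [|lia|lia]; by split; lia.
rewrite (@modn_small x.+1); last by lia.
have [e|ne'] := eqVneq x.+2 j.
  by rewrite e modnn modn_small; [split; lia|lia].
rewrite (@modn_small x.+2); last by lia.
have [e|ne''] := eqVneq x.+3 j.
  by rewrite e modnn; split; lia.
by rewrite modn_small; [split; lia|lia].
Qed.

(** The graph has all scales as vertices. Injectivity of [f] is not assumed but follows from the
    overlap pattern. *)
Lemma induced_cycle_of_scales (L : set point) j (f : 'I_j -> set point) :
  (3 < j)%N -> lizard k L -> finite_set [set S | lizard_scale k L S] ->
  (forall t, lizard_scale k L (f t)) ->
  (forall x y : 'I_j, (x < y)%N -> cycle_adj x y <-> overlap (f x) (f y)) ->
  exists G : sgraph, MSP_graph R k G /\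
    exists A : {set G}, sgraph_iso (induced_subgraph A) (cycle_graph j).
Proof.
move=> j3 Ll [n /card_esym/card_set_bijP [g [gA ginj gsurj]]] fS fadj_lt.
have fadj x y : x != y -> cycle_adj x y <-> overlap (f x) (f y).
  move=> xy; have [lt|lt|/val_inj e] := ltngtP x y; first exact: fadj_lt.
    rewrite cycle_adj_sym fadj_lt //; split; exact: overlap_sym.
  by rewrite e eqxx in xy.
have finj : injective f.
  move=> x y exy; apply: contrapT => /eqP xy.
  (* If two neighbours had the same scale, then [u] would overlap the successor of [v], to which it
     is not adjacent as [j > 3]. Equal scales at nonadjacent vertices would overlap, having nonempty
     interior. *)
  have key (u v : 'I_j) : f u = f v -> v = ordS u -> False.
    move=> euv vu; have [n1 n2] := cycle_adj_ordSS u j3.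
    move/negP: n2; apply; apply/fadj => //; rewrite euv vu; apply/overlap_sym/fadj.
      by have := cycle_adj_ordS (ordS u) (ltnW (ltnW j3)); rewrite /cycle_adj => /andP[].
    by apply: cycle_adj_ordS; lia.
  have [a|na] := boolP (cycle_adj x y).
    move: a; rewrite /cycle_adj xy /= => /orP[/eqP e|/eqP e]; first exact: key e.
    by apply: key e.
  move/negP: na; apply; apply/fadj => //; rewrite -exy.
  have : overlap (f x) (f (ordS x)).
    apply/fadj; last by apply: cycle_adj_ordS; lia.
    by have := cycle_adj_ordS x (ltnW (ltnW j3)); rewrite /cycle_adj => /andP[].
  by move=> [z [z1 _]]; exists z.
pose gadj (u v : 'I_n) : bool := (u != v) && `[< overlap (g u) (g v) >].
have gsym : symmetric gadj.
  move=> u v; rewrite /gadj eq_sym; congr (_ && _).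
  by apply/asbool_equiv_eq; split; exact: overlap_sym.
have girr : irreflexive gadj by move=> u; rewrite /gadj eqxx.
exists (SGraph gsym girr); split.
  exists L, (fun u : 'I_n => g u); split => //.
    split.
    - by move=> u _ /=; apply: (gA u); rewrite /= ltn_ord.
    - move=> u v _ _ e; apply: val_inj; apply: ginj => //; rewrite ?inE /=; exact: ltn_ord.
    - move=> S /gsurj [u /= un e]; by exists (Ordinal un).
  move=> u v uv; rewrite /= /gadj uv /=; split; [by move/asboolP|by move/asboolP].
have /choice [h hf] : forall t, exists u : 'I_n, g u = f t.
  move=> t; have [u /= un e] := gsurj _ (fS t).
  by exists (Ordinal un).
have hinj : injective h by move=> x y e; apply: finj; rewrite -!hf e.
have hadj x y : gadj (h x) (h y) = cycle_adj x y.
  rewrite /gadj (inj_eq hinj); have [->|xy] /= := eqVneq x y; first by rewrite cycle_adj_irrefl.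
  by rewrite !hf; apply/idP/idP => [/asboolP/fadj|/fadj h1]; [apply|apply/asboolP/h1].
pose A : {set 'I_n} := [set h t | t in 'I_j]%SET.
have memA t : h t \in A by exact: imset_f.
exists A.
have /choice [phi phiP] : forall x : {x : 'I_n | x \in A}, exists t, h t = val x.
  by move=> [x /= /imsetP [t _ ->]]; exists t.
exists phi; split.
  exists (fun t => exist _ (h t) (memA t)) => x.
    by apply: val_inj; rewrite /= phiP.
  by apply: hinj; rewrite phiP.
by move=> x y; rewrite -[LHS]/(cycle_adj (phi x) (phi y)) -hadj !phiP.
Qed.

End CyclesOfScales.

(** * The inverse slopes of the pins as functions of [cos (2 pi/k)] *)

Section Slopes.
Variables (R : realType) (k : nat).
Hypothesis k_gt5 : (5 < k)%N.
Local Notation point := (R * R)%type.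
Local Notation kap := (kappa R k).
Local Notation pt := (pt kap).
Local Notation ht := (ht kap).
Let k_gt1 : (1 < k)%N. Proof. lia. Qed.
Let k_gt0 : (0 < k)%N. Proof. lia. Qed.
Let k_gt2 : (2 < k)%N. Proof. lia. Qed.

Definition cos2 : R := cos (angle R k 2).
Local Notation C := cos2.
(** [rho] and [rho'] are the cotangents of [2 pi/k] and [3 pi/k] divided by that of [pi/k]; see
    [cot2E] and [cot3E]. *)
Definition rho : R := C / (1 + C).
Definition rho' : R := (2 * C - 1) / (2 * C + 1).
(* Wide enough for a pin of slopes [-1, -rho] to miss the pins two gates further on, and
   narrow enough for it to meet the next one below the floor. *)
Definition spacing : R := 1 + 3 * C.

Let angle2 : angle R k 2 = angle R k 1 + angle R k 1.
Proof. by rewrite -angleD. Qed.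

Lemma cos2_cos : C = 2 * cos (angle R k 1) ^+ 2 - 1.
Proof.
rewrite /C angle2 cosD -!expr2; have := cos2Dsin2 (angle R k 1); lra.
Qed.

Lemma cos2_sin : C = 1 - 2 * sin (angle R k 1) ^+ 2.
Proof. by rewrite cos2_cos; have := cos2Dsin2 (angle R k 1); lra. Qed.

Lemma cos3E : cos (angle R k 3) = cos (angle R k 1) * (2 * C - 1).
Proof.
have -> : 3%N = (1 + 2)%N by [].
rewrite angleD angle2 cosD cosD sinD; have h := cos2_cos; have h2 := cos2_sin.
have : cos (angle R k 1) * C = cos (angle R k 1) * (1 - 2 * sin (angle R k 1) ^+ 2) by rewrite -h2.
have : cos (angle R k 1) * C = cos (angle R k 1) * (2 * cos (angle R k 1) ^+ 2 - 1) by rewrite -h.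
lra.
Qed.

Lemma sin3E : sin (angle R k 3) = sin (angle R k 1) * (2 * C + 1).
Proof.
have -> : 3%N = (1 + 2)%N by [].
rewrite angleD angle2 sinD cosD sinD; have h := cos2_cos; have h2 := cos2_sin.
have : sin (angle R k 1) * C = sin (angle R k 1) * (1 - 2 * sin (angle R k 1) ^+ 2) by rewrite -h2.
have : sin (angle R k 1) * C = sin (angle R k 1) * (2 * cos (angle R k 1) ^+ 2 - 1) by rewrite -h.
lra.
Qed.

(** Here [k > 5] enters: the angle [3 pi/k] is at most a right angle, and its cosine is
    [cos (pi/k) * (2 * C - 1)]. *)
Lemma cos2_ge : 1 / 2 <= C.
Proof.
have c0 := @cos1_gt0 R k k_gt2.
have : 0 <= cos (angle R k 3).
  apply: cos_ge0_pihalf; apply/andP; split.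
    rewrite (@le_trans _ _ 0) ?oppr_le0 ?divr_ge0 ?mulr_ge0 ?pi_ge0 //.
  rewrite /angle ler_pdivrMr ?ltr0n //.
  have : 6 <= k%:R :> R by rewrite (ler_nat _ 6).
  by have := pi_gt0 R; nra.
rewrite cos3E pmulr_rge0 //; lra.
Qed.

Lemma cos2_lt : C < 1.
Proof.
have s0 := @sin1_gt0 R k k_gt2; rewrite cos2_sin.
have := mulr_gt0 s0 s0; rewrite -expr2; lra.
Qed.

Lemma cot1E : cot R k 1 = kap * 1.
Proof. by rewrite mulr1. Qed.

Lemma cot2E : cot R k 2 = kap * rho.
Proof.
have c0 := @cos1_gt0 R k k_gt2; have s0 := @sin1_gt0 R k k_gt2.
have c1 := cos2_ge.
have e : sin (angle R k 2) = 2 * sin (angle R k 1) * cos (angle R k 1).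
  by rewrite angle2 sinD; ring.
rewrite /cot -/C e /kappa /rho; have e2 : 1 + C = 2 * cos (angle R k 1) ^+ 2 by rewrite cos2_cos; ring.
by rewrite e2; field; rewrite !gt_eqF.
Qed.

Lemma cot3E : cot R k 3 = kap * rho'.
Proof.
have c0 := @cos1_gt0 R k k_gt2; have s0 := @sin1_gt0 R k k_gt2.
have c1 := cos2_ge.
have d0 : 0 < 2 * C + 1 by lra.
by rewrite /cot cos3E sin3E /kappa /rho'; field; rewrite (gt_eqF s0) (gt_eqF d0).
Qed.

Lemma rhoE : rho * (1 + C) = C.
Proof. by have := cos2_ge => c; rewrite /rho divfK // gt_eqF //; lra. Qed.

Lemma rho_bounds : [/\ 1 / 3 <= rho, rho < 1 / 2, 0 <= rho' & rho' < 1 / 3].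
Proof.
have c1 := cos2_ge; have c2 := cos2_lt; split; rewrite /rho /rho'.
- by rewrite ler_pdivlMr; lra.
- by rewrite ltr_pdivrMr; lra.
- by rewrite divr_ge0; lra.
- by rewrite ltr_pdivrMr; lra.
Qed.

Lemma rhoB : rho - rho' = ((1 + C) * (2 * C + 1))^-1.
Proof. by have c1 := cos2_ge; rewrite /rho /rho'; field; rewrite !gt_eqF //; lra. Qed.

Lemma rhoB_ge : 1 / 6 <= rho - rho'.
Proof.
have c1 := cos2_ge; have c2 := cos2_lt; rewrite rhoB.
have p : 0 < (1 + C) * (2 * C + 1) by apply: mulr_gt0; lra.
have -> : 1 / 6 = 6^-1 :> R by lra.
rewrite lef_pV2 ?posrE //; nra.
Qed.

Lemma rhoB_le : rho - rho' <= 1 / 3.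
Proof.
have c1 := cos2_ge; have c2 := cos2_lt; rewrite rhoB.
have p : 0 < (1 + C) * (2 * C + 1) by apply: mulr_gt0; lra.
have -> : 1 / 3 = 3^-1 :> R by lra.
rewrite lef_pV2 ?posrE //; nra.
Qed.

Lemma spacing_bounds : 5 / 2 <= spacing /\ spacing <= 4.
Proof. by have c1 := cos2_ge; have c2 := cos2_lt; rewrite /spacing; lra. Qed.

End Slopes.

(** * Which pins overlap one another and the bottom scale *)

Section ZigZag.
Variables (R : realType) (k m : nat).
Hypothesis k_gt5 : (5 < k)%N.
Local Notation point := (R * R)%type.
Local Notation kap := (kappa R k).
Local Notation pt := (pt kap).
Local Notation ht := (ht kap).
Local Notation C := (cos2 R k).
Local Notation rho := (rho R k).
Local Notation rho' := (rho' R k).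
Local Notation s := (spacing R k).
Local Notation X := (gate_x s).
Local Notation XR := (right_x s m).
Local Notation tower := (tower kap s m).
Local Notation bottom := (bottom k s m).
Local Notation pin := (pin k s).
Let k_gt1 : (1 < k)%N. Proof. lia. Qed.
Let k_gt0 : (0 < k)%N. Proof. lia. Qed.
Let k_gt2 : (2 < k)%N. Proof. lia. Qed.
Let kap_gt0 : 0 < kap. Proof. exact: kappa_gt0. Qed.
Let htpt x v : ht (pt x v) = v. Proof. exact: ht_pt. Qed.
Let s_ge : 5 / 2 <= s. Proof. by have [] := @spacing_bounds R k k_gt5. Qed.
Let s_le : s <= 4. Proof. by have [] := @spacing_bounds R k k_gt5. Qed.
Let Xge0 i : 0 <= X i. Proof. exact: gate_x_ge0. Qed.
Let sE : s = 1 + 3 * C. Proof. by []. Qed.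
Let C_ge : 1 / 2 <= C. Proof. exact: cos2_ge. Qed.
Let C_lt : C < 1. Proof. exact: cos2_lt. Qed.

Let htdot (z : point) : ht z = dot (0, kap) z.
Proof. by rewrite /dot /= mul0r add0r. Qed.

Let lindot a (z : point) : z.1 - a * ht z = dot (1, - (a * kap)) z.
Proof. by rewrite /dot /ht /=; ring. Qed.

Lemma pin_interior i l r z : ht z < 1 / 8 -> X i - 1 < z.1 - l * ht z ->
  z.1 - r * ht z < X i + 1 -> interior (pin i l r) z.
Proof.
move=> h1 h2 h3.
pose U := [set y | dot (0, kap) y < 1 / 8] `&` [set y | X i - 1 < dot (1, - (l * kap)) y] `&`
    [set y | dot (1, - (r * kap)) y < X i + 1].
have oU : open U.
  by apply: openI; [apply: openI; [exact: open_dot_lt|exact: open_dot_gt]|exact: open_dot_lt].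
have Uz : U z by split; [split|]; rewrite /= -?lindot -?htdot.
have US : U `<=` pin i l r.
  by move=> y [[/= y1 y2] y3]; split; rewrite ?lindot ?htdot ltW.
exact: (filterS US (open_nbhs_nbhs (conj oU Uz))).
Qed.

Lemma bottom_interior z : ht z < - 5 -> -20 < z.1 + ht z -> z.1 - ht z < XR ->
  interior bottom z.
Proof.
move=> h1 h2 h3.
have addE (y : point) : y.1 + ht y = dot (1, kap) y by rewrite /dot /ht /=; ring.
have subE (y : point) : y.1 - ht y = dot (1, - kap) y by rewrite /dot /ht /=; ring.
pose U := [set y | dot (0, kap) y < - 5] `&` [set y | -20 < dot (1, kap) y] `&`
    [set y | dot (1, - kap) y < XR].
have oU : open U.
  by apply: openI; [apply: openI; [exact: open_dot_lt|exact: open_dot_gt]|exact: open_dot_lt].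
have Uz : U z by split; [split|]; rewrite /= -?addE -?subE -?htdot.
have US : U `<=` bottom.
  by move=> y [[/= y1 y2] y3]; split; rewrite ?addE ?subE ?htdot ltW.
exact: (filterS US (open_nbhs_nbhs (conj oU Uz))).
Qed.

(** Below the floor the facing sides do not converge, since [l' <= r]. Above it they come closer by
    at most [1/4], while the gates leave a gap of [s - 2 >= 1/2]. *)
Lemma pin_disjoint g g' l r l' r' : (g < g')%N -> -1 <= l' -> l' <= r -> r <= 1 ->
  pin g l r `&` pin g' l' r' = set0.
Proof.
move=> gg' l1 lr r1; apply/seteqP; split => // z [[h1 h2 h3] [h4 h5 h6]].
have XX := gate_x_lt s_ge gg'; have s1 := s_ge; exfalso.
have [hz|hz] := leP (ht z) 0.
  have : 0 <= (r - l') * - ht z by apply: mulr_ge0; lra.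
  lra.
have p1 : 0 <= (1 - r) * ht z by apply: mulr_ge0; lra.
have p2 : 0 <= (1 + l') * ht z by apply: mulr_ge0; lra.
lra.
Qed.

(** As [1 - rho = 1/(1 + C)], the first pin ends at [v = -2 * (1 + C)], where [rho * v = -2 * C].
    Meeting would thus force the gates to be at most [2 + 4 * C] apart, but their distance is at
    least [2 * s = 2 + 6 * C]. *)
Lemma pin_disjoint_far g g' l' r' : (g.+1 < g')%N -> -1 <= l' -> l' <= rho ->
  pin g (-1) (- rho) `&` pin g' l' r' = set0.
Proof.
move=> gg' l1 lr; apply/seteqP; split => // z [[h1 h2 h3] [h4 h5 h6]].
have XX := gate_x_lt s_ge gg'; have XS' := gate_xS s g; have s1 := s_ge; have sE' := sE; exfalso.
have c1 := C_ge; have c2 := C_lt; have [r1 r2 _ _] := @rho_bounds R k k_gt5.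
have [hz|hz] := leP (ht z) 0; last first.
  have p1 : 0 <= (1 + l') * ht z by apply: mulr_ge0; lra.
  have p2 : 0 <= rho * ht z by apply: mulr_ge0; lra.
  lra.
have rE := @rhoE R k k_gt5.
have p1 : 0 <= (rho - l') * - ht z by apply: mulr_ge0; lra.
have p2 : 0 <= (1 + C) * (2 + (1 - rho) * ht z) by apply: mulr_ge0; lra.
have p3 : (1 + C) * (2 + (1 - rho) * ht z) = 2 * (1 + C) + ht z.
  have -> : (1 + C) * (2 + (1 - rho) * ht z) = 2 * (1 + C) + (1 + C - rho * (1 + C)) * ht z by ring.
  by rewrite rE; ring.
have p4 : 0 <= rho * (2 * (1 + C) + ht z) by apply: mulr_ge0; lra.
have p5 : rho * (2 * (1 + C) + ht z) = 2 * C + rho * ht z.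
  by rewrite -[in RHS]rE; ring.
lra.
Qed.

(** The apex is at [v = -2/(r - l) >= -4]. *)
Lemma pin_disjoint_bottom g l r : 1 / 2 <= r - l -> bottom `&` pin g l r = set0.
Proof.
move=> rl; apply/seteqP; split => // z [[h1 h2 h3] [h4 h5 h6]]; exfalso.
have : 0 <= (r - l - 1 / 2) * - ht z by apply: mulr_ge0; lra.
lra.
Qed.

Lemma pin_overlap_gate g l r l' r' : overlap (pin g l r) (pin g l' r').
Proof.
by exists (pt (X g) 0); split; apply: pin_interior; rewrite htpt /=; lra.
Qed.

Lemma pin_overlap_next g : overlap (pin g (-1) (- rho)) (pin g.+1 rho 1).
Proof.
have c1 := C_ge; have c2 := C_lt; have [r1 r2 _ _] := @rho_bounds R k k_gt5.
have rE := @rhoE R k k_gt5; have XSg := gate_xS s g; have sE' := sE.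
(* On the vertical line midway between the gates, the slopes [-1] and [1] allow heights above
   [-(1 + C) * 6 * C / (4 * C)] and the slopes [-rho] and [rho] heights below
   [-(1 + C) * (6 * C - 2) / (4 * C)]; [v] is the mean of the two. *)
pose v := - ((1 + C) * (6 * C - 1) / (4 * C)).
have vE : v * (4 * C) = - ((1 + C) * (6 * C - 1)).
  by rewrite /v mulNr divfK // gt_eqF //; lra.
have rv : rho * v = - ((6 * C - 1) / 4).
  rewrite /v /rho; field; rewrite !gt_eqF //; lra.
have v0 : v < 0 by nra.
have v1 : - (3 * (1 + C) / 2) < v by nra.
clearbody v.
by exists (pt (X g + s / 2) v); split; apply: pin_interior; rewrite htpt /= ?XSg; lra.
Qed.

Lemma pin_overlap_last g : overlap (pin g (-1) (- rho)) (pin g.+1 rho' rho).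
Proof.
have c1 := C_ge; have c2 := C_lt; have [r1 r2 r3 r4] := @rho_bounds R k k_gt5.
have rE := @rhoE R k k_gt5; have XSg := gate_xS s g; have sE' := sE.
(* Relative to gate [g], the apex of the first pin is [(1 + 2 * C, -2 * (1 + C))]. The witness is
   this apex shrunk by [e] towards the middle of the gate, with [e] close enough to 1 for its
   abscissa to exceed [s - 1 = 3 * C]. *)
pose e := 1 - (1 - C) / 4; have e0 : 3 / 4 <= e by rewrite /e; lra.
have e1 : e < 1 by rewrite /e; lra.
pose v := - (2 * (1 + C) * e); pose x := e * (1 + 2 * C).
have rv : rho * v = - (2 * C * e) by rewrite /v -[in RHS]rE; ring.
have v0 : v < 0 by rewrite /v; nra.
have rv' : rho' * v <= 0 by rewrite mulr_ge0_le0 // ltW.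
have eC : e * C < C by rewrite gtr_pMl //; lra.
have x1 : 3 * C < x by rewrite /x /e; nra.
have xv : x + v = - e by rewrite /x /v; ring.
have xr : x + rho * v = e by rewrite rv /x; ring.
have xr' : x - rho * v = e + 4 * (e * C) by rewrite rv /x; ring.
clearbody x v e.
by exists (pt (X g + x) v); split; apply: pin_interior; rewrite htpt /= ?XSg; lra.
Qed.

(** As [rho - rho' <= 1/3], the apex is at or below [v = -6]. The witness is on the median of the
    pin, halfway between [-6] and [-5]. *)
Lemma bottom_overlap_left g : (g <= m)%N -> overlap bottom (pin g rho' rho).
Proof.
move=> gm; have Xg := gate_x_le s_ge gm; have Xg0 := Xge0 g.
have XRE : XR = X m + 20 by [].
have [r1 r2 r3 r4] := @rho_bounds R k k_gt5; have rr := @rhoB_le R k k_gt5.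
by exists (pt (X g - (rho + rho') * (11 / 4)) (- (11 / 2))); split;
  [apply: bottom_interior|apply: pin_interior]; rewrite htpt /=; lra.
Qed.

Lemma bottom_overlap_right g : (g <= m)%N -> overlap bottom (pin g (- rho) (- rho')).
Proof.
move=> gm; have Xg := gate_x_le s_ge gm; have Xg0 := Xge0 g.
have XRE : XR = X m + 20 by [].
have [r1 r2 r3 r4] := @rho_bounds R k k_gt5; have rr := @rhoB_le R k k_gt5.
by exists (pt (X g + (rho + rho') * (11 / 4)) (- (11 / 2))); split;
  [apply: bottom_interior|apply: pin_interior]; rewrite htpt /=; lra.
Qed.

End ZigZag.

(** * The cycle formed by the bottom scale and the zigzag of pins *)

Section Cycle.
Variables (R : realType) (j k : nat).
Hypothesis j_gt3 : (3 < j)%N.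
Hypothesis k_gt5 : (5 < k)%N.
Local Notation point := (R * R)%type.
Local Notation kap := (kappa R k).
Local Notation rho := (rho R k).
Local Notation rho' := (rho' R k).
Local Notation s := (spacing R k).
Let m := (j.-2)./2.
Local Notation tower := (tower kap s m).
Local Notation bottom := (bottom k s m).
Local Notation pin := (pin k s).
Let k_gt2 : (2 < k)%N. Proof. lia. Qed.
Let k_gt1 : (1 < k)%N. Proof. lia. Qed.
Let s_ge : 5 / 2 <= s. Proof. by have [] := @spacing_bounds R k k_gt5. Qed.
Let s_le : s <= 4. Proof. by have [] := @spacing_bounds R k k_gt5. Qed.

(* The first and the last pin taper more slowly, and hence reach [bottom]. *)
Definition steep u := (u == 0%N) || (u == j.-2).

(** The pin of an even [u] descends to the left from gate [u./2], that of an odd [u] to the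
    right. *)
Definition zigzag u : set point :=
  if odd u then if steep u then pin u./2 (- rho) (- rho') else pin u./2 (-1) (- rho)
  else if steep u then pin u./2 rho' rho else pin u./2 rho 1.

Definition cycle_scale (t : 'I_j) : set point :=
  if (t : nat) is u.+1 then zigzag u else bottom.

Lemma zigzag_scale u : (u < j.-1)%N -> lizard_scale k tower (zigzag u).
Proof.
move=> uj; have um : (u./2 <= m)%N by rewrite /m; apply: half_leq; lia.
have ik i : (0 < i < 6)%N -> (0 < i < k)%N /\ (0 < k - i < k)%N by lia.
have [[k1 k1'] [k2 k2'] [k3 k3']] := And3 (ik 1%N isT) (ik 2%N isT) (ik 3%N isT).
have [r1 r2 r3 r4] := @rho_bounds R k k_gt5; have rr := @rhoB_ge R k k_gt5.
have c1 := @cot1E R k; have c2 := @cot2E R k k_gt5; have c3 := @cot3E R k k_gt5.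
have cN i : (0 < i < k)%N -> cot R k (k - i) = - cot R k i by exact: cotN.
have N1 : cot R k (k - 1) = kap * -1 by rewrite cN // c1; ring.
have N2 : cot R k (k - 2) = kap * - rho by rewrite cN // c2; ring.
have N3 : cot R k (k - 3) = kap * - rho' by rewrite cN // c3; ring.
rewrite /zigzag; case: ifP => _; case: ifP => _.
- by apply: (@pin_scale _ _ _ _ k_gt2 s_ge _ _ _ (k - 2) (k - 3)) => //; lra.
- by apply: (@pin_scale _ _ _ _ k_gt2 s_ge _ _ _ (k - 1) (k - 2)) => //; lra.
- by apply: (@pin_scale _ _ _ _ k_gt2 s_ge _ _ _ 3 2) => //; lra.
- by apply: (@pin_scale _ _ _ _ k_gt2 s_ge _ _ _ 2 1) => //; lra.
Qed.

Lemma cycle_scaleP t : lizard_scale k tower (cycle_scale t).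
Proof.
rewrite /cycle_scale; case: t => -[|u] /= uj; first exact: bottom_scale.
by apply: zigzag_scale; lia.
Qed.

Lemma bottom_zigzag u : (u < j.-1)%N -> steep u <-> overlap bottom (zigzag u).
Proof.
move=> uj; have um : (u./2 <= m)%N by rewrite /m; apply: half_leq; lia.
have [r1 r2 r3 r4] := @rho_bounds R k k_gt5.
rewrite /zigzag; case: ifP => uo; case: ifP => us; split => //.
- by move=> _; exact: bottom_overlap_right.
- by move=> h; case: (not_overlap _ h); apply: pin_disjoint_bottom; lra.
- by move=> _; exact: bottom_overlap_left.
- by move=> h; case: (not_overlap _ h); apply: pin_disjoint_bottom; lra.
Qed.

Lemma zigzag_next u : (u.+1 < j.-1)%N -> overlap (zigzag u) (zigzag u.+1).
Proof.
move=> uj; rewrite /zigzag /=; case: (boolP (odd u)) => /= uo.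
  (* Being odd, [u] is not the first pin; having a successor, it is not the last. *)
  have -> : steep u = false by rewrite /steep; apply/norP; split; [case: u uo uj|lia].
  have -> : uphalf u = (u./2).+1 by rewrite uphalf_half uo.
  case: ifP => _; [exact: pin_overlap_last|exact: pin_overlap_next].
rewrite uphalf_half (negbTE uo) add0n.
by case: ifP => _; case: ifP => _; exact: pin_overlap_gate.
Qed.

(** The facing sides converge only when [u] is odd and [u'] is even. Then [u'] is at least [u + 3],
    so the gates are at least two apart and [pin_disjoint_far] applies. *)
Lemma zigzag_disjoint u u' : (u.+1 < u')%N -> (u' < j.-1)%N ->
  zigzag u `&` zigzag u' = set0.
Proof.
move=> uu uj; have [r1 r2 r3 r4] := @rho_bounds R k k_gt5.
have gg : (u./2 < u'./2)%N by lia.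
have near l r l' r' := @pin_disjoint R k k_gt5 u./2 u'./2 l r l' r' gg.
have us : odd u -> steep u = false.
  by move=> uo; rewrite /steep; apply/norP; split; [case: u uo uu {gg near}|lia].
rewrite /zigzag; case: (boolP (odd u)) => uo.
  rewrite us //; case: (boolP (odd u')) => uo'.
    by case: ifP => _; apply: near; lra.
  have gg2 : ((u./2).+1 < u'./2)%N by lia.
  by case: ifP => _; apply: (pin_disjoint_far k_gt5) => //; lra.
by case: ifP => _; case: ifP => _; case: ifP => _; apply: near; lra.
Qed.

End Cycle.

Theorem proposition3p6 (R : realType) (j k : nat)
    (hj : (3 < j)%N) (hk : (5 < k)%N) :
  exists G : sgraph, MSP_graph R k G /\
    exists A : {set G}, sgraph_iso (induced_subgraph A) (cycle_graph j).
Proof.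
have [s_ge s_le] := @spacing_bounds R k hk.
have k_gt2 : (2 < k)%N by lia.
apply: (@induced_cycle_of_scales R k (tower (kappa R k) (spacing R k) (j.-2)./2) j
  (@cycle_scale R j k)) => //.
- exact: tower_lizard.
- exact: finite_tower_scales.
- exact: cycle_scaleP.
move=> x y xy; rewrite cycle_adj_lt //; last by lia.
have yj := ltn_ord y; rewrite /cycle_scale.
case: y xy yj => -[//|v] /= yj' xy yj; case: x xy => -[|u] /= xj' xy.
  rewrite -bottom_zigzag //; last by lia.
  (* The neighbours of vertex 0 are the vertices [1] and [j - 1], that is the pins [0] and [j - 2],
     which are the steep ones. *)
  by rewrite /steep eqSS; have -> : (v.+1 == j.-1)%N = (v == j.-2) by lia.
rewrite orbF !eqSS; split => [/eqP ->|].
  by apply: zigzag_next; lia.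
apply: contraPT => vu; apply: not_overlap; apply: zigzag_disjoint => //; lia.
Qed.
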